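(* Let $F$ be a field, let $A$ be a semi-simple $F$-algebra and let $B=\mathrm{Mat}_n(\Delta)$ be a simple $F$-algebra, where $\Delta$ is a division algebra over $F$. Let $\mathcal{O}_{A,B}$, $\widetilde D_i$, $D_i$, $R_i$, $\mathfrak m_{R_i}$, $Z_i$ ($i=1,\dots,t$) and $P(A,B)$ be the objects attached to $A$ and $B$ as defined in the context. (1) The orbit set $\mathcal{O}_{A,B}$ is infinite if and only if there is an element $(x_1,\dots,x_t)\in P(A,B)$ such that $$\dim_{Z_i}\mathfrak m_{R_i}/\mathfrak m_{R_i}^2\ge 2\quad\text{and}\quad x_i\ge 2$$ for some $i\in\{1,\dots,t\}$. (2) Suppose the orbit set $\mathcal{O}_{A,B}$ is finite, that is, for every element $(x_1,\dots,x_t)\in P(A,B)$, one has, for all $i\in\{1,\dots,t\}$, either $\dim_{Z_i}\mathfrak m_{R_i}/\mathfrak m_{R_i}^2\le 1$ or $x_i\le 1$. Then $$|\mathcal{O}_{A,B}|=\sum_{(x_1,\dots,x_t)\in P(A,B)}\ \prod_{i=1}^t|\mathrm{Mod}(\widetilde D_i,x_i)|,$$ where $\mathrm{Mod}(\widetilde D_i,x_i)$ is the set of isomorphism classes of $\widetilde D_i$-modules $W$ with $\mathrm{length}\,W=x_i$. The cardinality $|\mathrm{Mod}(\widetilde D_i,x_i)|$ is given by $$|\mathrm{Mod}(\widetilde D_i,x_i)|=\begin{cases}1&\text{if } x_i\le 1,\\ p(x_i,e_i)&\text{if } x_i>1\text{ and }\dim_{Z_i}\mathfrak m_{R_i}/\mathfrak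 m_{R_i}^2=1,\end{cases}$$ where $e_i$ is the smallest positive integer such that $\mathfrak m_{R_i}^{e_i}=0$, and $p(x,e)$ denotes the number of all partitions $x=c_1+\dots+c_s$ of $x$ with each part $c_i\le e$.
   Context: All $F$-algebras are finite-dimensional over the (arbitrary) field $F$; $F$-algebra homomorphisms send the identity to the identity. $\mathrm{Hom}_{F\text{-alg}}(A,B)$ is the set of $F$-algebra homomorphisms $A\to B$; the group $B^\times$ acts on it on the left by $(b\cdot\varphi)(a)=b\,\varphi(a)\,b^{-1}$, and $\mathcal{O}_{A,B}:=B^\times\backslash\mathrm{Hom}_{F\text{-alg}}(A,B)$. For an $F$-algebra $C$, $C^{ss}:=C/\mathrm{rad}(C)$ with $\mathrm{rad}(C)$ the Jacobson radical; $Z(C)$ is the center; $A^{\mathrm{o}}$ is the opposite algebra. Write the Wedderburn decomposition $(\Delta\otimes_F A^{\mathrm{o}})^{ss}\simeq\prod_{i=1}^t\mathrm{Mat}_{m_i}(D_i)$ with $D_i$ division $F$-algebras. The algebra $\Delta\otimes_F A^{\mathrm{o}}$ then has the form $$\Delta\otimes_F A^{\mathrm{o}}\simeq\prod_{i=1}^t\mathrm{Mat}_{m_i}(\widetilde D_i),$$ where each $\widetilde D_i$ is an Artinian $F$-algebra with $(\widetilde D_i)^{ss}=D_i$; fix such a decomposition. Put $R_i:=Z(\widetilde D_i)$ (a local commutative Artinian ring), let $\mathfrak m_{R_i}$ be its maximal ideal, and put $Z_i:=Z(D_i)=(R_i)^{ss}=R_i/\mathfrak m_{R_i}$. Since $\Delta$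 embeds in $\mathrm{Mat}_{m_i}(D_i)$, $[\Delta:F]$ divides $m_i[D_i:F]$; put $\ell_i:=m_i[D_i:F]/[\Delta:F]\in\mathbb N$. Put $$P(A,B):=\Big\{(x_1,\dots,x_t)\in\mathbb Z_{\ge 0}^t\ :\ n=\sum_{i=1}^t\ell_ix_i\Big\}$$ (here $n=\dim_\Delta V$ where $V=\Delta^n$ is the right $\Delta$-module with $B=\mathrm{End}_\Delta(V)$). $\widetilde D_i$-modules are finite-dimensional right modules. *)

(* Defs.v *)
From HB Require Import structures.
From mathcomp Require Import all_boot all_order all_algebra all_field.
From mathcomp Require Import finmap.
From mathcomp Require Import boolp classical_sets functions cardinality fsbigop.

Set Implicit Arguments.
Unset Strict Implicit.
Unset Printing Implicit Defensive.

Import GRing.Theory.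

Local Open Scope classical_set_scope.
Local Open Scope ring_scope.

(* [fset_set S] is empty when [S] is infinite, so [ncard S] is the number of
   elements of [S] only when [S] is finite. *)
Definition ncard (T : choiceType) (S : set T) : nat := #|` fset_set S|%fset.

(** * Finite-dimensional algebras *)

(* Throughout, [falgType F] is the type of nonzero, unital, not necessarily
   commutative finite-dimensional [F]-algebras. *)

(* The library equips the converse [A^c] with its ring structure only. *)
Section OppositeAlgebra.
Variables (F : fieldType) (A : falgType F).

HB.instance Definition _ := GRing.Lmodule.on A^c.

Let opp_scalerAl (c : F) (x y : A^c) : c *: (x * y) = (c *: x : A^c) * y.
Proof. exact: (@scalerAr F A c y x). Qed.

HB.instance Definition _ := GRing.Lmodule_isLalgebra.Build F A^c opp_scalerAl.

Let opp_scalerAr (c : F) (x y : A^c) : c *: (x * y) = x * (c *: y : A^c).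
Proof. exact: (@scalerAl F A c y x). Qed.

HB.instance Definition _ := GRing.Lalgebra_isAlgebra.Build F A^c opp_scalerAr.
HB.instance Definition _ := Vector.on A^c.
End OppositeAlgebra.

(* [T], with [b |-> b (x) 1] and [c |-> 1 (x) c], is the tensor product of [B]
   and [C] over [F]: the bilinear map [(b, c) |-> b (x) c = i b * j c] is
   universal, and [(b (x) c) (b' (x) c') = b b' (x) c c']. *)
Definition is_tensor_product (F : fieldType) (B C T : falgType F)
    (i : {lrmorphism B -> T}) (j : {lrmorphism C -> T}) : Prop :=
  (forall b c, i b * j c = j c * i b) /\
  (forall (W : lmodType F) (beta : {bilinear B -> C -> W}),
     exists2 h : {linear T -> W},
       forall b c, h (i b * j c) = beta b c &
       forall h' : {linear T -> W},
         (forall b c, h' (i b * j c) = beta b c) -> h' =1 h).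

Section Radical.
Variables (F : fieldType) (C : falgType F).
Implicit Types L : {vspace C}.

(* A left ideal is stable under [c%:A] for [c : F], hence is a subspace. *)
Definition left_ideal L : Prop := ({:C} * L <= L)%VS.

Definition maximal_left_ideal L : Prop :=
  [/\ left_ideal L, L != fullv &
      forall L', left_ideal L' -> (L <= L')%VS -> L' = L \/ L' = fullv].

Definition in_jacobson_radical (x : C) : Prop :=
  forall L, maximal_left_ideal L -> x \in L.

Definition semisimple_algebra : Prop :=
  forall x, in_jacobson_radical x -> x = 0.

Definition division_algebra : Prop :=
  forall x : C, x != 0 -> x \is a GRing.unit.
End Radical.

(* [pi] identifies [D] with [C^ss = C / rad C]. *)
Definition is_ss_quotient (F : fieldType) (C D : falgType F)
    (pi : {lrmorphism C -> D}) : Prop :=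
  (forall y, exists x, pi x = y) /\
  (forall x, pi x = 0 <-> in_jacobson_radical x).

(** * Homomorphisms into matrix algebras *)

Section MatrixAlgebra.
Variables (F : fieldType) (A D : falgType F) (n : nat).

(* ['M[D]_n] is an [F]-algebra for the entrywise scaling by [F]; the library
   only provides its scaling by [D]. *)
Definition is_mx_alg_hom (f : A -> 'M[D]_n) : Prop :=
  [/\ zmod_morphism f, monoid_morphism f &
      forall (c : F) (a : A), f (c *: a) = map_mx ( *:%R c) (f a)].

Definition alg_homs : set (A -> 'M[D]_n) := [set f | is_mx_alg_hom f].

Definition conj_orbit (f : A -> 'M[D]_n) : set (A -> 'M[D]_n) :=
  [set g | exists b b' : 'M[D]_n,
     [/\ b *m b' = 1%:M, b' *m b = 1%:M & forall a, g a = b *m f a *m b']].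

Definition orbit_set : set (set (A -> 'M[D]_n)) :=
  [set conj_orbit f | f in alg_homs].
End MatrixAlgebra.

(* The maps [Phi i] are the components of an isomorphism of [F]-algebras
   [T ~ \prod_i 'M[D i]_(m i)]. *)
Definition is_mx_prod_iso (F : fieldType) (T : falgType F) (t : nat)
    (m : 'I_t -> nat) (D : 'I_t -> falgType F)
    (Phi : forall i, T -> 'M[D i]_(m i)) : Prop :=
  (forall i, is_mx_alg_hom (Phi i)) /\
  (forall y : forall i, 'M[D i]_(m i), exists! x, forall i, Phi i x = y i).

Arguments orbit_set {F} A D n.

(** * Ideals of a commutative subalgebra *)

Section Ideals.
Variables (F : fieldType) (C : falgType F).
Implicit Types R I m : {vspace C}.

(* Here [R] is a commutative subalgebra of [C]. *)
Definition ideal_of R I : Prop := (I <= R)%VS /\ (R * I <= I)%VS.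

Definition maximal_ideal_of R m : Prop :=
  [/\ ideal_of R m, m != R &
      forall I, ideal_of R I -> (m <= I)%VS -> I = m \/ I = R].

(* The classes of [v_0, ..., v_(d-1)] form a basis of the [R/m]-vector space
   [m/m^2]. *)
Definition cotangent_basis R m (d : nat) (v : 'I_d -> C) : Prop :=
  [/\ forall k, v k \in m,
      forall w, w \in m -> exists2 r : 'I_d -> C, forall k, r k \in R &
        w - \sum_(k < d) r k * v k \in (m ^+ 2)%VS &
      forall r : 'I_d -> C, (forall k, r k \in R) ->
        \sum_(k < d) r k * v k \in (m ^+ 2)%VS -> forall k, r k \in m].

(* [dim_(R/m) m/m^2 = d] *)
Definition has_cotangent_dim R m (d : nat) : Prop :=
  exists v : 'I_d -> C, cotangent_basis R m v.

(* [e] is the smallest positive integer with [m^e = 0] *)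
Definition is_nilpotency_index m (e : nat) : Prop :=
  [/\ (0 < e)%N, (m ^+ e)%VS = 0%VS &
      forall k, (0 < k)%N -> (m ^+ k)%VS = 0%VS -> (e <= k)%N].
End Ideals.

(** * Modules *)

Section Modules.
Variable S : nzRingType.

Definition submodule (W : lmodType S) (N : set W) : Prop :=
  N 0 /\ forall (a : S) u v, N u -> N v -> N (a *: u + v).

(* [W] has a composition series of length [x]. *)
Definition has_length (W : lmodType S) (x : nat) : Prop :=
  exists N : nat -> set W,
    [/\ forall k, (k <= x)%N -> submodule (N k),
        N 0%N = [set 0], N x = setT &
        forall k, (k < x)%N ->
          N k `<` N k.+1 /\
          forall N', submodule N' -> N k `<=` N' -> N' `<=` N k.+1 ->
            N' = N k \/ N' = N k.+1].

Definition module_iso (U V : lmodType S) : Prop :=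
  exists f : {linear U -> V}, bijective f.
End Modules.

(* Right [D]-modules are left modules over [D^c]. Those of finite length are
   finite-dimensional over [F]. The set [Mod(D, x)] of isomorphism classes lives
   in too large a universe for [set], so that [|Mod(D, x)| = k] is stated with a
   family of [k] representatives. *)
Section CountingModules.
Variables (F : fieldType) (D : falgType F) (x : nat).

Definition Mod_has_card (k : nat) : Prop :=
  exists W : 'I_k -> lmodType D^c,
    [/\ forall a, has_length (W a) x,
        forall a b, module_iso (W a) (W b) -> a = b &
        forall V : lmodType D^c, has_length V x -> exists a, module_iso V (W a)].

Definition Mod_finite : Prop := exists k, Mod_has_card k.

(* [|Mod(D, x)|], meaningful when [Mod(D, x)] is finite. *)
Definition Mod_card : nat := xget 0%N [set k | Mod_has_card k].
End CountingModules.

(** * Partitions *)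

Definition partitions (x e : nat) : set (seq nat) :=
  [set s | [/\ sorted geq s, all (fun c => 0 < c <= e)%N s & sumn s = x]].

Definition npartitions (x e : nat) : nat := ncard (partitions x e).

(* [P(A, B)] for [B = 'M[Delta]_n]; the quotient [l_i] is exact as soon as
   [Delta] embeds into ['M[D i]_(m i)]. *)
Definition multiplicity_vectors (F : fieldType) (Delta : falgType F) (n t : nat)
    (m : 'I_t -> nat) (D : 'I_t -> falgType F) : set {ffun 'I_t -> nat} :=
  [set x | n = (\sum_(i < t) (m i * \dim {:D i} %/ \dim {:Delta}) * x i)%N].

(* Main.v *)
(** Conjugacy classes of homomorphisms [A -> 'M[Delta]_n] are the
isomorphism classes of right [T]-modules of [F]-dimension [n * \dim Delta],
[T = Delta (x) A^o], and by Morita theory these are the tuples of right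
[D' i]-modules [W i]; as all simple [D' i]-modules are [D i], the length of [W i]
is [\dim (W i) / \dim (D i)], and the condition on the dimension becomes
[x \in P].

The structure of [D' i] comes from a property inherited by tensor products and
by matrix corners: there are finitely many sums [psi_j] of maps
[x |-> p x q], with central values, such that [x = \sum_j g_j psi_j(x)].  For a
local algebra with centre [R] it yields [rad = m D'] and an [R]-linear
retraction [D' -> R], so that [I D' :&: R = I] for the ideals [I] of [R].

If [dim m/m^2 <= 1] then [rad = a D'] with [a] central, and the modules are the
sums of the [D'/a^c D'], [c <= e].  If [v_0, v_1] are independent in [m/m^2],
the quotients of [D'] by the ideals generated by the hyperplanes [H_lam] of [m]
that contain [v_0 - lam v_1] and the other basis vectors but not [v_1] have
length 2 and pairwise distinct annihilators; and [F] is infinite, since over a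
finite field the centre of [T] is reduced. *)

Require Import Defs.
From HB Require Import structures.
From mathcomp Require Import all_boot all_order all_algebra all_field.
From mathcomp Require Import finmap.
From mathcomp Require Import boolp classical_sets functions cardinality fsbigop.

Set Implicit Arguments.
Unset Strict Implicit.
Unset Printing Implicit Defensive.

Import GRing.Theory.

Local Open Scope classical_set_scope.
Local Open Scope ring_scope.

(** No separability is assumed, so [T] need not be semisimple and its blocks [D' i] are not given by
    any explicit formula. The identity [x = \sum_j g_j psi_j(x)] is an elementary form of the
    statement that an algebra is Azumaya over its centre: the [g_j] and [psi_j] are dual bases over
    the centre, and the [psi_j] belong to the image of the enveloping algebra. This form is
    transported by explicit formulas, and the centre of a tensor product or of a block never has to
    be computed. Each [psi_j] maps a two-sided ideal into its intersection with the centre, so such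
    ideals are generated by central elements; a [psi_j] with [psi_j(1)] invertible, once normalized,
    is the retraction. On the side of modules, dimensions over [F] do the work: lengths are
    dimensions divided by that of the residue algebra, an injective equivariant map between spaces
    of equal dimension is an isomorphism, and non-isomorphic modules are told apart by the ranks of
    central elements. *)

Lemma ex_max_nat (X : Type) (Q : X -> Prop) (f : X -> nat) (N : nat) :
  (exists x, Q x) -> (forall x, Q x -> (f x <= N)%N) ->
  exists2 x, Q x & forall y, Q y -> (f y <= f x)%N.
Proof.
move=> [x0 Qx0] fN.
have exP : exists n, `[< exists2 x, Q x & f x = n >].
  by exists (f x0); apply/asboolP; exists x0.
have ubP n : `[< exists2 x, Q x & f x = n >] -> (n <= N)%N.
  by move=> /asboolP[x /fN + <-].
case: (ex_maxnP exP ubP) => n /asboolP[x Qx <-] xmax.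
by exists x => // y Qy; apply: xmax; apply/asboolP; exists y.
Qed.

Lemma ex_min_nat (X : Type) (Q : X -> Prop) (f : X -> nat) :
  (exists x, Q x) -> exists2 x, Q x & forall y, Q y -> (f x <= f y)%N.
Proof.
move=> [x0 Qx0].
have exP : exists n, `[< exists2 x, Q x & f x = n >].
  by exists (f x0); apply/asboolP; exists x0.
case: (ex_minnP exP) => n /asboolP[x Qx <-] xmin.
by exists x => // y Qy; apply: xmin; apply/asboolP; exists y.
Qed.

Lemma dimv_le_full (F : fieldType) (V : vectType F) (U : {vspace V}) :
  (\dim U <= \dim {:V})%N.
Proof. exact/dimvS/subvf. Qed.

(** A subspace of maximal dimension inside [P] is all of [P], since otherwise a line could be added.
    Linear conditions thereby become subspaces, to which dimension counts apply. *)
Lemma vspace_pred (F : fieldType) (V : vectType F) (P : V -> Prop) :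
  P 0 -> (forall c u v, P u -> P v -> P (c *: u + v)) ->
  exists U : {vspace V}, forall v, v \in U <-> P v.
Proof.
move=> P0 Plin.
have [] := @ex_max_nat _ (fun U : {vspace V} => forall v, v \in U -> P v)
  (fun U => \dim U) (\dim {:V}).
- by exists 0%VS => v; rewrite memv0 => /eqP ->.
- by move=> U _; exact: dimv_le_full.
move=> U UP Umax; exists U => v; split; first exact: UP.
move=> Pv.
have UvP w : w \in (U + <[v]>)%VS -> P w.
  move=> /memv_addP[u uU [_ /vlineP[c ->] ->]].
  by rewrite addrC; apply: Plin => //; apply: UP.
have := Umax _ UvP; rewrite (geq_leqif (dimv_leqif_sup (addvSl U <[v]>))).
by rewrite subv_add subvv -memvE.
Qed.

(** * Central frames *)

(** The action of the enveloping algebra on [S], generated syntactically so that properties of the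
    operators are proved by induction. *)
Inductive mulop (S : nzRingType) : (S -> S) -> Prop :=
| mulop_id : mulop (fun x => x)
| mulop_l p f : mulop f -> mulop (fun x => p * f x)
| mulop_r p f : mulop f -> mulop (fun x => f x * p)
| mulop_add f g : mulop f -> mulop g -> mulop (fun x => f x + g x).

Definition central (S : nzRingType) (z : S) := forall y, z * y = y * z.

Section Mulop.
Variable S : nzRingType.
Implicit Types (f g : S -> S).

Lemma mulop_ext f g : f =1 g -> mulop f -> mulop g.
Proof. by move=> /funext ->. Qed.

Lemma mulop0 : mulop (fun _ : S => 0).
Proof. by apply: mulop_ext (mulop_l 0 (mulop_id S)) => x; rewrite mul0r. Qed.

Lemma mulop_sub f g : mulop f -> mulop g -> mulop (fun x => f x - g x).
Proof.
move=> mf mg; apply: mulop_ext (mulop_add mf (mulop_l (-1) mg)) => x.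
by rewrite mulN1r.
Qed.

Lemma mulop_sum (I : Type) (r : seq I) (f : I -> S -> S) :
  (forall i, mulop (f i)) -> mulop (fun x => \sum_(i <- r) f i x).
Proof.
move=> mf; elim: r => [|i r IHr].
  by apply: mulop_ext mulop0 => x; rewrite big_nil.
by apply: mulop_ext (mulop_add (mf i) IHr) => x; rewrite big_cons.
Qed.

Lemma mulop_comp f g : mulop f -> mulop g -> mulop (fun x => f (g x)).
Proof.
move=> mf mg; elim: mf => //= [p h _ IH | p h _ IH | h k _ IHh _ IHk].
- exact: (mulop_l p IH).
- exact: (mulop_r p IH).
- exact: (mulop_add IHh IHk).
Qed.

Lemma mulop0E f : mulop f -> f 0 = 0.
Proof.
by elim=> // [p h _ ->|p h _ ->|h k _ -> _ ->]; rewrite ?mulr0 ?mul0r ?addr0.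
Qed.

Lemma mulopD f x y : mulop f -> f (x + y) = f x + f y.
Proof.
elim=> // [p h _ ->|p h _ ->|h k _ -> _ ->]; rewrite ?mulrDr ?mulrDl //.
by rewrite addrACA.
Qed.

Lemma mulop_sumE f I (r : seq I) (P : pred I) (x : I -> S) : mulop f ->
  f (\sum_(i <- r | P i) x i) = \sum_(i <- r | P i) f (x i).
Proof.
move=> mf; apply: (big_morph f (fun a b => mulopD a b mf) (mulop0E mf)).
Qed.

Lemma mulop_central f z x : mulop f -> central z -> f (z * x) = z * f x.
Proof.
move=> mf cz; elim: mf => // [p h _ ->|p h _ ->|h k _ -> _ ->].
- by rewrite mulrA -cz mulrA.
- by rewrite mulrA.
- by rewrite mulrDr.
Qed.

End Mulop.

(** * Left ideals and central idempotents of a semisimple algebra *)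

Section SemisimpleAlgebra.
Variables (F : fieldType) (A : falgType F).
Implicit Types (L : {vspace A}).

Lemma left_idealP L : left_ideal L <-> forall a x, x \in L -> a * x \in L.
Proof.
split=> [/prodvP h a x xL | h]; first by apply: h => //; exact: memvf.
by apply/prodvP => a x _; exact: h.
Qed.

Lemma left_ideal_capv L1 L2 :
  left_ideal L1 -> left_ideal L2 -> left_ideal (L1 :&: L2)%VS.
Proof.
move=> /left_idealP h1 /left_idealP h2; apply/left_idealP => a x.
by rewrite !memv_cap => /andP[x1 x2]; rewrite h1 ?h2.
Qed.

Lemma left_ideal_addv L1 L2 :
  left_ideal L1 -> left_ideal L2 -> left_ideal (L1 + L2)%VS.
Proof.
move=> /left_idealP h1 /left_idealP h2; apply/left_idealP => a v.
move=> /memv_addP[x x1 [y y2 ->]]; rewrite mulrDr.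
by apply: memv_add; [apply: h1 | apply: h2].
Qed.

Lemma left_ideal_principal y :
  exists L, left_ideal L /\ forall x, x \in L <-> exists a, x = a * y.
Proof.
have [|c _ _ [a ->] [b ->]|L LP] := @vspace_pred F A (fun x => exists a, x = a * y).
- by exists 0; rewrite mul0r.
- by exists (c *: a + b); rewrite mulrDl scalerAl.
exists L; split=> //; apply/left_idealP => a x /LP[b ->]; apply/LP.
by exists (a * b); rewrite mulrA.
Qed.

Lemma maximal_left_ideal_addv M L : maximal_left_ideal M -> left_ideal L ->
  ~ (L <= M)%VS -> (L + M)%VS = fullv.
Proof.
move=> [lM _ maxM] lL nLM.
have [E|//] := maxM _ (left_ideal_addv lL lM) (addvSr L M).
by case: nLM; rewrite -E addvSl.
Qed.

(** If a maximal left ideal [M] misses [x], then [1 = a x + u] with [u] in [M]; multiplying by [x]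
    on the left gives [x = x u], which is in [M]. *)
Lemma nil_in_jacobson_radical (x : A) : (forall a, x * a * x = 0) ->
  in_jacobson_radical x.
Proof.
move=> xAx M mM; apply/negPn/negP => nxM.
have [L [lL LP]] := left_ideal_principal x.
have nLM : ~ (L <= M)%VS.
  move=> /subvP LM; move: nxM; rewrite LM //; apply/LP.
  by exists 1; rewrite mul1r.
have := memvf (1 : A); rewrite -(maximal_left_ideal_addv mM lL nLM).
move=> /memv_addP[_ /LP[a ->] [u uM E]].
move/negP: nxM; apply; rewrite -[x]mulr1 E mulrDr mulrA xAx add0r.
by case: mM => /left_idealP lM _ _; apply: lM.
Qed.

Hypothesis ssA : semisimple_algebra A.

(** Take [L'] of least dimension with [L + L' = A]. If [y != 0] were in [L :&: L'], some maximal [M]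
    would miss [y], and the smaller [L' :&: M] would still supplement [L]. *)
Lemma left_ideal_complement L : left_ideal L ->
  exists2 L', left_ideal L' & (L + L' = fullv /\ L :&: L' = 0)%VS.
Proof.
move=> lL.
have [|L' [lL' LL'] L'min] := @ex_min_nat _
  (fun L' => left_ideal L' /\ (L + L')%VS = fullv) (fun L' => \dim L').
  by exists fullv; split; [apply/left_idealP => *; exact: memvf | rewrite addvf].
exists L' => //; split=> //; apply/eqP/negPn/negP => LL'0.
set y := vpick (L :&: L')%VS.
have y0 : y != 0 by rewrite vpick0.
have /memv_capP[yL yL'] : y \in (L :&: L')%VS by exact: memv_pick.
have [M mM nyM] : exists2 M, maximal_left_ideal M & y \notin M.
  apply: contrapT => h; move/eqP: y0; apply; apply: ssA => M mM.
  by apply/negPn/negP => nyM; apply: h; exists M.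
have lM : left_ideal M by case: mM.
have nLM : ~ (L :&: L' <= M)%VS.
  by move=> /subvP sM; move: nyM; rewrite sM // memv_pick.
have E := maximal_left_ideal_addv mM (left_ideal_capv lL lL') nLM.
have : (\dim L' <= \dim (L' :&: M))%N.
  apply: L'min; split; first exact: left_ideal_capv.
  apply/eqP; rewrite eqEsubv subvf -LL' subv_add addvSl /=.
  apply/subvP => v vL'; have := memvf v; rewrite -E => /memv_addP[a].
  move=> /memv_capP[aL aL'] [u uM Ev]; rewrite Ev memv_add // memv_cap uM andbT.
  by have -> : u = v - a by [rewrite Ev addrC addKr]; rewrite memvB.
rewrite (geq_leqif (dimv_leqif_sup (capvSl L' M))) => /subvP /(_ y yL').
by rewrite memv_cap (negPf nyM) andbF.
Qed.

(** Split [1 = e + f] along a complement of [L]: for [x] in [L], the element [x e - x = - x f] lies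
    in both summands. *)
Lemma left_ideal_right_unit L : left_ideal L ->
  exists2 e, e \in L & forall x, x \in L -> x * e = x.
Proof.
move=> lL; have [L' lL' [LL' LcL']] := left_ideal_complement lL.
have := memvf (1 : A); rewrite -LL' => /memv_addP[e eL [f fL' E]].
exists e => // x xL; apply/eqP; rewrite -subr_eq0 -memv0 -LcL' memv_cap.
have -> : x * e - x = - (x * f) by rewrite -{2}[x]mulr1 E mulrDr opprD addNKr.
rewrite !memvN; have /left_idealP -> // := lL'; rewrite andbT.
have -> : x * f = x - x * e by rewrite -{2}[x]mulr1 E mulrDr addrC addKr.
by rewrite memvB //; have /left_idealP -> := lL.
Qed.

(* The two-sided ideal [I] generated by [y] has a right unit [e]; for [x] in [I],
   [w = x - e x] satisfies [w A w = 0], so [e] is also a left unit of [I]. *)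
Lemma semisimple_central_idempotent (y : A) : y != 0 ->
  exists f, [/\ mulop f, f y != 0, f y * f y = f y & central (f y)].
Proof.
move=> y0.
have [||I IP] := @vspace_pred F A (fun x => exists2 f, mulop f & x = f y).
- by exists (fun=> 0) => //; exact: mulop0.
- move=> c _ _ [f mf ->] [g mg ->]; exists (fun x => c%:A * f x + g x).
    by apply: mulop_add => //; apply: mulop_l.
  by rewrite -scalerAl mul1r.
have lI a x : x \in I -> a * x \in I.
  by move=> /IP[f mf ->]; apply/IP; exists (fun x => a * f x) => //; exact: mulop_l.
have rI a x : x \in I -> x * a \in I.
  by move=> /IP[f mf ->]; apply/IP; exists (fun x => f x * a) => //; exact: mulop_r.
have /left_ideal_right_unit[e eI re] : left_ideal I by apply/left_idealP.
have le x : x \in I -> e * x = x.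
  move=> xI; apply/esym/eqP; rewrite -subr_eq0; apply/eqP/ssA.
  apply: nil_in_jacobson_radical => a; set w := x - e * x.
  have wI : w \in I by rewrite memvB // lI.
  have ew : e * w = 0 by rewrite /w mulrBr mulrA re // subrr.
  by rewrite -(re (w * a)) ?rI // -mulrA ew mulr0.
have /IP[f mf Ef] := eI; exists f; rewrite -Ef; split=> //.
- apply: contra_neq y0 => e0; rewrite -(re y) ?e0 ?mulr0 //.
  by apply/IP; exists (fun x => x) => //; exact: mulop_id.
- exact: re.
(* As [e] is a unit of the ideal on both sides, [e a = e a e = a e]. *)
- by move=> a; rewrite -(re (e * a)) ?rI // -(le (a * e)) ?lI // mulrA.
Qed.

End SemisimpleAlgebra.

(** [Z] is a parameter because frames of a tensor product are used with two kinds of values: central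
    ones, and central ones that are periodic under Frobenius. *)
Definition central_frame (S : nzRingType) (Z : S -> Prop) :=
  exists (J : finType) (g : J -> S) (psi : J -> S -> S),
    [/\ forall j, mulop (psi j), forall j x, Z (psi j x) &
        forall x, x = \sum_j g j * psi j x].

(** * Existence of a frame for a semisimple algebra *)

Section SemisimpleFrame.
Variables (F : fieldType) (A : falgType F).

(** A partial dual basis. The diagonal values are central idempotents instead of 1, because an
    operator may detect only some of the simple factors of [A]. *)
Definition separated (k : nat) (g eps : nat -> A) (psi : nat -> A -> A) :=
  (forall j, (j < k)%N ->
    [/\ mulop (psi j), eps j != 0, eps j * eps j = eps j, central (eps j) &
        g j * eps j = g j]) /\
  forall i j, (i < k)%N -> (j < k)%N -> psi j (g i) = (if i == j then eps j else 0).

Lemma mulopZ (f : A -> A) c x : mulop f -> f (c *: x) = c *: f x.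
Proof.
move=> mf; rewrite -[x in LHS]mul1r scalerAl (mulop_central _ mf) -?scalerAl ?mul1r //.
by move=> y; rewrite -scalerAl -scalerAr mul1r mulr1.
Qed.

(** Applying [psi i] to a linear relation between the [g] leaves [c i *: eps i = 0], so they are
    linearly independent over [F]. *)
Lemma separated_size_le k g eps psi : separated k g eps psi -> (k <= \dim {:A})%N.
Proof.
move=> [sep sepE]; pose X := [tuple g i | i < k].
have fX : free X.
  apply/freeP => c E i; have [mpsi e0 _ _ _] := sep i (ltn_ord i).
  have XE (j : 'I_k) : X`_j = g j by rewrite -tnth_nth tnth_mktuple.
  have := congr1 (psi i) E; rewrite (mulop_sumE _ _ _ mpsi) (mulop0E mpsi).
  rewrite (bigD1 i) // big1 => [|j ji]; rewrite (mulopZ _ _ mpsi) XE sepE //.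
    by rewrite /= addr0 eqxx => /eqP; rewrite scaler_eq0 (negPf e0) orbF => /eqP.
  by rewrite ifN ?scaler0.
have := fX; rewrite /free size_tuple => /eqP <-; exact: dimv_le_full.
Qed.

(* Once [f x] is a nonzero central idempotent [e], replace [x] by [e x] and [f]
   by [e f], and correct the old [psi_j] by [psi_j x * f]. *)
Lemma separated_extend k g eps psi f x : semisimple_algebra A ->
  separated k g eps psi -> mulop f -> (forall i, (i < k)%N -> f (g i) = 0) ->
  f x != 0 -> exists g' eps' psi', separated k.+1 g' eps' psi'.
Proof.
move=> ssA [sep sepE] mf fg fx0.
have [h [mh h0 hh hc]] := semisimple_central_idempotent ssA fx0.
pose e := h (f x); pose y := e * x; pose f' z := h (f z).
have mf' : mulop f' by exact: mulop_comp.
have f'y : f' y = e by rewrite /y (mulop_central _ mf').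
have f'g i : (i < k)%N -> f' (g i) = 0 by move=> ik; rewrite /f' fg // (mulop0E mh).
have ye : y * e = y by rewrite -hc mulrA hh.
exists (fun i => if (i < k)%N then g i else y).
exists (fun i => if (i < k)%N then eps i else e).
exists (fun j => if (j < k)%N then fun z => psi j z - psi j y * f' z else f').
split=> [j _|i j]; first case: ifP => [jk|_].
- have [mpsi ? ? ? ?] := sep j jk; split=> //.
  by apply: mulop_sub => //; apply: mulop_l.
- by split.
rewrite !ltnS [(i <= k)%N]leq_eqVlt [(j <= k)%N]leq_eqVlt.
case: (ltnP i k) => ik; rewrite ?(ltn_eqF ik) ?orbF /=.
  move=> _; case: (ltnP j k) => jk; rewrite ?(ltn_eqF jk) ?orbF /= => hj.
    by rewrite f'g // mulr0 subr0 sepE.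
  by rewrite f'g // (eqP hj) ltn_eqF.
move=> /eqP ->; case: (ltnP j k) => jk; rewrite ?(ltn_eqF jk) ?orbF /= => hj.
  rewrite f'y (gtn_eqF jk); have [mpsi _ _ _ _] := sep j jk.
  apply/eqP; rewrite subr_eq0; apply/eqP.
  by rewrite -hc -(mulop_central _ mpsi) // [e * y]hc ye.
by rewrite f'y (eqP hj) eqxx.
Qed.

(* For a maximal separated family, an operator killing all the [g_i] vanishes:
   apply this to [p psi_j - psi_j p] and to [id - \sum_j g_j psi_j]. *)
Lemma semisimple_frame : semisimple_algebra A -> central_frame (@central A).
Proof.
move=> ssA.
have [||k [g [eps [psi [sep sepE]]]] kmax] := @ex_max_nat _
  (fun k => exists g eps psi, separated k g eps psi) id (\dim {:A}).
- by exists 0%N, (fun=> 0), (fun=> 0), (fun=> id).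
- by move=> k [g [eps [psi /separated_size_le]]].
have kill f x : mulop f -> (forall i, (i < k)%N -> f (g i) = 0) -> f x = 0.
  move=> mf fg; apply/eqP/negPn/negP => fx0.
  suff /kmax : exists g eps psi, separated k.+1 g eps psi by rewrite ltnn.
  exact: (separated_extend ssA (conj sep sepE) mf fg fx0).
exists 'I_k, (fun i : 'I_k => g i), (fun i : 'I_k => psi i); split.
- by move=> j; case: (sep j (ltn_ord j)).
- move=> j x p; have [mpsi _ _ ce _] := sep j (ltn_ord j); apply/esym/eqP.
  rewrite -subr_eq0; apply/eqP.
  apply: (kill (fun x => p * psi j x - psi j x * p)) => [|i ik].
    by apply: mulop_sub; [apply: mulop_l | apply: mulop_r].
  by rewrite sepE //; case: ifP => _; rewrite ?ce ?mulr0 ?mul0r subrr.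
- move=> x; apply/eqP; rewrite -subr_eq0; apply/eqP.
  apply: (kill (fun x => x - \sum_(j < k) g j * psi j x)) => [|i ik].
    apply: mulop_sub; first exact: mulop_id.
    by apply: mulop_sum => j; apply: mulop_l; case: (sep j (ltn_ord j)).
  rewrite (bigD1 (Ordinal ik)) //= big1 => [|j ji].
    by rewrite addr0 sepE // eqxx; case: (sep i ik) => _ _ _ _ ->; rewrite subrr.
  rewrite sepE // ifN ?mulr0 //; by apply: contra_neq ji => E; apply: val_inj; rewrite /= E.
Qed.

End SemisimpleFrame.

(** * Tensor products *)

Section TensorProduct.
Variables (F : fieldType) (B C T : falgType F).
Variables (i : {lrmorphism B -> T}) (j : {lrmorphism C -> T}).
Hypothesis tensT : is_tensor_product i j.

Lemma tensor_universal (W : lmodType F) (f : B -> C -> W) :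
  (forall c, linear (f^~ c)) -> (forall b, linear (f b)) ->
  exists h : {linear T -> W}, forall b c, h (i b * j c) = f b c.
Proof.
move=> fl fr.
pose beta : {bilinear B -> C -> W} :=
  HB.pack f (bilinear_isBilinear.Build F B C W *:%R *:%R f (fl, fr)).
by have [h hE _] := tensT.2 W beta; exists h.
Qed.

(** The identity and the projection onto the subspace defined by [P] agree on pure tensors, so
    uniqueness in the universal property makes them equal. *)
Lemma tensor_lin_ind (P : T -> Prop) :
  P 0 -> (forall c u v, P u -> P v -> P (c *: u + v)) ->
  (forall b c, P (i b * j c)) -> forall t, P t.
Proof.
move=> P0 Plin Pij; have [U UP] := vspace_pred P0 Plin.
have fl c : linear (fun b => i b * j c).
  by move=> k u v; rewrite linearP mulrDl -scalerAl.
have fr b : linear (fun c => i b * j c).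
  by move=> k u v; rewrite linearP mulrDr -scalerAr.
pose beta : {bilinear B -> C -> T} :=
  HB.pack (fun b c => i b * j c) (bilinear_isBilinear.Build F B C T
    *:%R *:%R (fun b c => i b * j c) (fl, fr)).
have [h _ hU] := tensT.2 T beta.
have E1 : @idfun T =1 h by exact: hU.
have E2 : projv U =1 h by apply: hU => b c; apply: projv_id; apply/UP.
move=> t; apply/UP; have := E1 t; rewrite -(E2 t) /= => ->; exact: memv_proj.
Qed.

Lemma tensor_add_ind (P : T -> Prop) :
  P 0 -> (forall u v, P u -> P v -> P (u + v)) ->
  (forall b c, P (i b * j c)) -> forall t, P t.
Proof.
move=> P0 PD Pij t; rewrite -[t]scale1r; move: (1 : F); move: t.
apply: (@tensor_lin_ind (fun t => forall k, P (k *: t))) => [k|c u v Pu Pv k|b c k].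
- by rewrite scaler0.
- by rewrite scalerDr scalerA; apply: PD.
- by rewrite scalerAl -linearZ; exact: Pij.
Qed.

Lemma mulop_tensorl f : mulop f ->
  exists2 g, mulop g & forall b c, g (i b * j c) = i (f b) * j c.
Proof.
have cij := tensT.1.
elim=> [|p h _ [g mg gE]|p h _ [g mg gE]|h k _ [g mg gE] _ [g' mg' gE']].
- by exists (fun x => x) => //; apply: mulop_id.
- exists (fun x => i p * g x) => [|b c]; first exact: mulop_l.
  by rewrite gE rmorphM mulrA.
- exists (fun x => g x * i p) => [|b c]; first exact: mulop_r.
  by rewrite gE rmorphM -!mulrA cij.
- exists (fun x => g x + g' x) => [|b c]; first exact: mulop_add.
  by rewrite gE gE' rmorphD mulrDl.
Qed.

Lemma mulop_tensorr f : mulop f ->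
  exists2 g, mulop g & forall b c, g (i b * j c) = i b * j (f c).
Proof.
have cij := tensT.1.
elim=> [|p h _ [g mg gE]|p h _ [g mg gE]|h k _ [g mg gE] _ [g' mg' gE']].
- by exists (fun x => x) => //; apply: mulop_id.
- exists (fun x => j p * g x) => [|b c]; first exact: mulop_l.
  by rewrite gE rmorphM mulrA -cij -mulrA.
- exists (fun x => g x * j p) => [|b c]; first exact: mulop_r.
  by rewrite gE rmorphM -!mulrA.
- exists (fun x => g x + g' x) => [|b c]; first exact: mulop_add.
  by rewrite gE gE' rmorphD mulrDr.
Qed.

Lemma tensor_mul b c b' c' :
  (i b * j c) * (i b' * j c') = i (b * b') * j (c * c').
Proof. by rewrite !rmorphM -!mulrA; congr (_ * _); rewrite !mulrA (tensT.1 b'). Qed.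

Lemma central_tensor b c : central b -> central c -> central (i b * j c).
Proof.
move=> cb cc; apply: tensor_add_ind => [|u v Pu Pv|b' c'].
- by rewrite mulr0 mul0r.
- by rewrite mulrDr mulrDl Pu Pv.
- by rewrite !tensor_mul cb cc.
Qed.

(** The frame is [g (x) h] with the operators [psi (x) phi], which are operators of [T] because [i]
    and [j] commute. Their values are sums of [i b * j c] with [b] in [ZB] and [c] in [ZC], hence
    satisfy [ZT]. *)
Lemma tensor_frame (ZB : B -> Prop) (ZC : C -> Prop) (ZT : T -> Prop) :
  central_frame ZB -> central_frame ZC -> ZT 0 ->
  (forall u v, ZT u -> ZT v -> ZT (u + v)) ->
  (forall b c, ZB b -> ZC c -> ZT (i b * j c)) -> central_frame ZT.
Proof.
move=> [J [g [psi [mpsi Zpsi Epsi]]]] [K [h [phi [mphi Zphi Ephi]]]] ZT0 ZTD ZTij.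
have /boolp.choice[psi' psi'P] k : exists f, mulop f /\
    forall b c, f (i b * j c) = i (psi k b) * j c.
  by have [f mf fE] := mulop_tensorl (mpsi k); exists f.
have /boolp.choice[phi' phi'P] k : exists f, mulop f /\
    forall b c, f (i b * j c) = i b * j (phi k c).
  by have [f mf fE] := mulop_tensorr (mphi k); exists f.
pose op (q : J * K) x := psi' q.1 (phi' q.2 x).
have mop q : mulop (op q) by apply: mulop_comp; [case: (psi'P q.1)|case: (phi'P q.2)].
have opE q b c : op q (i b * j c) = i (psi q.1 b) * j (phi q.2 c).
  by rewrite /op (phi'P q.2).2 (psi'P q.1).2.
exists (J * K)%type, (fun q => i (g q.1) * j (h q.2)), op; split=> //.
- move=> q; apply: tensor_add_ind => [|u v Pu Pv|b c].
  + by rewrite (mulop0E (mop q)).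
  + by rewrite mulopD //; apply: ZTD.
  + by rewrite opE; apply: ZTij.
- apply: tensor_add_ind => [|u v Pu Pv|b c].
  + by rewrite big1 // => q _; rewrite (mulop0E (mop q)) mulr0.
  + rewrite {1}Pu {1}Pv -big_split /=; apply: eq_bigr => q _.
    by rewrite mulopD // mulrDr.
  + rewrite {1}(Epsi b) {1}(Ephi c) !rmorph_sum mulr_suml -(pair_bigA _ (fun p q =>
      (i (g p) * j (h q)) * op (p, q) (i b * j c))) /=.
    apply: eq_bigr => p _; rewrite mulr_sumr; apply: eq_bigr => q _.
    by rewrite opE tensor_mul.
Qed.

End TensorProduct.

(** * Frobenius on reduced centres over a finite field *)

Section FiniteField.

Lemma finite_set_falg (F : fieldType) (V : vectType F) :
  finite_set [set: F] -> finite_set [set: V].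
Proof.
move=> finF; pose X := fset_set [set: F].
have XP (x : F) : x \in X by rewrite in_fset_set // inE.
pose f (c : {ffun 'I_(\dim {:V}) -> X}) : V := \sum_i val (c i) *: (vbasis {:V})`_i.
suff -> : [set: V] = range f by apply: finite_image; exact: finite_finset.
apply/seteqP; split=> // v _.
exists [ffun i => [` XP (coord (vbasis {:V}) i v)]%fset] => //.
rewrite [RHS](coord_vbasis (memvf v)); apply: eq_bigr => i _.
by rewrite ffunE.
Qed.

Lemma finite_set_repeat (X : Type) (u : nat -> X) : finite_set [set: X] ->
  exists a b, (a < b)%N /\ u a = u b.
Proof.
move=> finX; apply: contrapT => nrep; apply: infinite_nat.
have uinj : injective u.
  move=> a b E; apply/eqP; case: ltngtP => // ab; case: nrep.
    by exists a, b.
  by exists b, a.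
have ui : {in [set: nat] &, injective u} by move=> a b _ _; exact: uinj.
rewrite -(eq_finite_set (inj_card_eq ui)).
exact: sub_finite_set finX.
Qed.

Lemma finite_pchar (F : fieldType) : finite_set [set: F] -> exists p, p \in [pchar F].
Proof.
move=> /(finite_set_repeat (fun n => n%:R))[a [b [ab E]]].
have := @natf0_pchar F (b - a); rewrite subn_gt0 => /(_ ab).
rewrite natrB ?(ltnW ab) // E subrr eqxx => /(_ isT) [p pP]; by exists p.
Qed.

Definition frob_periodic (S : nzRingType) p (x : S) :=
  exists2 N, (0 < N)%N & x ^+ (p ^ N) = x.

Lemma frob_iterD (S : nzRingType) p (x y : S) N : p \in [pchar S] ->
  x * y = y * x -> (x + y) ^+ (p ^ N) = x ^+ (p ^ N) + y ^+ (p ^ N).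
Proof.
move=> pS xy; elim: N => [|N IH]; first by rewrite expn0 !expr1.
rewrite expnSr !exprM IH -!(pFrobenius_autE pS) pFrobenius_autD_comm //.
exact/commrX/commr_sym/commrX.
Qed.

Lemma frob_iterB (S : nzRingType) p (x y : S) N : p \in [pchar S] ->
  x * y = y * x -> (x - y) ^+ (p ^ N) = x ^+ (p ^ N) - y ^+ (p ^ N).
Proof.
move=> pS xy; elim: N => [|N IH]; first by rewrite expn0 !expr1.
rewrite expnSr !exprM IH -!(pFrobenius_autE pS) pFrobenius_autB_comm //.
exact/commrX/commr_sym/commrX.
Qed.

Lemma frob_periodicM (S : nzRingType) p (x : S) N k :
  x ^+ (p ^ N) = x -> x ^+ (p ^ (k * N)) = x.
Proof.
move=> xN; elim: k => [|k IH]; first by rewrite mul0n expn0 expr1.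
by rewrite mulSn expnD exprM xN.
Qed.

Lemma frob_periodic_common (S S' : nzRingType) p (x : S) (y : S') :
  frob_periodic p x -> frob_periodic p y ->
  exists N, [/\ (0 < N)%N, x ^+ (p ^ N) = x & y ^+ (p ^ N) = y].
Proof.
move=> [a a0 xa] [b b0 yb]; exists (a * b)%N.
rewrite muln_gt0 a0 b0; split=> //; last exact: frob_periodicM.
by rewrite mulnC; apply: frob_periodicM.
Qed.

(** Repeating the period [k] times gives [x = x ^+ (p ^ (k * N))], where the exponent is at least
    [k]. *)
Lemma nilpotent_frob_periodic (S : nzRingType) p (x : S) k : prime p ->
  frob_periodic p x -> x ^+ k = 0 -> x = 0.
Proof.
move=> pp [N N0 xN] xk; rewrite -(frob_periodicM k xN).
have kp : (k <= p ^ (k * N))%N.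
  apply: leq_trans (ltnW (ltn_expl k (prime_gt1 pp))) _.
  by rewrite leq_exp2l ?prime_gt1 // leq_pmulr.
by rewrite -(subnKC kp) exprD xk mul0r.
Qed.

Definition reduced_center (S : nzRingType) :=
  forall (z : S) k, central z -> z ^+ k = 0 -> z = 0.

(** If [n >= 2] is the least exponent killing [z], then [w = z ^+ (n - 1)] is central with
    [w a w = w w a = 0], because [2 (n - 1) >= n]; so [w] is in the radical and vanishes, against
    minimality. *)
Lemma semisimple_reduced_center (F : fieldType) (A : falgType F) :
  semisimple_algebra A -> reduced_center A.
Proof.
move=> ssA z k cz zk.
have [|n n0 nmin] := @ex_min_nat _ (fun n => z ^+ n = 0) id; first by exists k.
case: n n0 nmin => [|[|n]]; first by rewrite expr0 => /eqP; rewrite oner_eq0.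
  by rewrite expr1.
move=> n0 nmin; have : z ^+ n.+1 = 0.
  apply: ssA; apply: nil_in_jacobson_radical => a.
  rewrite -mulrA; have -> : a * z ^+ n.+1 = z ^+ n.+1 * a.
    by apply/esym/commr_sym/commrX => /=; rewrite /GRing.comm cz.
  rewrite mulrA -exprD; have -> : (n.+1 + n.+1 = n.+2 + n)%N by rewrite addnS.
  by rewrite exprD n0 !mul0r.
by move=> /nmin; rewrite ltnn.
Qed.

(** Finiteness makes two Frobenius iterates of [z] equal, say for [a < b]; then
    [z ^+ (p ^ (b - a)) - z] is central and its power of exponent [p ^ a] is 0. *)
Lemma central_frob_periodic (F : fieldType) (A : falgType F) p (z : A) :
  finite_set [set: F] -> p \in [pchar A] ->
  reduced_center A -> central z -> frob_periodic p z.
Proof.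
move=> finF pA redA cz.
have [a [b [ab E]]] := finite_set_repeat (fun N => z ^+ (p ^ N))
   (finite_set_falg A finF).
exists (b - a)%N; first by rewrite subn_gt0.
apply/eqP; rewrite -subr_eq0; apply/eqP.
have czX n : central (z ^+ n).
  by move=> y; apply/commr_sym/commrX; rewrite /GRing.comm cz.
apply: (redA _ (p ^ a)%N).
  by move=> y; rewrite mulrBl mulrBr czX cz.
by rewrite frob_iterB // -?czX // -exprM -expnD subnK ?E ?subrr // ltnW.
Qed.

End FiniteField.

(** * Frame and centre of the tensor product *)

Section TensorCenter.
Variables (F : fieldType) (B C T : falgType F).
Variables (i : {lrmorphism B -> T}) (j : {lrmorphism C -> T}).
Hypothesis tensT : is_tensor_product i j.
Hypotheses (frameB : central_frame (@central B)) (frameC : central_frame (@central C)).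
Hypotheses (redB : reduced_center B) (redC : reduced_center C).

Lemma tensor_central_frame : central_frame (@central T).
Proof.
apply: (tensor_frame tensT frameB frameC).
- by move=> y; rewrite mul0r mulr0.
- by move=> u v cu cv y; rewrite mulrDl mulrDr cu cv.
- by move=> b c; exact: central_tensor.
Qed.

(* Frobenius acts with finite orbits on the centres of [B] and [C], hence on the
   sums of products of central elements, which contain all [psi_j(x)]. *)
Lemma tensor_reduced_center : finite_set [set: F] -> reduced_center T.
Proof.
move=> finF z k cz zk; have [p pF] := finite_pchar finF.
have pp := pcharf_prime pF.
have pch (A : falgType F) : p \in [pchar A] by rewrite pchar_lalg.
pose Z (t : T) := central t /\ frob_periodic p t.
have : central_frame Z.
  apply: (tensor_frame tensT frameB frameC).
  - split; first by move=> y; rewrite mul0r mulr0.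
    by exists 1%N => //; rewrite expr0n expn1 eqn0Ngt prime_gt0.
  - move=> u v [cu pu] [cv pv]; split.
      by move=> y; rewrite mulrDl mulrDr cu cv.
    have [N [N0 uN vN]] := frob_periodic_common pu pv.
    by exists N => //; rewrite (frob_iterD _ (pch T) (cu v)) uN vN.
  - move=> b c cb cc; split; first exact: central_tensor.
    have [N [N0 bN cN]] := frob_periodic_common
      (central_frob_periodic finF (pch B) redB cb)
      (central_frob_periodic finF (pch C) redC cc).
    exists N => //; rewrite exprMn_comm; last exact: (tensT.1 b c).
    by rewrite -!rmorphXn bN cN.
move=> [J [g [psi [mpsi Zpsi Epsi]]]]; rewrite [z]Epsi big1 // => l _.
suff -> : psi l z = 0 by rewrite mulr0.
apply: (nilpotent_frob_periodic (k := k) pp (Zpsi l z).2).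
(* Operators are linear over the centre, so [psi l z = z * psi l 1] is nilpotent along with [z]. *)
rewrite -[z in psi l z]mulr1 mulop_central // exprMn_comm; last exact: cz.
by rewrite zk mul0r.
Qed.

End TensorCenter.

(** * Transfer to the opposite algebra, and the case of division algebras *)

Section OppositeFrame.
Variables (F : fieldType) (A : falgType F).

Lemma mulop_opp (f : A -> A) : mulop f -> mulop (f : A^c -> A^c).
Proof.
elim=> [|p h _ IH|p h _ IH|h k _ IH _ IH'].
- exact: mulop_id.
- exact: (@mulop_r A^c p _ IH).
- exact: (@mulop_l A^c p _ IH).
- exact: mulop_add IH IH'.
Qed.

Lemma central_frame_opp : central_frame (@central A) -> central_frame (@central A^c).
Proof.
move=> [J [g [psi [mpsi cpsi Epsi]]]]; exists J, g, psi; split.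
- by move=> j; exact: mulop_opp.
- by move=> j x y; have := cpsi j x y.
- move=> x; rewrite {1}(Epsi x); apply: eq_bigr => j _.
  exact: esym (cpsi j x (g j)).
Qed.

Lemma reduced_center_opp : reduced_center A -> reduced_center A^c.
Proof.
move=> redA z k cz zk; apply: (redA z k).
  by move=> y; exact: esym (cz y).
suff <- : (z : A^c) ^+ k = (z : A) ^+ k by [].
elim: k {zk} => // k IH; rewrite exprS IH; exact: esym (exprSr (z : A) k).
Qed.

(** The zero left ideal of a division algebra is maximal. *)
Lemma division_semisimple : division_algebra A -> semisimple_algebra A.
Proof.
move=> divA x /(_ 0%VS) x0; apply/eqP; rewrite -memv0; apply: x0; split.
- by apply/left_idealP => a y; rewrite !memv0 => /eqP ->; rewrite mulr0.
- by apply/negP => /eqP E; have := memvf (1 : A); rewrite -E memv0 oner_eq0.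
- move=> L /left_idealP lL _; have [->|L0] := eqVneq L 0%VS; [by left | right].
  apply/eqP; rewrite eqEsubv subvf; apply/subvP => y _.
  have u : vpick L \is a GRing.unit by apply: divA; rewrite vpick0.
  by rewrite -[y]mulr1 -(mulVr u) mulrA lL ?memv_pick.
Qed.

End OppositeFrame.

(** * Products of matrix algebras *)

Section MatrixProduct.
Variables (F : fieldType) (T : falgType F) (t : nat) (m : 'I_t -> nat).
Variables (D : 'I_t -> falgType F) (Phi : forall i, T -> 'M[D i]_(m i)).
Hypothesis isoPhi : is_mx_prod_iso Phi.
Hypothesis m_gt0 : forall i, (0 < m i)%N.

Lemma Phi_inj x y : (forall i, Phi i x = Phi i y) -> x = y.
Proof.
move=> E; have [z [_ zU]] := isoPhi.2 (Phi^~ y).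
by rewrite -(zU x) ?(zU y).
Qed.

Lemma PhiB i x y : Phi i (x - y) = Phi i x - Phi i y.
Proof. by case: (isoPhi.1 i) => -> _ _. Qed.

Lemma Phi0 i : Phi i 0 = 0.
Proof. by rewrite -{1}(subrr (0 : T)) PhiB subrr. Qed.

Lemma PhiD i x y : Phi i (x + y) = Phi i x + Phi i y.
Proof. by rewrite -[y in LHS]opprK PhiB -(sub0r y) PhiB Phi0 sub0r opprK. Qed.

Lemma Phi_sum i (J : Type) (r : seq J) (P : pred J) (x : J -> T) :
  Phi i (\sum_(j <- r | P j) x j) = \sum_(j <- r | P j) Phi i (x j).
Proof. exact: (big_morph (Phi i) (PhiD i) (Phi0 i)). Qed.

Lemma PhiM i x y : Phi i (x * y) = Phi i x *m Phi i y.
Proof. by case: (isoPhi.1 i) => _ [_ ->] _. Qed.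

Lemma Phi1 i : Phi i 1 = 1%:M.
Proof. by case: (isoPhi.1 i) => _ [-> _] _. Qed.

Lemma PhiZ i c x : Phi i (c *: x) = map_mx ( *:%R c) (Phi i x).
Proof. by case: (isoPhi.1 i). Qed.

Local Notation mx_at X := (@dfwith _ (fun j => 'M[D j]_(m j)) (fun=> 0) _ X).

Definition mx_inj i (X : 'M[D i]_(m i)) : T :=
  xget 0 [set x | forall j, Phi j x = mx_at X j].

Lemma mx_injP i (X : 'M[D i]_(m i)) j :
  Phi j (mx_inj X) = mx_at X j.
Proof.
rewrite /mx_inj; case: xgetP => [x _ ->//|noX].
by have [x [xP _]] := isoPhi.2 (mx_at X); case: (noX x xP).
Qed.

Lemma mx_injE i (X : 'M[D i]_(m i)) : Phi i (mx_inj X) = X.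
Proof. by rewrite mx_injP dfwith_in. Qed.

Lemma mx_inj_out i j (X : 'M[D i]_(m i)) : i != j -> Phi j (mx_inj X) = 0.
Proof. by move=> ij; rewrite mx_injP dfwith_out. Qed.

Let o i : 'I_(m i) := Ordinal (m_gt0 i).

Lemma central_Phi z i : central z ->
  exists2 r : D i, central r & Phi i z = r%:M.
Proof.
move=> cz; set X := Phi i z.
have cX Y : X *m Y = Y *m X by rewrite -(mx_injE Y) -!PhiM cz.
have Xkl a k l : X a k = X l l *+ (a == k).
  have /matrixP/(_ a l) := cX (delta_mx k l); rewrite !mxE.
  rewrite (bigD1 k) //= big1 => [|b bk]; last by rewrite mxE (negPf bk) mulr0.
  rewrite (bigD1 l) //= big1 => [|b bl]; last first.
    by rewrite mxE (negPf bl) andbF mul0r.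
  by rewrite !mxE !eqxx mulr1 !addr0 andbT mulrb => ->; case: eqP; rewrite ?mul1r ?mul0r.
have XE : X = (X (o i) (o i))%:M by apply/matrixP => a b; rewrite !mxE; exact: Xkl.
exists (X (o i) (o i)) => // y.
have /matrixP/(_ (o i) (o i)) := cX y%:M.
by rewrite XE -!scalar_mxM !mxE eqxx.
Qed.

Lemma central_mx_inj i (r : D i) : central r -> central (mx_inj r%:M).
Proof.
move=> cr y; apply: Phi_inj => j; rewrite !PhiM mx_injP.
case: dfwithP => [|k ik]; last by rewrite mul0mx mulmx0.
apply/matrixP => a b; rewrite mul_scalar_mx !mxE (bigD1 b) //= big1 => [|c cb].
  by rewrite !mxE eqxx addr0 cr.
by rewrite !mxE (negPf cb) mulr0.
Qed.

(** Matrix products unfold entrywise into sums of one-sided products, so an operator of [T],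
    evaluated on scalar matrices of block [i], has operators of [D i] as entries. *)
Lemma mulop_Phi i f : mulop f ->
  forall k l, mulop (fun x : D i => Phi i (f (mx_inj x%:M)) k l).
Proof.
elim=> [|p h _ IH|p h _ IH|h h' _ IH _ IH'] k l.
- apply: (@mulop_ext _ (fun x => x *+ (k == l))) => [x|].
    by rewrite mx_injE mxE.
  by case: (k == l) => /=; [exact: mulop_id | exact: mulop0].
- apply: (@mulop_ext _ (fun x => \sum_c Phi i p k c * Phi i (h (mx_inj x%:M)) c l)).
    by move=> x; rewrite PhiM mxE.
  by apply: mulop_sum => c; apply: mulop_l.
- apply: (@mulop_ext _ (fun x => \sum_c Phi i (h (mx_inj x%:M)) k c * Phi i p c l)).
    by move=> x; rewrite PhiM mxE.
  by apply: mulop_sum => c; apply: mulop_r.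
- apply: (@mulop_ext _ (fun x => Phi i (h (mx_inj x%:M)) k l +
    Phi i (h' (mx_inj x%:M)) k l)); first by move=> x; rewrite PhiD mxE.
  exact: mulop_add.
Qed.

(** Compare one diagonal entry on both sides of the frame identity of [T] at a scalar matrix: the
    values of the operators are central in [T], so their components are scalar matrices and a single
    term of each product survives. *)
Lemma mx_prod_frame i : central_frame (@central T) -> central_frame (@central (D i)).
Proof.
move=> [J [g [psi [mpsi cpsi Epsi]]]].
exists J, (fun j => Phi i (g j) (o i) (o i)),
  (fun j x => Phi i (psi j (mx_inj x%:M)) (o i) (o i)); split.
- by move=> j; apply: mulop_Phi.
- move=> j x; have [r cr ->] := central_Phi i (cpsi j (mx_inj x%:M)).
  by rewrite mxE eqxx.
- move=> x; have := congr1 (fun X => Phi i X (o i) (o i)) (Epsi (mx_inj x%:M)).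
  rewrite mx_injE mxE eqxx mulr1n Phi_sum summxE => {1}->.
  apply: eq_bigr => j _; rewrite PhiM mxE.
  have [r cr ->] := central_Phi i (cpsi j (mx_inj x%:M)).
  rewrite (bigD1 (o i)) //= big1 ?addr0 // => k ko.
  by rewrite !mxE (negPf ko) mulr0.
Qed.

Lemma mx_prod_reduced_center i : reduced_center T -> reduced_center (D i).
Proof.
move=> redT r k cr rk.
have : mx_inj r%:M = 0.
  have E n : Phi i (mx_inj r%:M ^+ n) = (r ^+ n)%:M.
    elim: n => [|n IH]; first by rewrite !expr0 Phi1.
    by rewrite !exprS PhiM IH mx_injE scalar_mxM.
  have E' n j : i != j -> Phi j (mx_inj r%:M ^+ n.+1) = 0.
    by move=> ij; rewrite exprS PhiM mx_inj_out // mul0mx.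
  (* The exponent must be positive for the blocks other than [i] to vanish. *)
  apply: (redT _ k.+1); first exact: central_mx_inj.
  apply: Phi_inj => j; rewrite Phi0; have [<-|ij] := eqVneq i j.
    by rewrite E exprSr rk mul0r; apply/matrixP => a b; rewrite !mxE mul0rn.
  exact: E'.
move=> /(congr1 (fun X => Phi i X (o i) (o i))).
by rewrite mx_injE Phi0 !mxE eqxx.
Qed.

End MatrixProduct.

(** * Local algebras *)

Lemma memv_expv (F : fieldType) (S : falgType F) (m : {vspace S}) x k :
  x \in m -> x ^+ k \in (m ^+ k)%VS.
Proof.
move=> xm; elim: k => [|k IH]; first by rewrite expr0 expv0 memv_line.
by rewrite exprS expvSl memv_mul.
Qed.

Section LocalAlgebra.
Variables (F : fieldType) (S D : falgType F) (pi : {lrmorphism S -> D}).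
Hypotheses (divD : division_algebra D) (ssq : is_ss_quotient pi).

Let piM x y : pi (x * y) = pi x * pi y. Proof. exact: rmorphM. Qed.
Let piD x y : pi (x + y) = pi x + pi y. Proof. exact: rmorphD. Qed.
Let piB x y : pi (x - y) = pi x - pi y. Proof. exact: rmorphB. Qed.
Let piZ c x : pi (c *: x) = c *: pi x. Proof. exact: linearZ. Qed.
Let piX x n : pi (x ^+ n) = pi x ^+ n. Proof. exact: rmorphXn. Qed.
Let pi1 : pi 1 = 1. Proof. exact: rmorph1. Qed.
Let pi_sum (J : finType) (x : J -> S) : pi (\sum_j x j) = \sum_j pi (x j).
Proof. exact: rmorph_sum. Qed.

Lemma left_inverse_unit (a x : S) : a * x = 1 -> x \is a GRing.unit.
Proof.
move=> ax; have kx : lker (amull x) == 0%VS.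
  apply/lker0P => y z; rewrite !lfunE /= => /(congr1 ( *%R a)).
  by rewrite !mulrA ax !mul1r.
have [y] : exists y, amull x y = 1.
  have /memv_imgP[y _ E] : 1 \in limg (amull x) by rewrite lker0_limgf ?memvf.
  by exists y.
rewrite lfunE /= => xy; have E : a = y by rewrite -[a]mulr1 -xy mulrA ax mul1r.
by apply/unitrP; exists a; rewrite ax E xy.
Qed.

Lemma proper_left_ideal_sub (L : {vspace S}) : left_ideal L -> 1 \notin L ->
  exists2 M, maximal_left_ideal M & (L <= M)%VS.
Proof.
move=> lL L1.
have [||M [lM LM M1] Mmax] := @ex_max_nat _
  (fun M : {vspace S} => [/\ left_ideal M, (L <= M)%VS & 1 \notin M])
  (fun M => \dim M) (\dim {:S}).
- by exists L.
- by move=> M _; exact: dimv_le_full.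
exists M => //; split=> //; first by apply: contraNneq M1 => ->; exact: memvf.
move=> M' lM' MM'; case: (boolP (1 \in M')) => M'1.
  right; apply/eqP; rewrite eqEsubv subvf; apply/subvP => x _.
  by rewrite -[x]mulr1; have /left_idealP := lM'; apply.
left; apply/eqP; rewrite eq_sym -(geq_leqif (dimv_leqif_eq MM')); apply: Mmax.
by split=> //; exact: subv_trans MM'.
Qed.

(** Choose [y] with [pi (y x) = 1]. A proper left ideal generated by [y x] would lie in a maximal
    one, which also contains the radical element [1 - y x], hence 1. In finite dimension a left
    inverse is enough. *)
Lemma unit_pi x : pi x != 0 -> x \is a GRing.unit.
Proof.
move=> px0; have [y yE] := ssq.1 (pi x)^-1.
have [L [lL LP]] := left_ideal_principal (y * x).
have y1 : pi (1 - y * x) = 0.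
  by rewrite piB piM pi1 yE mulVr ?subrr //; apply: divD.
have /LP[a E] : 1 \in L.
  apply/negPn/negP => L1; have [M mM LM] := proper_left_ideal_sub lL L1.
  have M1 : 1 \notin M.
    case: mM => /left_idealP lM nM _; apply: contra nM => M1.
    by rewrite eqEsubv subvf; apply/subvP => z _; rewrite -[z]mulr1 lM.
  move/negP: M1; apply; rewrite -[1](subrK (y * x)) memvD //.
    by have := (ssq.2 _).1 y1; apply.
  by move/subvP: LM; apply; apply/LP; exists 1; rewrite mul1r.
by apply: (@left_inverse_unit (a * y)); rewrite -mulrA.
Qed.

Lemma nilpotent_pi x k : x ^+ k = 0 -> pi x = 0.
Proof.
move=> xk; apply/eqP/negPn/negP => /divD upx.
by have := unitrX k upx; rewrite -piX xk rmorph0 unitr0.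
Qed.

Lemma pi_mulop f x : mulop f -> pi x = 0 -> pi (f x) = 0.
Proof.
move=> mf px; elim: mf => // [p h _ E|p h _ E|h k _ E _ E'].
- by rewrite piM E mulr0.
- by rewrite piM E mul0r.
- by rewrite piD E E' addr0.
Qed.

Variables (R m : {vspace S}) (e : nat).
Hypotheses (RE : R = 'Z({:S})%VS) (maxm : maximal_ideal_of R m).
Hypothesis nilm : is_nilpotency_index m e.

Lemma mem_center x : x \in R <-> central x.
Proof.
rewrite RE /center_vspace memv_cap memvf /=; split=> [/centvP h y|cx].
  by apply: h; exact: memvf.
by apply/centvP => y _; exact: cx.
Qed.

Lemma center1 : 1 \in R.
Proof. by apply/mem_center => y; rewrite mul1r mulr1. Qed.

Lemma centerM x y : x \in R -> y \in R -> x * y \in R.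
Proof.
move=> /mem_center cx /mem_center cy; apply/mem_center => z.
by rewrite -mulrA cy mulrA cx mulrA.
Qed.

Lemma center_scalar c : c%:A \in R.
Proof. by apply/mem_center => y; rewrite -scalerAl -scalerAr mul1r mulr1. Qed.

Lemma ideal_mem I x : ideal_of R I -> x \in I -> x \in R.
Proof. by move=> [/subvP h _]; exact: h. Qed.

Lemma idealM I r x : ideal_of R I -> r \in R -> x \in I -> r * x \in I.
Proof. by move=> [_ /prodvP h]; exact: h. Qed.

Lemma maximal_ideal_ideal : ideal_of R m. Proof. by case: maxm. Qed.

Lemma maximal_ideal_central x : x \in m -> central x.
Proof. by move=> /(ideal_mem maximal_ideal_ideal)/mem_center. Qed.

Lemma maximal_ideal_residue x : x \in m -> pi x = 0.
Proof.
move=> xm; apply: (@nilpotent_pi _ e); have [_ me _] := nilm.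
by apply/eqP; rewrite -memv0 -me; exact: memv_expv.
Qed.

Lemma maximal_ideal_neq1 : 1 \notin m.
Proof. by apply/negP => /maximal_ideal_residue/eqP; rewrite pi1 oner_eq0. Qed.

(** By maximality the ideal [m + R r] is [m] or [R]. In the second case [1 = a + s r] with [a] in
    [m], and [pi] kills the right-hand side because [a] is nilpotent. *)
Lemma center_residue0 r : r \in R -> pi r = 0 -> r \in m.
Proof.
move=> rR pr; have [||I IP] := @vspace_pred F S
  (fun x => exists a s, [/\ a \in m, s \in R & x = a + s * r]).
- by exists 0, 0; rewrite !mem0v mul0r addr0.
- move=> c _ _ [a [s [am sR ->]]] [a' [s' [am' sR' ->]]].
  exists (c *: a + a'), (c *: s + s'); split; try by rewrite memvD ?memvZ.
  by rewrite scalerDr mulrDl scalerAl addrACA.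
have rI : r \in I by apply/IP; exists 0, 1; rewrite mem0v center1 mul1r add0r.
have idI : ideal_of R I.
  split; first apply/subvP => x /IP[a [s [am sR ->]]].
    by rewrite memvD ?(ideal_mem maximal_ideal_ideal am) // centerM.
  apply/prodvP => b x bR /IP[a [s [am sR ->]]]; apply/IP.
  by exists (b * a), (b * s); rewrite mulrDr mulrA centerM ?(idealM maximal_ideal_ideal).
have mI : (m <= I)%VS.
  by apply/subvP => x xm; apply/IP; exists x, 0; rewrite xm mem0v mul0r addr0.
case: maxm => _ _ /(_ I idI mI) [<- //|IR].
have : 1 \in I by rewrite IR center1.
move=> /IP[a [s [am _ /(congr1 pi)/eqP]]].
by rewrite pi1 piD piM pr mulr0 (maximal_ideal_residue am) addr0 oner_eq0.
Qed.

Hypothesis frameS : central_frame (@central S).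

(** The operators [psi_j] preserve the kernel of [pi] and have central values, so they map the
    radical into [m]. *)
Lemma radical_span x : pi x = 0 -> exists (J : finType) (g z : J -> S),
  (forall j, z j \in m) /\ x = \sum_j g j * z j.
Proof.
move=> px; have [J [g [psi [mpsi cpsi Epsi]]]] := frameS.
exists J, g, (psi^~ x); split=> // j; apply: center_residue0; last exact: pi_mulop.
exact/mem_center.
Qed.

(** The frame identity at 1 shows that some [psi_j 1] is outside the radical; it is then a central
    unit by which [psi_j] can be divided. *)
Lemma center_retraction : exists tau : S -> S,
  [/\ mulop tau, forall x, tau x \in R & tau 1 = 1].
Proof.
have [J [g [psi [mpsi cpsi Epsi]]]] := frameS.
have [j pj] : exists j, pi (psi j 1) != 0.
  apply: contrapT => h; have := oner_eq0 D.
  rewrite -pi1 (Epsi 1) pi_sum big1 ?eqxx // => j _.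
  rewrite piM; case: (eqVneq (pi (psi j 1)) 0) => [->|n0]; first by rewrite mulr0.
  by case: h; exists j.
have u := unit_pi pj.
exists (fun x => (psi j 1)^-1 * psi j x); split; first exact: mulop_l.
  move=> x; apply/mem_center => y; rewrite -mulrA (cpsi j x) !mulrA; congr (_ * _).
  by apply: (mulrI u); rewrite !mulrA (cpsi j 1 y) mulrK // divrr ?mul1r.
by rewrite mulVr.
Qed.

Lemma maximal_ideal_mul x y : x \in m -> y \in m -> x * y \in (m ^+ 2)%VS.
Proof. by move=> xm ym; rewrite expv2 memv_mul. Qed.

Lemma maximal_ideal_sqr : (m ^+ 2 <= m)%VS /\ forall s x, s \in R -> x \in (m ^+ 2)%VS ->
  s * x \in (m ^+ 2)%VS.
Proof.
split.
  rewrite expv2; apply/prodvP => x y xm ym; apply: (idealM maximal_ideal_ideal) => //.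
  exact: ideal_mem maximal_ideal_ideal _.
move=> s x sR xm; suff /subvP/(_ (s * x)) : (R * m ^+ 2 <= m ^+ 2)%VS.
  by apply; apply: memv_mul.
by rewrite expv2 prodvA prodvSl //; case: maximal_ideal_ideal.
Qed.

(** A Nakayama argument: [m <= R a + m^2] iterates to [m <= R a + m^(k+1)], and [m] is nilpotent.
    Then [m^k <= R a^k] for all [k], so [a ^+ e.-1 = 0] would contradict the minimality of [e]. *)
Lemma uniformizer d : has_cotangent_dim R m d -> (d <= 1)%N ->
  exists a : S, [/\ central a, a ^+ e = 0, a ^+ e.-1 != 0 &
    forall x, pi x = 0 -> exists s, x = a * s].
Proof.
move=> [v [vm vspan _]] d1; have [e0 me emin] := nilm.
have [a am aspan] : exists2 a, a \in m & forall w, w \in m ->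
    exists2 r, r \in R & w - r * a \in (m ^+ 2)%VS.
  (* For [d = 0] one has [m <= m^2], and [a = 0] serves. *)
  case: d d1 v vm vspan => [|[|//]] _ v vm vspan.
    exists 0; first exact: mem0v.
    move=> w /vspan[r _]; rewrite big_ord0 => wm; exists 0; first exact: mem0v.
    by rewrite mulr0.
  exists (v ord0) => // w /vspan[r rR]; rewrite big_ord1 => wm.
  by exists (r ord0).
have ca := maximal_ideal_central am.
pose A := (R * <[a]>)%VS.
have mA2 : (m <= A + m ^+ 2)%VS.
  apply/subvP => w /aspan[r rR wr]; rewrite -[w](subrK (r * a)) addrC memv_add //.
  by rewrite memv_mul // memv_line.
have AR x y : x \in R -> y \in A -> x * y \in A.
  move=> xR yA; suff /subvP/(_ (x * y)) : (R * A <= A)%VS by apply; apply: memv_mul.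
  by rewrite prodvA prodvSl //; apply/prodvP => *; apply: centerM.
have mkR k : (m ^+ k <= R)%VS.
  elim: k => [|k IH].
    by rewrite expv0; apply/subvP => x /vlineP[c ->]; exact: center_scalar.
  rewrite expvSl; apply/prodvP => x y /(ideal_mem maximal_ideal_ideal) xR /(subvP IH).
  exact: centerM.
have mAk k : (m <= A + m ^+ k.+1)%VS.
  elim: k => [|k IH]; first by rewrite expv1 addvSr.
  apply: (subv_trans mA2); rewrite subv_add addvSl /= expv2.
  apply: (subv_trans (prodvSr m IH)); rewrite prodvDr subv_add.
  rewrite -expvSl addvSr andbT; apply: subv_trans (addvSl _ _).
  by apply/prodvP => x y /(ideal_mem maximal_ideal_ideal); exact: AR.
have mA : (m <= A)%VS.
  by have := mAk e; rewrite expvSl me prodv0 addv0.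
have mRa k : (m ^+ k <= R * <[a ^+ k]>)%VS.
  elim: k => [|k IH].
    rewrite expr0 expv0; apply/subvP => x /vlineP[c ->].
    by apply/memv_cosetP; exists c%:A; rewrite ?mulr1 ?center_scalar.
  rewrite expvSl; apply/prodvP => x y /(subvP mA)/memv_cosetP[r rR ->].
  move=> /(subvP IH)/memv_cosetP[s sR ->]; apply/memv_cosetP.
  exists (r * s); first exact: centerM.
  by rewrite exprS !mulrA; congr (_ * _); rewrite -!mulrA ca.
exists a; split=> //.
- by apply/eqP; rewrite -memv0 -me memv_expv.
- apply/negP => /eqP a0.
  case: e a0 emin => [|[|k]] /= a0 emin'; [|by move: a0 => /eqP; rewrite oner_eq0|].
    by move: a0 => /eqP; rewrite oner_eq0.
  have := emin' k.+1 isT; rewrite ltnn => h; apply: notF; apply: h.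
  apply/eqP; rewrite -subv0; apply: subv_trans (mRa _) _.
  by rewrite a0 prodv0 subvv.
- move=> x /radical_span[J [g [z [zm ->]]]].
  have /boolp.choice[r rP] j : exists r, z j = r * a.
    have := subvP (mRa 1%N) (z j); rewrite expv1 expr1 => /(_ (zm j)).
    by move=> /memv_cosetP[r _ ->]; exists r.
  exists (\sum_j g j * r j); rewrite mulr_sumr; apply: eq_bigr => j _.
  by rewrite rP mulrA -ca.
Qed.

(* [Q = H D'] for the kernel [H] of the functional on [m/m^2] that maps [v_0] to
   [lam], [v_1] to 1 and the other basis vectors to 0. *)
Lemma plane_ideals d : has_cotangent_dim R m d -> (2 <= d)%N ->
  exists v0 v1 : S, central v0 /\ central v1 /\ forall lam : F, exists Q : {vspace S},
    [/\ forall x s, x \in Q -> x * s \in Q,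
        v0 - lam *: v1 \in Q,
        forall x, pi x = 0 -> exists s, x - v1 * s \in Q,
        forall s, v1 * s \in Q -> pi s = 0 &
        forall x, pi x = 0 -> v1 * x \in Q] /\ (forall x, x \in Q -> pi x = 0).
Proof.
case: d => [|[|d]] // [v [vm vspan vfree]] _.
pose i0 : 'I_d.+2 := ord0; pose i1 : 'I_d.+2 := lift ord0 ord0.
exists (v i0), (v i1); split; first exact: maximal_ideal_central.
split; first exact: maximal_ideal_central.
move=> lam.
have [m2m m2R] := maximal_ideal_sqr.
pose comb (r : 'I_d.+2 -> S) := \sum_(k < d.+2) r k * v k.
have [||H HP] := @vspace_pred F S (fun w => w \in m /\ exists r : 'I_d.+2 -> S,
   [/\ forall k, r k \in R, w - comb r \in (m ^+ 2)%VS & lam *: r i0 + r i1 \in m]).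
- split; first exact: mem0v.
  exists (fun=> 0); split=> [k||]; rewrite ?scaler0 ?addr0 ?mem0v //.
  by rewrite /comb big1 ?subr0 ?mem0v // => k _; rewrite mul0r.
- move=> c w w' [wm [r [rR rw rl]]] [wm' [r' [rR' rw' rl']]].
  split; first by rewrite memvD ?memvZ.
  exists (fun k => c *: r k + r' k); split.
  + by move=> k; rewrite memvD ?memvZ.
  + have -> : c *: w + w' - comb (fun k => c *: r k + r' k) =
      c *: (w - comb r) + (w' - comb r').
      rewrite scalerBr addrACA; congr (_ + _); rewrite -opprD; congr (- _).
      rewrite /comb scaler_sumr -big_split /=; apply: eq_bigr => k _.
      by rewrite mulrDl scalerAl.
    by rewrite memvD ?memvZ.
  + rewrite scalerDr scalerA mulrC -scalerA addrACA -scalerDr.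
    by rewrite memvD ?memvZ.
have HM s w : s \in R -> w \in H -> s * w \in H.
  move=> sR /HP[wm [r [rR rw rl]]]; apply/HP.
  split; first exact: idealM maximal_ideal_ideal _ _.
  exists (fun k => s * r k); split.
  + by move=> k; apply: centerM.
  + have -> : s * w - comb (fun k => s * r k) = s * (w - comb r).
      rewrite mulrBr; congr (_ - _); rewrite /comb mulr_sumr; apply: eq_bigr => k _.
      by rewrite mulrA.
    exact: m2R.
  + by rewrite scalerAr -mulrDr; apply: idealM maximal_ideal_ideal _ _.
have Hm w : w \in H -> w \in m by move=> /HP[].
have m2H w : w \in (m ^+ 2)%VS -> w \in H.
  move=> wm2; apply/HP; split; first exact: (subvP m2m).
  exists (fun=> 0); split=> [k||]; rewrite ?scaler0 ?addr0 ?mem0v //.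
  by rewrite /comb big1 ?subr0 // => k _; rewrite mul0r.
have delta k : v k = comb (fun l => (k == l)%:R).
  rewrite /comb (bigD1 k) //= big1 ?eqxx ?mul1r ?addr0 // => l lk.
  by rewrite eq_sym (negPf lk) mul0r.
have natR (b : bool) : b%:R \in R by case: b; rewrite ?center1 ?mem0v.
have v1H : v i1 \notin H.
  apply/negP => /HP[_ [r [rR rw rl]]].
  have comb_sub : v i1 - comb r = \sum_(k < d.+2) ((i1 == k)%:R - r k) * v k.
    by rewrite {1}delta /comb -sumrB; apply: eq_bigr => k _; rewrite mulrBl.
  rewrite comb_sub in rw.
  have sub1 k : (i1 == k)%:R - r k \in m.
    by apply: (vfree (fun k => (i1 == k)%:R - r k)) => // l; rewrite memvB.
  have := sub1 i0; rewrite /= sub0r memvN => r0m.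
  have := sub1 i1; rewrite eqxx => r1m.
  have r1 : r i1 \in m by rewrite -[r i1](addKr (lam *: r i0)) memvD // memvN memvZ.
  by have := maximal_ideal_neq1; rewrite -[1 : S](subrK (r i1)) memvD.
pose Q := (H * fullv)%VS.
have HQ h s : h \in H -> h * s \in Q by move=> hH; rewrite memv_mul ?memvf.
(* As [tau (h s) = h (tau s)] for [h] in [H], the retraction maps [Q] into [H] while it fixes
   central elements: the extension of [H] to [S] contains no new central element. *)
have QH z : central z -> z \in Q -> z \in H.
  have [tau [mtau tauR tau1]] := center_retraction.
  have [||U UP] := @vspace_pred F S (fun x => tau x \in H).
  - by rewrite (mulop0E mtau) mem0v.
  - by move=> c x y xH yH; rewrite mulopD // (mulopZ _ _ mtau) memvD ?memvZ.
  have QU : (Q <= U)%VS.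
    apply/prodvP => h s hH _; apply/UP.
    rewrite mulop_central //; last exact/maximal_ideal_central/Hm.
    have /mem_center -> := ideal_mem maximal_ideal_ideal (Hm h hH).
    exact: HM.
  by move=> cz /(subvP QU)/UP; rewrite -[z]mulr1 mulop_central // tau1.
have Qpi x : x \in Q -> pi x = 0.
  have [||U UP] := @vspace_pred F S (fun x => pi x = 0).
  - exact: rmorph0.
  - by move=> c y z py pz; rewrite piD piZ py pz scaler0 addr0.
  have QU : (Q <= U)%VS.
    by apply/prodvP => h s /Hm/maximal_ideal_residue ph _; apply/UP; rewrite piM ph mul0r.
  by move=> /(subvP QU)/UP.
exists Q; split=> //; split.
- move=> x s xQ; suff /subvP/(_ (x * s)) : (Q * fullv <= Q)%VS.
    by apply; rewrite memv_mul ?memvf.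
  by rewrite /Q -prodvA prodvSr // subvf.
- rewrite -[_ - _]mulr1; apply: HQ; apply/HP; split.
    by rewrite memvB ?memvZ.
  exists (fun k => (i0 == k)%:R - lam *: (i1 == k)%:R); split.
  + by move=> k; rewrite memvB ?memvZ.
  + rewrite {1}[v i0]delta {1}[v i1]delta /comb scaler_sumr -sumrB.
    rewrite -sumrB big1 ?mem0v // => k _.
    by rewrite mulrBl scalerAl subrr.
  + by rewrite !eqxx /= scaler0 subr0 sub0r subrr mem0v.
- move=> x /radical_span[J [g [z [zm ->]]]].
  (* Modulo the kernel [H], an element of [m] is the value of the functional on it times [v i1],
     which has value 1. *)
  have /boolp.choice[r rP] j : exists r, r \in R /\ z j - r * v i1 \in H.
    have [r rR rw] := vspan _ (zm j).
    have sR : lam *: r i0 + r i1 \in R by rewrite memvD ?memvZ.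
    exists (lam *: r i0 + r i1); split=> //; apply/HP; split.
      by rewrite memvB // (idealM maximal_ideal_ideal).
    exists (fun k => r k - (lam *: r i0 + r i1) * (i1 == k)%:R); split.
    + by move=> k; rewrite memvB ?centerM.
    + rewrite {1}[v i1]delta /comb mulr_sumr.
      under [X in _ - X]eq_bigr => k _ do rewrite mulrBl -mulrA.
      by rewrite sumrB opprB addrA subrK.
    + by rewrite !eqxx /= mulr0 subr0 mulr1 addrA subrr mem0v.
  exists (\sum_j g j * r j); rewrite mulr_sumr -sumrB memv_suml // => j _.
  have [rR zr] := rP j.
  have -> : g j * z j - v i1 * (g j * r j) = (z j - r j * v i1) * g j.
    rewrite mulrBl (maximal_ideal_central (zm j)); congr (_ - _).
    rewrite (maximal_ideal_central (vm i1)) -mulrA.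
    have /mem_center -> // := centerM rR (ideal_mem maximal_ideal_ideal (vm i1)).
  exact: HQ.
- move=> s vs; apply/eqP/negPn/negP => /unit_pi us.
  move/negP: v1H; apply; apply: QH; first exact: maximal_ideal_central.
  have -> : v i1 = v i1 * s * s^-1 by rewrite -mulrA divrr ?mulr1.
  suff /subvP : (Q * fullv <= Q)%VS by apply; rewrite memv_mul ?memvf.
  by rewrite /Q -prodvA prodvSr // subvf.
- move=> x /radical_span[J [g [z [zm ->]]]]; rewrite mulr_sumr memv_suml // => j _.
  by rewrite -(maximal_ideal_central (zm j)) mulrA; apply/HQ/m2H/maximal_ideal_mul.
Qed.

End LocalAlgebra.

(** * Right modules and their length *)

(** The finite-dimensional carrier is built in, so that kernels, images and ranks are at hand;
    [has_length_rmod] shows that over a local algebra every module of finite length has this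
    form. *)
Record rmod (F : fieldType) (S : falgType F) := RMod {
  rcar :> vectType F;
  ract : rcar -> S -> rcar;
  ract_linl : forall s, linear (ract^~ s);
  ract_linr : forall v, linear (ract v);
  ract1 : forall v, ract v 1 = v;
  ractM : forall v s t, ract v (s * t) = ract (ract v s) t }.

Notation "v *> s" := (ract v s) (at level 40, left associativity).

Section RModTheory.
Variables (F : fieldType) (S : falgType F).
Implicit Types (M N : rmod S).

Definition ractl M (s : S) := fun v : M => v *> s.
Definition ractr M (v : M) := fun s : S => v *> s.

HB.instance Definition _ M s :=
  GRing.isLinear.Build F M M _ (@ractl M s) (@ract_linl F S M s).
HB.instance Definition _ M v :=
  GRing.isLinear.Build F S M _ (@ractr M v) (@ract_linr F S M v).

Definition actl M (s : S) : 'End(M) := linfun (@ractl M s).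
Definition actr M (v : M) : 'Hom(S, M) := linfun (@ractr M v).

Lemma actlE M s (v : M) : actl M s v = v *> s. Proof. exact: lfunE. Qed.
Lemma actrE M s (v : M) : actr v s = v *> s. Proof. exact: lfunE. Qed.

Section Laws.
Variable M : rmod S.
Implicit Types (u v : M) (s t : S).

Lemma ract0l s : (0 : M) *> s = 0. Proof. exact: (linear0 (@ractl M s)). Qed.
Lemma ractDl u v s : (u + v) *> s = u *> s + v *> s.
Proof. exact: (linearD (@ractl M s)). Qed.
Lemma ractBl u v s : (u - v) *> s = u *> s - v *> s.
Proof. exact: (linearB (@ractl M s)). Qed.
Lemma ractZl c v s : (c *: v) *> s = c *: (v *> s).
Proof. exact: (linearZ_LR (@ractl M s)). Qed.
Lemma ract_suml (I : Type) (r : seq I) (P : pred I) (f : I -> M) s :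
  (\sum_(i <- r | P i) f i) *> s = \sum_(i <- r | P i) f i *> s.
Proof. exact: (linear_sum (@ractl M s)). Qed.
Lemma ract0r v : v *> 0 = 0. Proof. exact: (linear0 (@ractr M v)). Qed.
Lemma ractDr v s t : v *> (s + t) = v *> s + v *> t.
Proof. exact: (linearD (@ractr M v)). Qed.
Lemma ractBr v s t : v *> (s - t) = v *> s - v *> t.
Proof. exact: (linearB (@ractr M v)). Qed.
Lemma ractZr v c s : v *> (c *: s) = c *: (v *> s).
Proof. exact: (linearZ_LR (@ractr M v)). Qed.
Lemma ract_sumr v (I : Type) (r : seq I) (P : pred I) (f : I -> S) :
  v *> (\sum_(i <- r | P i) f i) = \sum_(i <- r | P i) v *> f i.
Proof. exact: (linear_sum (@ractr M v)). Qed.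
Lemma ract_scalar v c : v *> c%:A = c *: v.
Proof. by rewrite ractZr ract1. Qed.
Lemma ract_unitK v s : s \is a GRing.unit -> v *> s *> s^-1 = v.
Proof. by move=> us; rewrite -ractM divrr ?ract1. Qed.
End Laws.

Definition equivariant M N (f : M -> N) := forall v s, f (v *> s) = f v *> s.

Definition riso M N := exists (f : 'Hom(M, N)) (g : 'Hom(N, M)),
  [/\ cancel f g, cancel g f & equivariant f].

Lemma riso_lfun M N (f : 'Hom(M, N)) : lker f == 0%VS -> limg f = fullv ->
  equivariant f -> riso M N.
Proof.
move=> kf lf ef; exists f, f^-1%VF; split=> //; first exact: lker0_lfunK.
by move=> v; apply: limg_lfunVK; rewrite lf memvf.
Qed.

Lemma limg_ker0_full (V W : vectType F) (f : 'Hom(V, W)) : lker f == 0%VS ->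
  \dim {:V} = \dim {:W} -> limg f = fullv.
Proof.
move=> kf d; apply/eqP; rewrite eqEdim subvf -d /=.
by rewrite limg_dim_eq // (eqP kf) capv0.
Qed.

Lemma riso_dim_lfun M N (f : 'Hom(M, N)) : lker f == 0%VS ->
  \dim {:M} = \dim {:N} -> equivariant f -> riso M N.
Proof. by move=> kf d; apply: riso_lfun => //; exact: limg_ker0_full. Qed.

Lemma riso_sym M N : riso M N -> riso N M.
Proof.
move=> [f [g [fK gK ef]]]; exists g, f; split=> // v s.
by apply: (can_inj fK); rewrite ef !gK.
Qed.

Lemma riso_trans M N P : riso M N -> riso N P -> riso M P.
Proof.
move=> [f [g [fK gK ef]]] [f' [g' [fK' gK' ef']]].
exists (f' \o f)%VF, (g \o g')%VF; split=> [v|v|v s]; rewrite !comp_lfunE.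
- by rewrite fK' fK.
- by rewrite gK gK'.
- by rewrite ef ef'.
Qed.

(** The invariants that separate modules below: [s = 1] gives the dimension, powers of a uniformizer
    give a partition, and [v0 - lam *: v1] gives the parameter of an infinite family. *)
Lemma riso_act_dim M N s : riso M N ->
  \dim (limg (actl M s)) = \dim (limg (actl N s)).
Proof.
move=> [f [g [fK gK ef]]].
have kf : lker f == 0%VS by apply/lker0P/(can_inj fK).
rewrite -(limg_dim_eq (f := f)); last by rewrite (eqP kf) capv0.
congr (\dim _); rewrite -limg_comp; apply/vspaceP => v; apply/memv_imgP/memv_imgP.
- by move=> [u _ ->]; exists (f u); rewrite ?memvf // comp_lfunE !actlE ef.
- move=> [u _ ->]; exists (g u); rewrite ?memvf // comp_lfunE !actlE ef.
  by rewrite gK.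
Qed.

Lemma riso_dim M N : riso M N -> \dim {:M} = \dim {:N}.
Proof.
move=> /(riso_act_dim 1); have E P : limg (actl P 1) = fullv.
  suff -> : actl P 1 = \1%VF by rewrite lim1g.
  by apply/lfunP => v; rewrite actlE ract1 id_lfunE.
by rewrite !E.
Qed.

Definition stable M (U : {vspace M}) := forall u s, u \in U -> u *> s \in U.

Lemma stable_add M (U V : {vspace M}) : stable U -> stable V -> stable (U + V)%VS.
Proof.
move=> sU sV _ s /memv_addP[u uU [v vV ->]].
by rewrite ractDl memv_add ?sU ?sV.
Qed.

Lemma stable_limg_actr M (v : M) : stable (limg (actr v)).
Proof.
move=> _ s /memv_imgP[t _ ->]; rewrite actrE -ractM -actrE.
by rewrite memv_img ?memvf.
Qed.

(** A common source for submodules, restriction of scalars and Morita corners. For corners [theta 1]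
    is an idempotent other than 1 in general, hence the separate condition on the action of
    [theta 1]. *)
Lemma rsub_along (S' : falgType F) (theta : S' -> S) M (U : {vspace M}) :
  linear theta -> {morph theta : x y / x * y} ->
  (forall u s, u \in U -> u *> theta s \in U) -> (forall u, u \in U -> u *> theta 1 = u) ->
  exists (N : rmod S') (f : 'Hom(N, M)),
    [/\ lker f == 0%VS, limg f = U & forall v s, f (v *> s) = f v *> theta s].
Proof.
move=> lth mth sU U1; pose act (v : subvs_of U) s := vsproj U (vsval v *> theta s).
have actE v s : vsval (act v s) = vsval v *> theta s.
  by rewrite vsprojK // sU ?subvsP.
have ll s : linear (act^~ s).
  by move=> c u v /=; apply: subvs_inj; rewrite actE !vsval_is_linear !actE ractDl ractZl.
have lr v : linear (act v).
  by move=> c s t; apply: subvs_inj; rewrite actE vsval_is_linear !actE lth ractDr ractZr.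
have a1 v : act v 1 = v by apply: subvs_inj; rewrite actE U1 ?subvsP.
have aM v s t : act v (s * t) = act (act v s) t.
  by apply: subvs_inj; rewrite !actE mth ractM.
exists (RMod ll lr a1 aM), (linfun (@vsval F M U)); split.
- by apply/lker0P => u v; rewrite !lfunE /=; exact: subvs_inj.
- apply/vspaceP => v; apply/memv_imgP/idP => [[u _ ->]|vU].
    by rewrite lfunE /= subvsP.
  by exists (vsproj U v); rewrite ?memvf // lfunE /= vsprojK.
- by move=> v s; rewrite !lfunE /=; exact: actE.
Qed.

Lemma rsub_exists M (U : {vspace M}) : stable U ->
  exists (N : rmod S) (f : 'Hom(N, M)),
    [/\ lker f == 0%VS, limg f = U & equivariant f].
Proof.
by move=> sU; apply: (@rsub_along S id M U) => // u _; exact: ract1.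
Qed.

(** The quotient is realized on the complement [U^C], with [f] the projection along [U]. *)
Lemma rquo_exists M (U : {vspace M}) : stable U ->
  exists (N : rmod S) (f : 'Hom(M, N)),
    [/\ lker f = U, limg f = fullv & equivariant f].
Proof.
move=> sU; pose p (v : M) := vsproj U^C (v - projv U v).
have lp : linear p.
  move=> c u v; rewrite /p -vsproj_is_linear; congr (vsproj _ _).
  by rewrite linearP scalerBr opprD addrACA.
pose f : 'Hom(M, subvs_of U^C) := linfun (HB.pack_for {linear M -> subvs_of U^C} p
  (GRing.isLinear.Build _ _ _ _ p lp)).
have fE v : f v = p v by rewrite lfunE.
have kf v : (f v == 0) = (v \in U).
  rewrite fE /p; apply/eqP/idP => [/(congr1 vsval)|vU].
    rewrite vsprojK ?memv_projC //= => /eqP; rewrite subr_eq0 => /eqP ->.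
    exact: memv_proj.
  by rewrite projv_id // subrr linear0.
have valK w : f (vsval w) = w.
  rewrite fE /p; have -> : projv U (vsval w) = 0.
    by apply/eqP; rewrite -memv_ker lker_proj subvsP.
  by rewrite subr0 vsvalK.
pose act (v : subvs_of U^C) s := f (vsval v *> s).
have fact v s : act (f v) s = f (v *> s).
  apply/eqP; rewrite -subr_eq0 -linearB kf -ractBl; apply: sU.
  by rewrite -kf linearB /= valK subrr.
have ll s : linear (act^~ s).
  by move=> c u v; rewrite /act linearP ractDl ractZl linearP.
have lr v : linear (act v).
  by move=> c u w; rewrite /act ractDr ractZr linearP.
have a1 v : act v 1 = v by rewrite /act ract1 valK.
have aM v s t : act v (s * t) = act (act v s) t by rewrite /act ractM -fact.
exists (RMod ll lr a1 aM), f; split.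
- by apply/vspaceP => v; rewrite memv_ker kf.
- apply/vspaceP => v; rewrite memvf; apply/memv_imgP.
  by exists (vsval v); rewrite ?memvf ?valK.
- by move=> v s; rewrite -fact.
Qed.

Definition rzero : rmod S.
Proof.
exists 'rV[F]_0 (fun _ _ => 0).
- by move=> s c u v; rewrite scaler0 addr0.
- by move=> v c s t; rewrite scaler0 addr0.
- by move=> v; apply/rowP => [[]].
- by [].
Defined.

Definition rsum_act M N (p : (M * N)%type) s : (M * N)%type := (p.1 *> s, p.2 *> s).

Definition rsum M N : rmod S.
Proof.
exists (M * N)%type (@rsum_act M N).
- by move=> s c u v; rewrite /rsum_act /= !ractDl !ractZl.
- by move=> v c s t; rewrite /rsum_act /= !ractDr !ractZr.
- by move=> [u v]; rewrite /rsum_act /= !ract1.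
- by move=> v s t; rewrite /rsum_act /= !ractM.
Defined.

Lemma dim_rzero : \dim {:rzero} = 0%N.
Proof. by rewrite dimvf. Qed.

Lemma dim_rsum M N : \dim {:rsum M N} = (\dim {:M} + \dim {:N})%N.
Proof. by rewrite !dimvf. Qed.

Lemma rsum_actE M N (u : M) (v : N) s :
  ((u, v) : rsum M N) *> s = (u *> s, v *> s).
Proof. by []. Qed.

End RModTheory.

(** * Right modules as left modules over the converse ring *)

Section LeftModule.
Variables (F : fieldType) (S : falgType F) (M : rmod S).

Definition rlmod : Type := M.
HB.instance Definition _ := GRing.Zmodule.on rlmod.

Definition rlmod_scale (s : S^c) (v : rlmod) : rlmod := (v : M) *> s.

Let scaleA a b v : rlmod_scale a (rlmod_scale b v) = rlmod_scale (a * b) v.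
Proof. by rewrite /rlmod_scale -ractM. Qed.
Let scale1 : left_id 1 rlmod_scale.
Proof. by move=> v; exact: ract1. Qed.
Let scaleDr : right_distributive rlmod_scale +%R.
Proof. by move=> a u v; exact: ractDl. Qed.
Let scaleDl v : {morph rlmod_scale^~ v : a b / a + b}.
Proof. by move=> a b; exact: ractDr. Qed.

HB.instance Definition _ := GRing.Zmodule_isLmodule.Build S^c rlmod
  scaleA scale1 scaleDr scaleDl.

Lemma rlmod_scaleE (s : S^c) (v : rlmod) : s *: v = (v : M) *> s.
Proof. by []. Qed.

End LeftModule.

Section ModuleIso.
Variable S : nzRingType.
Implicit Types U V W : lmodType S.

Lemma module_iso_can U V (f : U -> V) g : linear f -> cancel f g -> cancel g f ->
  module_iso U V.
Proof.
move=> lf fK gK.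
exists (HB.pack_for {linear U -> V} f (GRing.isLinear.Build _ _ _ _ f lf)).
by exists g.
Qed.

Lemma module_iso_sym U V : module_iso U V -> module_iso V U.
Proof.
move=> [f [g fK gK]].
have lg : linear g.
  by move=> c u v; apply: (can_inj fK); rewrite linearP !gK.
exact: module_iso_can lg gK fK.
Qed.

Lemma module_iso_trans U V W : module_iso U V -> module_iso V W -> module_iso U W.
Proof.
move=> [f bf] [g bg]; exists (g \o f : {linear U -> W}); exact: bij_comp.
Qed.

Lemma submoduleD W (N : set W) u v : submodule N -> N u -> N v -> N (u + v).
Proof. by move=> [_ h] Nu Nv; rewrite -[u]scale1r; apply: h. Qed.

Lemma submoduleZ W (N : set W) a u : submodule N -> N u -> N (a *: u).
Proof. by move=> [h0 h] Nu; rewrite -[a *: u]addr0; apply: h. Qed.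

Lemma submoduleB W (N : set W) u v : submodule N -> N u -> N v -> N (u - v).
Proof.
by move=> sN Nu Nv; apply: submoduleD => //; rewrite -scaleN1r; apply: submoduleZ.
Qed.

End ModuleIso.

Section Rlmod.
Variables (F : fieldType) (S : falgType F).
Implicit Types (M N : rmod S).

Lemma module_iso_riso M N : module_iso (rlmod M) (rlmod N) <-> riso M N.
Proof.
split=> [[f [g fK gK]]|[f [g [fK gK ef]]]].
  have ef (v : M) s : f ((v : M) *> s : M) = (f v : N) *> s.
    exact: (linearZ_LR f s v).
  have lf : linear (f : M -> N).
    move=> c u v; rewrite -ract_scalar; have := linearD f (u *> c%:A) v => /= ->.
    by rewrite ef ract_scalar.
  pose f' : 'Hom(M, N) := linfun (HB.pack_for {linear M -> N} (f : M -> N)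
    (GRing.isLinear.Build _ _ _ _ (f : M -> N) lf)).
  have f'E v : f' v = f v by rewrite lfunE.
  apply: (riso_lfun (f := f')).
  - by apply/lker0P => u v; rewrite !f'E => /(can_inj fK).
  - apply/vspaceP => v; rewrite memvf; apply/memv_imgP.
    by exists (g v); rewrite ?memvf // f'E gK.
  - by move=> v s; rewrite !f'E.
have lf : linear (f : rlmod M -> rlmod N).
  by move=> c u v; rewrite !rlmod_scaleE linearD /= ef.
exact: (module_iso_can lf fK gK).
Qed.

Lemma submodule_stable M (U : {vspace M}) :
  stable U <-> submodule [set v : rlmod M | (v : M) \in U].
Proof.
split=> [sU|[_ h] u s uU]; last first.
  have := h s u 0 uU (mem0v U); rewrite /= addr0; exact.
by split=> [|a u v uU vU]; [exact: mem0v | apply: memvD => //; exact: sU].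
Qed.

Lemma submodule_vspace M (N : set (rlmod M)) : submodule N ->
  exists U : {vspace M}, stable U /\ N = [set v : rlmod M | (v : M) \in U].
Proof.
move=> sN; have [||U UP] := @vspace_pred F M N.
- by case: sN.
- move=> c u v Nu Nv; rewrite -ract_scalar.
  by case: sN => _ h; exact: (h (c%:A) u v Nu Nv).
have E : N = [set v : rlmod M | (v : M) \in U].
  by apply/seteqP; split=> v /=; rewrite UP.
by exists U; split=> //; apply/submodule_stable; rewrite -E.
Qed.

End Rlmod.

(** * Length and dimension over a local algebra *)

Section Length.
Variables (F : fieldType) (S D : falgType F) (pi : {lrmorphism S -> D}).
Hypotheses (divD : division_algebra D) (ssq : is_ss_quotient pi).

Let piM x y : pi (x * y) = pi x * pi y. Proof. exact: rmorphM. Qed.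
Let piD x y : pi (x + y) = pi x + pi y. Proof. exact: rmorphD. Qed.
Let piB x y : pi (x - y) = pi x - pi y. Proof. exact: rmorphB. Qed.
Let pi1 : pi 1 = 1. Proof. exact: rmorph1. Qed.

(** By simplicity [v] generates [B / A]. A scalar outside the radical is a unit and cannot send [v]
    into [A]; conversely, if radical multiples of [v] filled [B / A], then [(1 - r) v] would be in
    [A] for some radical [r], although [1 - r] is a unit. *)
Lemma simple_step (W : lmodType S^c) (A B : set W) (v : W) :
  submodule A -> submodule B -> A `<=` B -> B v -> ~ A v ->
  (forall N', submodule N' -> A `<=` N' -> N' `<=` B -> N' = A \/ N' = B) ->
  (forall s : S, A ((s : S^c) *: v) <-> pi s = 0) /\
  (forall b, B b -> exists s : S, A (b - (s : S^c) *: v)).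
Proof.
move=> sA sB AB Bv nAv simp.
have A0 : A 0 by case: sA.
have cancelU (s : S) : s \is a GRing.unit -> A ((s : S^c) *: v) -> A v.
  move=> us As; suff -> : v = (s^-1 : S^c) *: ((s : S^c) *: v) by apply: submoduleZ.
  rewrite scalerA; have -> : (s^-1 : S^c) * (s : S^c) = 1 by exact: (divrr us).
  by rewrite scale1r.
split=> [s|]; last first.
  pose X := [set x : W | exists2 s : S^c, A (x - s *: v) & True].
  have sX : submodule X.
    split; first by exists 0; rewrite ?scale0r ?subr0.
    move=> a x y [s As _] [s' As' _]; exists (a * s + s') => //.
    rewrite scalerDl -scalerA opprD addrACA -scalerBr.
    by apply: submoduleD => //; apply: submoduleZ.
  have AX : A `<=` X by move=> x Ax; exists 0; rewrite ?scale0r ?subr0.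
  have XB : X `<=` B.
    move=> x [s As _]; rewrite -[x](subrK (s *: v)).
    by apply: submoduleD => //; [apply: AB | apply: submoduleZ].
  have Xv : X v by exists 1; rewrite ?scale1r ?subrr.
  have [XA|XB'] := simp X sX AX XB; first by case: nAv; rewrite -XA.
  by move=> b; rewrite -XB' => -[s As _]; exists s.
split=> [As|ps].
  apply/eqP/negPn/negP => /(unit_pi divD ssq) us; apply: nAv.
  exact: cancelU As.
pose Y := [set x : W | exists2 s : S^c, A (x - s *: v) & pi (s : S) = 0].
have sY : submodule Y.
  split; first by exists 0; rewrite ?scale0r ?subr0 //; exact: rmorph0.
  move=> a x y [s1 As p1] [s2 As' p2]; exists (a * s1 + s2).
    rewrite scalerDl -scalerA opprD addrACA -scalerBr.
    by apply: submoduleD => //; apply: submoduleZ.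
  have -> : pi (a * s1 + s2 : S^c) = pi s1 * pi a + pi s2 by rewrite -piM -piD.
  by rewrite p1 p2 mul0r addr0.
have AY : A `<=` Y.
  by move=> x Ax; exists 0; rewrite ?scale0r ?subr0 //; exact: rmorph0.
have YB : Y `<=` B.
  move=> x [s1 As _]; rewrite -[x](subrK (s1 *: v)).
  by apply: submoduleD => //; [apply: AB | apply: submoduleZ].
have Ysv : Y ((s : S^c) *: v) by exists s; rewrite ?subrr.
have [<- //|YB'] := simp Y sY AY YB.
have : Y v by rewrite YB'.
move=> [r Ar pr]; case: nAv; apply: (cancelU (1 - r)).
  by apply: (unit_pi divD ssq); rewrite piB pi1 pr subr0 oner_neq0.
by rewrite scalerBl scale1r.
Qed.

Lemma residue_section : exists sg : {linear D -> S}, cancel sg pi.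
Proof.
exists (linfun pi)^-1%VF => y.
have /limg_lfunVK : y \in limg (linfun pi).
  by have [x <-] := ssq.1 y; apply/memv_imgP; exists x; rewrite ?memvf ?lfunE.
by rewrite lfunE.
Qed.

(** [W] comes without a basis over [F]. A space of coordinates is built along the composition
    series, each simple factor contributing a copy of [D] through the linear section [sg], and the
    action is transported to it. *)
Lemma has_length_rmod (W : lmodType S^c) x : has_length W x ->
  exists2 M : rmod S, \dim {:M} = (x * \dim {:D})%N & module_iso W (rlmod M).
Proof.
move=> [N [sN N0 Nx simp]]; have [sg sgK] := residue_section.
have psg s : pi (s - sg (pi s)) = 0 by rewrite piB sgK subrr.
have [V [phi [dV phiP phi_inj phiN]]] : exists (V : vectType F) (phi : V -> W),
  [/\ \dim {:V} = (x * \dim {:D})%N,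
      forall c u v, phi (c *: u + v) = (c%:A : S^c) *: phi u + phi v,
      forall v, phi v = 0 -> v = 0 &
      forall w, N x w <-> exists v, phi v = w].
  move: (leqnn x); elim: {-2}x => [_|k IH kx].
    exists 'rV[F]_0, (fun _ => 0); split.
    - by rewrite dimvf.
    - by move=> c u v; rewrite scaler0 addr0.
    - by move=> v _; apply/rowP => [[]].
    - move=> w; rewrite N0 /=; split=> [->|[_ <-] //]; by exists 0.
  have [V [phi [dV phiP phi_inj phiN]]] := IH (ltnW kx).
  have [[NN /nonsubset[v [Nv nNv]]] smp] := simp k kx.
  have [kerv genv] := simple_step (sN k (ltnW kx)) (sN k.+1 kx) NN Nv nNv smp.
  exists (V * D)%type, (fun p => phi p.1 + (sg p.2 : S^c) *: v); split.
  - by rewrite mulSn addnC -dV !dimvf.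
  - move=> c [u y] [u' y'] /=.
    have -> : sg (c *: y + y') = (c%:A : S^c) * (sg y : S^c) + sg y'.
      by rewrite linearP; congr (_ + _); have := scalerAr c (sg y : S) 1; rewrite mulr1.
    by rewrite phiP scalerDl -scalerA scalerDr addrACA.
  - move=> [u y] /= E.
    have Nsg : N k ((sg y : S^c) *: v).
      have -> : (sg y : S^c) *: v = 0 - phi u by rewrite -E addrC addKr.
      apply: submoduleB; first exact: sN (ltnW kx).
        by case: (sN k (ltnW kx)).
      by apply/phiN; exists u.
    move/kerv: Nsg; rewrite sgK => y0; move: E; rewrite y0 linear0 scale0r addr0.
    by move=> /phi_inj ->.
  - move=> w; split=> [/genv[s Ns]|[[u y] /= <-]].
      have : N k (w - (sg (pi s) : S^c) *: v).
        have -> : w - (sg (pi s) : S^c) *: v =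
            (w - (s : S^c) *: v) + ((s - sg (pi s) : S) : S^c) *: v.
          by rewrite scalerBl addrA subrK.
        apply: submoduleD; [exact: sN (ltnW kx) | by [] |].
        by apply/kerv.
      move=> /phiN[u E]; exists (u, pi s) => /=.
      by rewrite E subrK.
    apply: submoduleD; first exact: sN.
      by apply: NN; apply/phiN; exists u.
    by apply: submoduleZ; first exact: sN.
have phi0 : phi 0 = 0.
  by have := phiP (-1) 0 0; rewrite scaler0 addr0 scaleN1r scaleN1r addNr.
have phiD u v : phi (u + v) = phi u + phi v.
  by rewrite -[u in LHS]scale1r phiP scale1r scale1r.
have phiZ c u : phi (c *: u) = (c%:A : S^c) *: phi u.
  by rewrite -[c *: u]addr0 phiP phi0 addr0.
have phi_inj' : injective phi.
  move=> u v E; apply/eqP; rewrite -subr_eq0; apply/eqP/phi_inj.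
  by rewrite phiD -[- v]scaleN1r phiZ scaleN1r E scaleN1r subrr.
have /boolp.choice[psi psiK] w : exists v, phi v = w by apply/phiN; rewrite Nx.
have phiK : cancel phi psi by move=> v; apply: phi_inj'; rewrite psiK.
pose act v (s : S) := psi ((s : S^c) *: phi v).
have actE v s : phi (act v s) = (s : S^c) *: phi v by rewrite psiK.
have ll s : linear (act^~ s).
  move=> c u v; apply: phi_inj'; rewrite actE !phiP !actE scalerDr !scalerA.
  congr (_ *: _ + _); by have : c%:A * s = s * c%:A by rewrite -scalerAl -scalerAr mul1r mulr1.
have lr v : linear (act v).
  move=> c s t; apply: phi_inj'; rewrite phiP !actE scalerDl scalerA.
  by congr (_ *: _ + _); have := scalerAr c (s : S) 1; rewrite mulr1.
have a1 v : act v 1 = v by apply: phi_inj'; rewrite actE scale1r.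
have aM v s t : act v (s * t) = act (act v s) t.
  by apply: phi_inj'; rewrite !actE scalerA.
exists (RMod ll lr a1 aM) => //.
apply: module_iso_sym.
have lphi : linear (phi : rlmod (RMod ll lr a1 aM) -> W).
  by move=> c u v; rewrite phiD rlmod_scaleE /= actE.
exact: (module_iso_can lphi phiK psiK).
Qed.

Lemma rmod_has_length (M : rmod S) :
  exists2 x, has_length (rlmod M) x & \dim {:M} = (x * \dim {:D})%N.
Proof.
have [sg sgK] := residue_section.
have psg s : pi (s - sg (pi s)) = 0 by rewrite piB sgK subrr.
pose set_of (U : {vspace M}) := [set v : rlmod M | (v : M) \in U].
have set_of_le U V : set_of U `<=` set_of V <-> (U <= V)%VS.
  by split=> [UV|/subvP UV v]; [apply/subvP => v; exact: UV | exact: UV].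
have set_of_inj U V : set_of U = set_of V -> U = V.
  by move=> E; apply/vspaceP => v; apply/idP/idP; have := congr1 (@^~ v) E;
    rewrite /set_of /= => ->.
(* A stable subspace of least dimension strictly above [U] has a simple factor, which [simple_step]
   identifies with [D]. *)
have step U : stable U -> U != fullv -> exists U' : {vspace M},
    [/\ stable U', \dim U' = (\dim U + \dim {:D})%N, set_of U `<` set_of U' &
      forall N', submodule N' -> set_of U `<=` N' -> N' `<=` set_of U' ->
        N' = set_of U \/ N' = set_of U'].
  move=> sU nU; have [|U' [sU' UU' nUU'] U'min] := @ex_min_nat _
    (fun V => [/\ stable V, (U <= V)%VS & U != V]) (fun V => \dim V).
    by exists fullv; split=> //; [move=> *; exact: memvf | exact: subvf].
  have simp N' : submodule N' -> set_of U `<=` N' -> N' `<=` set_of U' ->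
        N' = set_of U \/ N' = set_of U'.
    move=> /submodule_vspace[V [sV ->]] /set_of_le UV /set_of_le VU'.
    have [->|nUV] := eqVneq U V; [by left | right].
    congr set_of; apply/eqP; rewrite -(geq_leqif (dimv_leqif_eq VU')).
    exact: U'min.
  have nU'U : ~ (U' <= U)%VS.
    by move=> U'U; move: nUU'; rewrite eqEsubv UU' U'U.
  exists U'; split=> //; last by split; [exact/set_of_le | move/set_of_le].
  have [v vU' nvU] : exists2 v, v \in U' & v \notin U by apply/subvPn/negP.
  have [kerv genv] := @simple_step (rlmod M) (set_of U) (set_of U') v
    (proj1 (submodule_stable _) sU) (proj1 (submodule_stable _) sU')
    (proj2 (set_of_le _ _) UU') vU' (fun h => negP nvU h) simp.
  pose h : 'Hom(D, M) := (actr v \o linfun sg)%VF.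
  have hE y : h y = v *> sg y by rewrite comp_lfunE actrE lfunE.
  have hU y : h y \in U -> y = 0.
    by rewrite hE => /(kerv (sg y)); rewrite sgK.
  have kh : lker h == 0%VS.
    apply/lker0P => y z E; apply/eqP; rewrite -subr_eq0; apply/eqP/hU.
    by rewrite linearB /= E subrr mem0v.
  have dh : \dim (limg h) = \dim {:D} by rewrite limg_dim_eq // (eqP kh) capv0.
  rewrite -dh -dimv_disjoint_sum; last first.
    apply/eqP; rewrite -subv0; apply/subvP => w /memv_capP[wU /memv_imgP[y _ E]].
    by rewrite memv0 E (hU y) ?linear0 // -E.
  congr (\dim _); apply/eqP; rewrite eqEsubv; apply/andP; split; last first.
    rewrite subv_add UU'; apply/subvP => w /memv_imgP[y _ ->].
    by rewrite hE; apply: sU'.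
  apply/subvP => w /genv[s ws]; rewrite -[w](subrK (v *> sg (pi s))).
  apply: memv_add; last by rewrite -hE memv_img ?memvf.
  rewrite -[w](subrK (v *> s)) -addrA -ractBr; apply: memvD; first exact: ws.
  exact/kerv.
(* Induction on a bound for the codimension, prolonging the series upwards from [U]. *)
suff chain k (U : {vspace M}) : stable U -> (\dim {:M} - \dim U <= k)%N ->
    exists x (N : nat -> set (rlmod M)),
    [/\ (forall k, (k <= x)%N -> submodule (N k)), N 0%N = set_of U, N x = setT,
        (forall k, (k < x)%N -> N k `<` N k.+1 /\
          forall N', submodule N' -> N k `<=` N' -> N' `<=` N k.+1 ->
            N' = N k \/ N' = N k.+1) &
        \dim {:M} = (\dim U + x * \dim {:D})%N].
  have [|x [N [sN N0 Nx simp d]]] := chain _ 0%VS _ (leqnn _).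
    by move=> u s; rewrite !memv0 => /eqP ->; rewrite ract0l.
  exists x; last by rewrite d dimv0.
  exists N; split=> //; rewrite N0; apply/seteqP; split=> [v|v ->]; last exact: mem0v.
  by rewrite /set_of /= (@memv0 F M v) => /eqP.
elim: k U => [|k IH] U sU dU.
  have -> : U = fullv by apply/eqP; rewrite eqEdim subvf -subn_eq0 -leqn0.
  exists 0%N, (fun=> setT); split=> //; last by rewrite addn0.
  by apply/seteqP; split=> v //= _; exact: memvf.
have [->|nU] := eqVneq U fullv.
  exists 0%N, (fun=> setT); split=> //; last by rewrite addn0.
  by apply/seteqP; split=> v //= _; exact: memvf.
have [U' [sU' dU' UU' simp]] := step U sU nU.
have dD : (0 < \dim {:D})%N.
  by rewrite lt0n dimv_eq0 -subv0; apply/negP => /subvP/(_ 1 (memvf _));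
    rewrite memv0 oner_eq0.
have [|x [N [sN N0 Nx smp d]]] := IH U' sU'.
  by rewrite dU' subnDA leq_subLR addnC (leq_trans dU) // -addn1 leq_add2l.
exists x.+1, (fun k => if k is k'.+1 then N k' else set_of U); split=> //.
- by case=> [_|i]; [exact/submodule_stable | exact: sN].
- case=> [_|i ix]; last exact: smp.
  by rewrite N0.
- by rewrite d dU' mulSn addnA.
Qed.

End Length.

Definition hom_of (F : fieldType) (V W : vectType F) (f : V -> W) (lf : linear f) :
  'Hom(V, W) :=
  linfun (HB.pack_for {linear V -> W} f (GRing.isLinear.Build _ _ _ _ f lf)).

Lemma hom_ofE (F : fieldType) (V W : vectType F) (f : V -> W) (lf : linear f) v :
  hom_of lf v = f v.
Proof. by rewrite /hom_of lfunE. Qed.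

(** * Direct sums and cyclic modules *)

Section DirectSums.
Variables (F : fieldType) (S : falgType F).
Implicit Types (M N : rmod S).

Lemma riso_rsum M M' N N' : riso M M' -> riso N N' -> riso (rsum M N) (rsum M' N').
Proof.
move=> [f [g [fK gK ef]]] [f' [g' [fK' gK' ef']]].
have lf : linear (fun p : rsum M N => (f p.1, f' p.2) : rsum M' N').
  by move=> c u v; rewrite !linearP.
have lg : linear (fun p : rsum M' N' => (g p.1, g' p.2) : rsum M N).
  by move=> c u v; rewrite !linearP.
exists (hom_of lf), (hom_of lg); split.
- by move=> [u v]; rewrite !hom_ofE /= fK fK'.
- by move=> [u v]; rewrite !hom_ofE /= gK gK'.
- by move=> [u v] s; rewrite !hom_ofE !rsum_actE /= ef ef'.
Qed.

Lemma rsum_act_dim M N s : \dim (limg (actl (rsum M N) s)) =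
  (\dim (limg (actl M s)) + \dim (limg (actl N s)))%N.
Proof.
have l1 : linear (fun u : M => (u, 0) : rsum M N).
  by move=> c u v; congr pair; rewrite /= scaler0 addr0.
have l2 : linear (fun v : N => (0, v) : rsum M N).
  by move=> c u v; congr pair; rewrite /= scaler0 addr0.
pose i1 := hom_of l1; pose i2 := hom_of l2.
have k1 : lker i1 == 0%VS by apply/lker0P => u v; rewrite !hom_ofE => -[].
have k2 : lker i2 == 0%VS by apply/lker0P => u v; rewrite !hom_ofE => -[].
rewrite -(limg_dim_eq (f := i1)); last by rewrite (eqP k1) capv0.
rewrite -(limg_dim_eq (f := i2)); last by rewrite (eqP k2) capv0.
rewrite -dimv_disjoint_sum.
  congr (\dim _); apply/vspaceP => w; apply/memv_imgP/memv_addP.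
    move=> [[u v] _ ->]; exists (i1 (u *> s)).
      by rewrite memv_img // -actlE memv_img ?memvf.
    exists (i2 (v *> s)); first by rewrite memv_img // -actlE memv_img ?memvf.
    by rewrite actlE !hom_ofE rsum_actE; congr pair; rewrite /= ?addr0 ?add0r.
  move=> [_ /memv_imgP[_ /memv_imgP[u _ ->] ->]].
  move=> [_ /memv_imgP[_ /memv_imgP[v _ ->] ->] ->].
  exists (u, v); rewrite ?memvf // !actlE !hom_ofE rsum_actE.
  by congr pair; rewrite /= ?addr0 ?add0r.
apply/eqP; rewrite -subv0; apply/subvP => x.
move=> /memv_capP[/memv_imgP[u _ ->] /memv_imgP[v _]].
by rewrite !hom_ofE memv0 => -[-> _].
Qed.

Lemma riso_direct M (U V : {vspace M}) N (P : rmod S) (f : 'Hom(N, M)) (g : 'Hom(P, M)) :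
  (U + V = fullv)%VS -> (U :&: V = 0)%VS ->
  lker f == 0%VS -> limg f = U -> equivariant f ->
  lker g == 0%VS -> limg g = V -> equivariant g -> riso (rsum N P) M.
Proof.
move=> UV UcV kf lf ef kg lg eg.
have lh : linear (fun p : rsum N P => f p.1 + g p.2).
  by move=> c u v; rewrite /= !linearP scalerDr addrACA.
apply: (riso_lfun (f := hom_of lh)).
- rewrite -subv0; apply/subvP => -[u v]; rewrite memv_ker hom_ofE /= => /eqP E.
  have fu0 : f u = 0.
    apply/eqP; rewrite -memv0 -UcV memv_cap -{1}lf memv_img ?memvf //=.
    have -> : f u = - g v by apply/eqP; rewrite -addr_eq0 E.
    by rewrite memvN -lg memv_img ?memvf.
  have gv0 : g v = 0 by move: E; rewrite fu0 add0r.
  have -> : u = 0 by apply/eqP; rewrite -memv0 -(eqP kf) memv_ker fu0.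
  have -> : v = 0 by apply/eqP; rewrite -memv0 -(eqP kg) memv_ker gv0.
  by rewrite memv0.
- apply/eqP; rewrite eqEsubv subvf -UV -lf -lg; apply/subvP => w.
  move=> /memv_addP[_ /memv_imgP[u _ ->] [_ /memv_imgP[v _ ->] ->]].
  by apply/memv_imgP; exists (u, v); rewrite ?memvf // hom_ofE.
- by move=> [u v] s; rewrite !hom_ofE rsum_actE /= ef eg ractDl.
Qed.

Lemma riso_cyclic M N (v : M) (w : N) :
  (forall x : M, exists s, x = v *> s) -> (forall x : N, exists s, x = w *> s) ->
  (forall s, v *> s = 0 <-> w *> s = 0) -> riso M N.
Proof.
(* [(actr v)^-1] only picks some [s] with [v *> s = x]; equality of the annihilators makes [w *> s]
   independent of the choice. *)
move=> genv genw ann; pose f : 'Hom(M, N) := (actr w \o (actr v)^-1)%VF.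
have fE s : f (v *> s) = w *> s.
  rewrite comp_lfunE actrE; set s' := (actr v)^-1%VF _.
  have : v *> s' = v *> s.
    by rewrite -actrE limg_lfunVK // -actrE memv_img ?memvf.
  move/eqP; rewrite -subr_eq0 -ractBr => /eqP/ann/eqP.
  by rewrite ractBr subr_eq0 => /eqP.
apply: (riso_lfun (f := f)).
- rewrite -subv0; apply/subvP => x; rewrite memv_ker memv0.
  by have [s ->] := genv x; rewrite fE => /eqP/ann ->.
- apply/vspaceP => x; rewrite memvf; apply/memv_imgP.
  by have [s ->] := genw x; exists (v *> s); rewrite ?memvf ?fE.
- by move=> x t; have [s ->] := genv x; rewrite -ractM !fE ractM.
Qed.

Definition rreg : rmod S.
Proof.
exists S (fun v s => v * s).
- by move=> s c u v; rewrite mulrDl scalerAl.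
- by move=> v c s t; rewrite mulrDr scalerAr.
- exact: mulr1.
- exact: mulrA.
Defined.

End DirectSums.

(** * Modules over a uniserial algebra *)

Section Uniserial.
Variables (F : fieldType) (S : falgType F) (a : S) (e : nat).
Hypotheses (ca : central a) (ae : a ^+ e = 0) (ae1 : a ^+ e.-1 != 0).
Hypothesis Sloc : forall s, s \is a GRing.unit \/ exists t, s = a * t.

(** The dimension of the residue algebra [S / a S]. *)
Let q := (\dim {:S} - \dim (limg (amull a)))%N.

Lemma nilpotency_gt0 : (0 < e)%N.
Proof. by case: e ae => // /eqP; rewrite expr0 oner_eq0. Qed.

Lemma uniformizer_pow_neq0 k : (k < e)%N -> a ^+ k != 0.
Proof.
move=> ke; apply: contra_neq ae1 => ak.
have -> : e.-1 = (k + (e.-1 - k))%N by rewrite subnKC // -ltnS prednK ?nilpotency_gt0.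
by rewrite exprD ak mul0r.
Qed.

Lemma uniformizer_nonunit t : a * t \isn't a GRing.unit.
Proof.
apply/negP => u; have := unitrX e u; rewrite exprMn_comm; last exact: ca.
by rewrite ae mul0r unitr0.
Qed.

Lemma residue_dim_gt0 : (0 < q)%N.
Proof.
rewrite subn_gt0 ltn_neqAle dimv_le_full andbT.
apply/eqP => E; have /eqP L : limg (amull a) == fullv.
  by rewrite eqEdim subvf E /=.
have : 1 \in limg (amull a) by rewrite L memvf.
move=> /memv_imgP[t _]; rewrite lfunE /= => E1.
by have := uniformizer_nonunit t; rewrite -E1 unitr1.
Qed.

Let L k := limg (amull (a ^+ k)).

Lemma uniformizer_ideal k s : s \in L k <-> exists t, s = a ^+ k * t.
Proof.
split=> [/memv_imgP[t _ ->]|[t ->]]; first by exists t; rewrite lfunE.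
by apply/memv_imgP; exists t; rewrite ?memvf // lfunE.
Qed.

Lemma uniformizer_ideal_le j k : (j <= k)%N -> (L k <= L j)%VS.
Proof.
move=> jk; apply/subvP => s /uniformizer_ideal[t ->]; apply/uniformizer_ideal.
by exists (a ^+ (k - j) * t); rewrite mulrA -exprD subnKC.
Qed.

(** For [i < e] no unit is killed by [a ^+ i], so the kernel of multiplication by [a ^+ i] lies in
    [a S] and [a^i S / a^(i+1) S] has the same dimension as [S / a S]. The induction descends from
    [a ^+ e = 0]. *)
Lemma dim_uniformizer_ideal k : \dim (L k) = ((e - k) * q)%N.
Proof.
have Le j : (e <= j)%N -> \dim (L j) = 0%N.
  move=> ej; apply/eqP; rewrite dimv_eq0 -subv0; apply/subvP => s.
  move=> /uniformizer_ideal[t ->]; rewrite -(subnKC ej) exprD ae !mul0r.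
  by rewrite memv0.
case: (leqP e k) => [ek|/ltnW ke]; first by rewrite Le // (eqP ek).
rewrite -{1}(subKn ke); move: (leq_subr k e); elim: (e - k)%N => [_|j IH je].
  by rewrite subn0 Le.
set i := (e - j.+1)%N; have ie : (i < e)%N by rewrite /i ltn_subrL /= nilpotency_gt0.
have Ei : (e - j = i.+1)%N by rewrite /i subnSK.
have := IH (ltnW je); rewrite Ei mulSn => <-.
have k1 := limg_ker_dim (amull (a ^+ i)) fullv.
have k2 := limg_ker_dim (amull (a ^+ i)) (limg (amull a)).
have kera : (lker (amull (a ^+ i)%R) <= limg (amull a))%VS.
  apply/subvP => s; rewrite memv_ker lfunE /= => /eqP E.
  case: (Sloc s) => [us|[t ->]].
    have := uniformizer_pow_neq0 ie.
    by rewrite -[a ^+ i]mulr1 -(divrr us) mulrA E mul0r eqxx.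
  by apply/memv_imgP; exists t; rewrite ?memvf // lfunE.
move: k1 k2; rewrite capfv (capv_idPr kera) -limg_comp.
have -> : (amull (a ^+ i) \o amull a)%VF = amull (a ^+ i.+1).
  by apply/lfunP => s; rewrite comp_lfunE !lfunE /= mulrA -exprSr.
rewrite -/(L i) -/(L i.+1) /q => <- <-; rewrite subnDl subnK //.
exact/dimvS/uniformizer_ideal_le.
Qed.

Definition cyclic_of (c : nat) (N : rmod S) := exists g : N,
  (forall x : N, exists s, x = g *> s) /\
  (forall s, g *> s = 0 <-> exists t, s = a ^+ c * t).

Lemma cyclic_exists c : (c <= e)%N -> exists N, cyclic_of c N.
Proof.
move=> ce; pose g : rreg S := a ^+ (e - c).
have [N [f [kf lf ef]]] := rsub_exists (@stable_limg_actr F S (rreg S) g).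
have /memv_imgP[h _ hE] : (g : rreg S) \in limg f.
  by rewrite lf; apply/memv_imgP; exists 1; rewrite ?memvf // actrE ract1.
have /lker0P finj := kf.
exists N, h; split=> [x|s].
  have : f x \in limg f by rewrite memv_img ?memvf.
  rewrite lf => /memv_imgP[s _]; rewrite actrE hE -ef => /finj ->.
  by exists s.
have -> : (h *> s = 0) <-> a ^+ (e - c) * s = 0.
  split=> [E|E]; first by have := ef h s; rewrite E linear0 -hE.
  by apply: finj; rewrite ef -hE linear0.
split=> [|[t ->]]; last first.
  by rewrite mulrA -exprD subnK // ae mul0r.
(* While [j < c], a unit cofactor [t] would give [a ^+ (e - c + j) = 0], so a further factor [a]
   splits off. *)
move=> E; have : forall j, (j <= c)%N -> exists t, s = a ^+ j * t.
  elim=> [_|j IH jc]; first by exists s; rewrite mul1r.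
  have [t st] := IH (ltnW jc); case: (Sloc t) => [ut|[t' tE]].
    have : a ^+ (e - c + j) != 0.
      by apply: uniformizer_pow_neq0; rewrite -{2}(subnK ce) ltn_add2l.
    by rewrite exprD -[a ^+ j]mulr1 -(divrr ut) !mulrA -[_ * _ * t]mulrA -st E mul0r eqxx.
  by exists t'; rewrite st tE mulrA -exprSr.
exact.
Qed.

(* [cyc c] is [S / a^c S], realized as [a^(e-c) S]; it is 0 when [e < c]. *)
Definition cyc c : rmod S :=
  if pselect (exists N, cyclic_of c N) is left p then projT1 (cid p) else rzero S.

Lemma cycP c : (c <= e)%N -> cyclic_of c (cyc c).
Proof.
move=> ce; rewrite /cyc; case: pselect => [p|[]]; last exact: cyclic_exists.
exact: (projT2 (cid p)).
Qed.

(** The image of [a ^+ k] on [S / a^c S] is [a^k S / a^c S] for [k <= c]; truncated subtraction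
    covers the zero image for [k > c]. *)
Lemma cyc_act_dim c k : (c <= e)%N ->
  \dim (limg (actl (cyc c) (a ^+ k))) = ((c - k) * q)%N.
Proof.
move=> ce; have [g [gen ann]] := cycP ce.
have -> : limg (actl (cyc c) (a ^+ k)) = (actr g @: L k)%VS.
  have caX s : a ^+ k * s = s * a ^+ k.
    by apply/esym/commrX/esym; exact: ca.
  apply/vspaceP => x; apply/memv_imgP/memv_imgP => [[y _ ->]|[s]].
    have [s ->] := gen y; exists (a ^+ k * s); first by apply/uniformizer_ideal; exists s.
    by rewrite actlE actrE -ractM caX.
  move=> /uniformizer_ideal[t ->] ->; exists (g *> t); rewrite ?memvf //.
  by rewrite actlE actrE -ractM caX.
have kerE : lker (actr g) = L c.
  apply/vspaceP => s; rewrite memv_ker actrE.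
  apply/eqP/idP => [/ann/uniformizer_ideal //|/uniformizer_ideal/ann //].
have := limg_ker_dim (actr g) (L k); rewrite kerE dim_uniformizer_ideal.
case: (leqP k c) => kc.
  rewrite (capv_idPr (uniformizer_ideal_le kc)) dim_uniformizer_ideal.
  have -> : (e - k = (e - c) + (c - k))%N by rewrite addnBA // subnK.
  by rewrite mulnDl => /addnI.
rewrite (capv_idPl (uniformizer_ideal_le (ltnW kc))) dim_uniformizer_ideal.
rewrite -[RHS]addn0 => /addnI ->.
by have /eqP -> : (c - k == 0)%N by rewrite subn_eq0 ltnW.
Qed.

Definition csum (s : seq nat) : rmod S := foldr (fun c M => rsum (cyc c) M) (rzero S) s.

Lemma csum_act_dim s k : all (fun c => c <= e)%N s ->
  \dim (limg (actl (csum s) (a ^+ k))) = (sumn [seq (c - k)%N | c <- s] * q)%N.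
Proof.
elim: s => [_|c s IH /= /andP[ce se]]; last first.
  by rewrite rsum_act_dim cyc_act_dim // IH // mulnDl.
rewrite /= mul0n; apply/eqP; rewrite -leqn0.
by apply: leq_trans (dimv_le_full _) _; rewrite dim_rzero.
Qed.

Lemma limg_actl1 (M : rmod S) : limg (actl M 1) = fullv.
Proof.
suff -> : actl M 1 = \1%VF by rewrite lim1g.
by apply/lfunP => v; rewrite actlE ract1 id_lfunE.
Qed.

Lemma dim_csum s : all (fun c => c <= e)%N s -> \dim {:csum s} = (sumn s * q)%N.
Proof.
move=> se; rewrite -limg_actl1; have := csum_act_dim 0 se; rewrite expr0 => ->.
by congr (sumn _ * _)%N; rewrite -[RHS]map_id; apply: eq_map => c; rewrite subn0.
Qed.

(* An element [v] of maximal order [c] generates a direct summand: a submodule [U]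
   maximal for [U :&: v S = 0] is a complement of [v S]. *)
Lemma uniserial_decomposition (M : rmod S) k : (k <= e)%N ->
  (forall v : M, v *> a ^+ k = 0) ->
  exists s, [/\ sorted geq s, all (fun c => 0 < c <= k)%N s & riso M (csum s)].
Proof.
(* The bound [k] stays general: the complement of [v S] is treated with the bound [c], which keeps
   the parts in decreasing order. *)
move: {-1}(\dim {:M}) (leqnn (\dim {:M})) => n.
elim: n M k => [|n IH] M k dM ke ak.
  exists [::]; split=> //; apply: (riso_dim_lfun (f := 0)).
  - rewrite -subv0; apply/subvP => v _.
    by move: dM; rewrite leqn0 dimv_eq0 => /eqP <-; rewrite memvf.
  - by rewrite dim_rzero; apply/eqP; rewrite -leqn0.
  - by move=> v s; rewrite !zero_lfunE ract0l.
have [M0|M0] := eqVneq (\dim {:M}) 0%N; first by apply: IH => //; rewrite M0.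
have [|c ac cmin] := @ex_min_nat _ (fun c => forall v : M, v *> a ^+ c = 0) id.
  by exists k.
have ck : (c <= k)%N by exact: cmin.
have ce := leq_trans ck ke.
have c0 : (0 < c)%N.
  rewrite lt0n; apply: contra_neq M0 => c0; apply/eqP.
  rewrite dimv_eq0 -subv0; apply/subvP => v _.
  by rewrite memv0 -[v]ract1 -[1](expr0 a) -c0 ac.
have [v vc] : exists v : M, v *> a ^+ c.-1 != 0.
  apply: contrapT => h; have : (c <= c.-1)%N.
    apply: cmin => v; apply/eqP/negPn/negP => nv; apply: h; by exists v.
  by rewrite leqNgt ltn_predL c0.
have vlt j : (j < c)%N -> v *> a ^+ j != 0.
  move=> jc; apply: contra_neq vc => E.
  have -> : c.-1 = (j + (c.-1 - j))%N by rewrite subnKC // -ltnS prednK.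
  by rewrite exprD ractM E ract0l.
have annv s : v *> s = 0 <-> exists t, s = a ^+ c * t.
  split=> [E|[t ->]]; last by rewrite ractM ac ract0l.
  suff : forall j, (j <= c)%N -> exists t, s = a ^+ j * t by exact.
  elim=> [_|j IHj jc]; first by exists s; rewrite mul1r.
  have [t st] := IHj (ltnW jc); case: (Sloc t) => [ut|[t' tE]].
    have := vlt j jc; rewrite -(ract_unitK (v *> a ^+ j) ut) -(ractM v (a ^+ j) t) -st E.
    by rewrite ract0l eqxx.
  by exists t'; rewrite st tE mulrA -exprSr.
pose V := limg (actr v).
have sV : stable V by exact: stable_limg_actr.
have vV s : v *> s \in V by rewrite -actrE memv_img ?memvf.
have [||U [sU UV] Umax] := @ex_max_nat _
   (fun U : {vspace M} => stable U /\ (U :&: V = 0)%VS) (fun U => \dim U) (\dim {:M}).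
- exists 0%VS; split; last by rewrite cap0v.
  by move=> u s; rewrite !memv0 => /eqP ->; rewrite ract0l.
- by move=> U _; exact: dimv_le_full.
have UVfull : (U + V)%VS = fullv.
  (* Let [w1] be the last multiple [w a^(j-1)] outside [U + V], so [w1 a = u + v s]. Multiplying by
     [a^(c-1)] gives [v s a^(c-1) = 0], hence [s = a s']. Then [w2 = w1 - v s'] satisfies
     [w2 a = u], and [U + w2 S] still meets [V] trivially, against the maximality of [U]. *)
  apply/eqP/negPn/negP => nUV.
  have [w nw] : exists w : M, w \notin (U + V)%VS.
    have /subvPn[w _ nw] : ~~ (fullv <= U + V)%VS.
      by apply: contra nUV => h; rewrite eqEsubv subvf.
    by exists w.
  have [|j wj jmin] := @ex_min_nat _ (fun j => w *> a ^+ j \in (U + V)%VS) id.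
    by exists c; rewrite ac mem0v.
  have j0 : (0 < j)%N.
    by rewrite lt0n; apply/negP => /eqP j0; move: wj; rewrite j0 ract1 (negPf nw).
  pose w1 := w *> a ^+ j.-1.
  have nw1 : w1 \notin (U + V)%VS.
    by apply/negP => /jmin; rewrite leqNgt ltn_predL j0.
  have : w1 *> a \in (U + V)%VS by rewrite -ractM -exprSr prednK.
  move=> /memv_addP[u uU [_ /memv_imgP[s _ ->]]]; rewrite actrE => wE.
  have : v *> (s * a ^+ c.-1) = 0.
    apply/eqP; rewrite -memv0 -UV memv_cap vV andbT ractM.
    have -> : v *> s *> a ^+ c.-1 = - (u *> a ^+ c.-1).
      apply/eqP; rewrite -addr_eq0 addrC -ractDl -wE -ractM -exprS prednK //.
      by rewrite ac.
    by rewrite memvN sU.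
  case: (Sloc s) => [us|[s' sE] _].
    move=> E; have := vlt c.-1; rewrite ltn_predL c0 => /(_ isT).
    have -> : a ^+ c.-1 = s * a ^+ c.-1 * s^-1.
      have -> : s * a ^+ c.-1 = a ^+ c.-1 * s.
        by apply/commrX/esym; exact: ca.
      by rewrite mulrK.
    by rewrite ractM E ract0l eqxx.
  pose w2 := w1 - v *> s'.
  have w2a : w2 *> a = u.
    by rewrite ractBl wE sE ca ractM addrK.
  have nw2 : w2 \notin (U + V)%VS.
    apply: contra nw1 => h; rewrite -[w1](subrK (v *> s')) memvD //.
    by rewrite (subvP (addvSr U V)).
  pose U' := (U + limg (actr w2))%VS.
  have w2U' : w2 \in U'.
    apply: (subvP (addvSr U _)); apply/memv_imgP.
    by exists 1; rewrite ?memvf // actrE ract1.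
  have sU' : stable U' by apply: stable_add => //; exact: stable_limg_actr.
  have U'V : (U' :&: V = 0)%VS.
    apply/eqP; rewrite -subv0; apply/subvP => x /memv_capP[].
    move=> /memv_addP[u1 u1U [_ /memv_imgP[r _ ->] ->]]; rewrite actrE => xV.
    case: (Sloc r) => [ur|[r' rE]].
      case/negP: nw2; rewrite -(ract_unitK w2 ur) stable_add //.
      have -> : w2 *> r = - u1 + (u1 + w2 *> r) by rewrite addKr.
      by rewrite memv_add // memvN.
    rewrite -UV memv_cap xV andbT memvD //.
    by rewrite rE ractM w2a sU.
  have := Umax U' (conj sU' U'V).
  rewrite (geq_leqif (dimv_leqif_sup (addvSl U _))) => /subvP/(_ w2 w2U') h.
  by case/negP: nw2; apply: (subvP (addvSl U V)).
have [N0 [f [kf lf ef]]] := rsub_exists sV.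
have [N1 [g [kg lg eg]]] := rsub_exists sU.
have MN : riso (rsum N0 N1) M.
  by apply: (riso_direct (U := V) (V := U) (f := f) (g := g)) => //;
    rewrite ?[(V + U)%VS]addvC ?[(V :&: U)%VS]capvC.
have /lker0P finj := kf; have /lker0P ginj := kg.
have N0c : riso N0 (cyc c).
  have [h [genh annh]] := cycP ce.
  have /memv_imgP[v0 _ v0E] : v \in limg f by rewrite lf -[v]ract1.
  apply: (riso_cyclic (v := v0) (w := h)) => //.
    move=> x; have : f x \in limg f by rewrite memv_img ?memvf.
    rewrite lf => /memv_imgP[s _]; rewrite actrE v0E -ef => /finj ->.
    by exists s.
  move=> s; rewrite annh -annv v0E -ef.
  by split=> [->|E]; [rewrite linear0 | apply: finj; rewrite E linear0].
have V0 : (0 < \dim V)%N.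
  rewrite lt0n dimv_eq0; apply/negP => /eqP V0.
  by move: vc; have := vV (a ^+ c.-1); rewrite V0 memv0 => ->.
have dN1 : (\dim {:N1} <= n)%N.
  have := riso_dim MN; rewrite dim_rsum => d.
  have d0 : \dim {:N0} = \dim V by rewrite -lf limg_dim_eq // (eqP kf) capv0.
  by rewrite -ltnS (leq_trans _ dM) // -d d0 -{1}[\dim {:N1}]add0n ltn_add2r.
have aN1 (x : N1) : x *> a ^+ c = 0 by apply: ginj; rewrite eg ac linear0.
have [s [ss sc sM]] := IH N1 c dN1 ce aN1.
exists (c :: s); split.
- rewrite /= path_sortedE; last by move=> x y z /= xy yz; exact: leq_trans yz xy.
  rewrite ss andbT; apply/allP => x /(allP sc)/andP[_ xc]; exact: xc.
- rewrite /= c0 ck /=; apply/allP => x /(allP sc)/andP[-> xc].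
  exact: leq_trans ck.
- apply: riso_trans (riso_sym MN) _; exact: riso_rsum.
Qed.

(** Consecutive differences of these sums count the parts exceeding [k], and differences of those
    counts give the multiplicity of each positive part. *)
Lemma sorted_parts_eq s s' : sorted geq s -> sorted geq s' ->
  all (fun c => 0 < c)%N s -> all (fun c => 0 < c)%N s' ->
  (forall k, sumn [seq (c - k)%N | c <- s] = sumn [seq (c - k)%N | c <- s']) -> s = s'.
Proof.
move=> ss ss' s0 s0' E.
have gtr : transitive geq by move=> x y z /= xy yz; exact: leq_trans yz xy.
have ganti : antisymmetric geq by move=> x y /= /anti_leq.
apply: (sorted_eq gtr ganti) => //.
have cgt k r : (sumn [seq (c - k)%N | c <- r] =
    sumn [seq (c - k.+1)%N | c <- r] + count (fun c => k < c)%N r)%N.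
  elim: r => //= c r ->; rewrite addnACA; congr (_ + _)%N.
  by case: ltnP => kc; [rewrite addn1 subnSK | rewrite addn0; apply/eqP;
    rewrite subnS (eqP kc)].
have Egt k : count (fun c => k < c)%N s = count (fun c => k < c)%N s'.
  by have := cgt k s; rewrite E cgt E => /addnI.
have cmem k r : (count (fun c => k < c)%N r =
    count_mem k.+1 r + count (fun c => k.+1 < c)%N r)%N.
  elim: r => //= c r ->; rewrite addnACA; congr (_ + _)%N.
  by rewrite [(k < c)%N]leq_eqVlt eq_sym; case: eqP => [->|_]; rewrite ?ltnn.
apply/allP => -[|k] _ /=.
  have mem0 r : all (fun c => 0 < c)%N r -> count_mem 0%N r = 0%N.
    move=> /allP r0; apply/count_memPn; apply/negP => /r0; by [].
  by rewrite !mem0.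
by have := cmem k s; rewrite Egt cmem Egt => /addIn ->.
Qed.

Lemma csum_inj s s' : sorted geq s -> sorted geq s' ->
  all (fun c => 0 < c <= e)%N s -> all (fun c => 0 < c <= e)%N s' ->
  riso (csum s) (csum s') -> s = s'.
Proof.
move=> ss ss' hs hs' iso.
have [p1 p2] : all (fun c => 0 < c)%N s /\ all (fun c => c <= e)%N s.
  by split; apply/allP => x /(allP hs)/andP[].
have [p1' p2'] : all (fun c => 0 < c)%N s' /\ all (fun c => c <= e)%N s'.
  by split; apply/allP => x /(allP hs')/andP[].
apply: sorted_parts_eq => // k; apply/eqP; rewrite -(eqn_pmul2r residue_dim_gt0).
by rewrite -!csum_act_dim // (riso_act_dim _ iso).
Qed.

End Uniserial.

(** * Isomorphism classes of given length *)

Lemma ord_inj_leq k k' (f : 'I_k -> 'I_k') : injective f -> (k <= k')%N.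
Proof. by move=> fi; rewrite -[k]card_ord -[k']card_ord; exact: leq_card fi. Qed.

Lemma Mod_has_card_le (F : fieldType) (S : falgType F) x k k' :
  Mod_has_card S x k -> Mod_has_card S x k' -> (k <= k')%N.
Proof.
move=> [W [Wl Winj _]] [W' [_ _ Wsur]].
have /boolp.choice[f fP] a : exists b, module_iso (W a) (W' b) by apply: Wsur.
apply: (@ord_inj_leq _ _ f) => a b E; apply: Winj.
by apply: module_iso_trans (fP a) _; rewrite E; apply: module_iso_sym.
Qed.

Lemma Mod_cardE (F : fieldType) (S : falgType F) x k :
  Mod_has_card S x k -> Mod_card S x = k.
Proof.
move=> hk; rewrite /Mod_card; case: xgetP => [k' -> hk'|/(_ k)] //.
by apply/eqP; rewrite eqn_leq !(Mod_has_card_le hk hk', Mod_has_card_le hk' hk).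
Qed.

Section CountModules.
Variables (F : fieldType) (S D : falgType F) (pi : {lrmorphism S -> D}).
Hypotheses (divD : division_algebra D) (ssq : is_ss_quotient pi).

Let piM x y : pi (x * y) = pi x * pi y. Proof. exact: rmorphM. Qed.
Let piD x y : pi (x + y) = pi x + pi y. Proof. exact: rmorphD. Qed.
Let piB x y : pi (x - y) = pi x - pi y. Proof. exact: rmorphB. Qed.
Let piZ c x : pi (c *: x) = c *: pi x. Proof. exact: linearZ. Qed.
Let pi1 : pi 1 = 1. Proof. exact: rmorph1. Qed.
Let delta := \dim {:D}.

Lemma falg_dim_gt0 (C : falgType F) : (0 < \dim {:C})%N.
Proof.
rewrite lt0n dimv_eq0 -subv0; apply/negP => /subvP/(_ 1 (memvf _)).
by rewrite memv0 oner_eq0.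
Qed.

Lemma rmod_length_dim (M : rmod S) x :
  has_length (rlmod M) x <-> \dim {:M} = (x * delta)%N.
Proof.
split=> [/(has_length_rmod divD ssq)[N dN]|dM].
  by move=> /module_iso_riso/riso_dim ->.
have [y hy] := rmod_has_length divD ssq M; rewrite dM => /eqP.
by rewrite eqn_pmul2r ?falg_dim_gt0 // => /eqP ->.
Qed.

Definition rmod_reps x k (W : 'I_k -> rmod S) :=
  [/\ forall a, \dim {:W a} = (x * delta)%N,
      forall a b, riso (W a) (W b) -> a = b &
      forall M : rmod S, \dim {:M} = (x * delta)%N -> exists a, riso M (W a)].

Lemma Mod_has_cardP x k : Mod_has_card S x k <-> exists W : 'I_k -> rmod S, rmod_reps x W.
Proof.
split=> [[W [Wl Winj Wsur]]|[W [Wl Winj Wsur]]].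
  have /boolp.choice[M MP] a : exists M : rmod S,
      \dim {:M} = (x * delta)%N /\ module_iso (W a) (rlmod M).
    by have [M dM iM] := has_length_rmod divD ssq (Wl a); exists M.
  exists M; split=> [a|a b /module_iso_riso iab|N dN]; first by case: (MP a).
    apply: Winj; apply: module_iso_trans (MP a).2 _.
    by apply: module_iso_trans iab _; apply: module_iso_sym (MP b).2.
  have [a ia] := Wsur (rlmod N) ((rmod_length_dim N x).2 dN).
  exists a; apply/module_iso_riso; exact: module_iso_trans ia (MP a).2.
exists (fun a => rlmod (W a)); split=> [a|a b /module_iso_riso|V lV].
- exact/rmod_length_dim.
- exact: Winj.
- have [N dN iN] := has_length_rmod divD ssq lV; have [a ia] := Wsur N dN.
  by exists a; apply: module_iso_trans iN _; apply/module_iso_riso.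
Qed.

Definition rres : rmod S.
Proof.
exists D (fun v s => v * pi s).
- by move=> s c u v; rewrite mulrDl scalerAl.
- by move=> v c s t; rewrite piD piZ mulrDr scalerAr.
- by move=> v; rewrite pi1 mulr1.
- by move=> v s t; rewrite piM mulrA.
Defined.

Lemma riso_dim0 (M N : rmod S) : \dim {:M} = 0%N -> \dim {:N} = 0%N -> riso M N.
Proof.
move=> dM dN; apply: (riso_dim_lfun (f := 0)); last 1 first.
- by move=> v s; rewrite !zero_lfunE ract0l.
- rewrite -subv0; apply/subvP => v _.
  by move/eqP: dM; rewrite dimv_eq0 => /eqP <-; rewrite memvf.
- by rewrite dM dN.
Qed.

(** Such modules have length 1, so each is generated by a vector whose annihilator is the kernel of
    [pi]. *)
Lemma riso_simple (M N : rmod S) : \dim {:M} = delta -> \dim {:N} = delta -> riso M N.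
Proof.
have gen (P : rmod S) : \dim {:P} = delta -> exists v : P,
    (forall x : P, exists s, x = v *> s) /\ (forall s, v *> s = 0 <-> pi s = 0).
  move=> dP; have : has_length (rlmod P) 1 by apply/rmod_length_dim; rewrite mul1n.
  move=> [L [sL L0 L1 simp]].
  have [[LL /nonsubset[v [Lv nLv]]] smp] := simp 0%N isT.
  have [ann g] := simple_step divD ssq (sL 0%N isT) (sL 1%N isT) LL Lv nLv smp.
  exists v; split=> [x|s].
    have [|s] := g x; first by rewrite L1.
    rewrite L0 /= => E; exists s; apply/eqP; rewrite -subr_eq0; exact/eqP.
  by rewrite -ann L0.
move=> /gen[v [genv annv]] /gen[w [genw annw]].
by apply: (riso_cyclic genv genw) => s; rewrite annv annw.
Qed.

Lemma Mod_has_card_le1 x : (x <= 1)%N -> Mod_has_card S x 1.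
Proof.
move=> x1; apply/Mod_has_cardP; case: x x1 => [|[|//]] _.
  exists (fun _ => rzero S); split=> [_|a b _|M dM].
  - by rewrite dim_rzero.
  - by rewrite !ord1.
  - by exists ord0; apply: riso_dim0; rewrite ?dM ?dim_rzero.
exists (fun _ => rres); split=> [_|a b _|M dM].
- by rewrite mul1n.
- by rewrite !ord1.
- by exists ord0; apply: riso_simple; rewrite ?dM ?mul1n.
Qed.

Lemma dim_ker_pi : (\dim (lker (linfun pi)) + delta)%N = \dim {:S}.
Proof.
rewrite -(limg_ker_dim (linfun pi) fullv) capfv; congr (_ + \dim _)%N.
apply/esym/vspaceP => y; rewrite memvf; apply/memv_imgP.
by have [x <-] := ssq.1 y; exists x; rewrite ?memvf ?lfunE.
Qed.

Variables (R m : {vspace S}) (e : nat).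
Hypotheses (RE : R = 'Z({:S})%VS) (maxm : maximal_ideal_of R m).
Hypothesis nilm : is_nilpotency_index m e.
Hypothesis frameS : central_frame (@central S).

Lemma finite_partitions x n : finite_set (partitions x n).
Proof.
pose f (b : {bseq x of 'I_n.+1}) : seq nat := [seq val i | i <- b].
apply: (@sub_finite_set _ _ (range f)); last by apply: finite_image; exact: finite_finset.
move=> s [_ sn sx].
have size_s : (size [seq inord i : 'I_n.+1 | i <- s] <= x)%N.
  rewrite size_map -sx; elim: s sn {sx} => //= c s IH /andP[/andP[c0 _] sn].
  by rewrite -add1n leq_add ?IH.
exists (Bseq size_s) => //; rewrite /f /= -map_comp -[RHS]map_id.
by apply/eq_in_map => c cs /=; rewrite inordK // ltnS; case/andP: (allP sn c cs).
Qed.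

(** This includes [d = 0], where [m = 0], [e = 1] and the only partition is into ones. *)
Lemma Mod_has_card_uniserial d x : has_cotangent_dim R m d -> (d <= 1)%N ->
  Mod_has_card S x (npartitions x e).
Proof.
move=> hd d1; apply/Mod_has_cardP.
have [a [ca ae ae1 rad]] := uniformizer pi divD RE maxm nilm frameS hd d1.
have Sloc s : s \is a GRing.unit \/ exists t, s = a * t.
  have [/rad ps|ps] := eqVneq (pi s) 0; [by right | left].
  exact: unit_pi ps.
have pa : pi a = 0 := nilpotent_pi pi divD ae.
have qE : (\dim {:S} - \dim (limg (amull a)))%N = delta.
  rewrite -dim_ker_pi; suff -> : limg (amull a) = lker (linfun pi) by rewrite addKn.
  apply/vspaceP => s; rewrite memv_ker lfunE /=.
  apply/memv_imgP/eqP => [[t _ ->]|/rad[t ->]]; first by rewrite lfunE /= piM pa mul0r.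
  by exists t; rewrite ?memvf ?lfunE.
have dim_sum s : all (fun c => 0 < c <= e)%N s -> \dim {:csum a s} = (sumn s * delta)%N.
  move=> hs; rewrite (dim_csum ca ae ae1 Sloc) ?qE //.
  by apply/allP => c /(allP hs)/andP[].
pose X := fset_set (partitions x e).
have XP s : s \in X <-> partitions x e s.
  by rewrite in_fset_set; [split; rewrite inE | exact: finite_partitions].
pose part (i : 'I_(npartitions x e)) := nth [::] X i.
have partP i : partitions x e (part i) by apply/XP; apply: mem_nth.
exists (fun i => csum a (part i)); split=> [i|i j|M dM].
- by have [_ hi <-] := partP i; rewrite dim_sum.
- have [si hi _] := partP i; have [sj hj _] := partP j.
  move=> /(csum_inj ca ae ae1 Sloc si sj hi hj)/eqP.
  by rewrite nth_uniq ?fset_uniq // => /eqP/val_inj.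
- have [|s [ss hs iM]] := uniserial_decomposition ca ae ae1 Sloc (leqnn e) (M := M).
    by move=> v; rewrite ae ract0r.
  have sX : s \in X.
    apply/XP; split=> //; apply/eqP; rewrite -(eqn_pmul2r (falg_dim_gt0 D)).
    by rewrite -dim_sum // -(riso_dim iM) dM.
  have iX : (index s X < npartitions x e)%N by rewrite /npartitions /ncard index_mem.
  by exists (Ordinal iX); rewrite /part /= nth_index.
Qed.

(** The members are [S / Q lam] padded with [x - 2] residue modules. The central element
    [v0 - lam *: v1] kills the member at [lam]; if it also killed the one at [mu != lam], then [v1]
    would lie in [Q mu]. *)
Lemma infinite_rmod_family d x : has_cotangent_dim R m d -> (2 <= d)%N -> (2 <= x)%N ->
  exists W : F -> rmod S, (forall lam, \dim {:W lam} = (x * delta)%N) /\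
    forall lam mu, riso (W lam) (W mu) -> lam = mu.
Proof.
move=> hd d2 x2.
have [v0 [v1 [c0 [c1 H]]]] := plane_ideals divD ssq RE maxm nilm frameS hd d2.
have /boolp.choice[Q QP] := H.
(* The parameters 0 and 1 put [v0] and [v0 - v1] in the radical. *)
have pv1 : pi v1 = 0.
  have [[_ q0 _ _ _] qpi] := QP 0; have [[_ q1 _ _ _] qpi'] := QP 1.
  have := qpi _ q0; have := qpi' _ q1; rewrite scale0r subr0 scale1r piB.
  by move=> /eqP E p0; move: E; rewrite p0 sub0r oppr_eq0 => /eqP.
have sQ lam : stable (M := rreg S) (Q lam).
  by move=> u s; have [[h _ _ _ _] _] := QP lam; exact: h.
have /boolp.choice[W0 W0P] lam : exists W0 : rmod S, \dim {:W0} = (2 * delta)%N /\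
    exists f : 'Hom(rreg S, W0), [/\ lker f = Q lam, limg f = fullv & equivariant f].
  have [N [f [kf lf ef]]] := rquo_exists (sQ lam); exists N; split; last by exists f.
  have [[_ _ q3 q4 q5] qpi] := QP lam.
  pose K : {vspace rreg S} := lker (linfun pi).
  have KP s : (s \in K) = (pi s == 0) by rewrite memv_ker lfunE.
  have QK : (Q lam <= K)%VS by apply/subvP => s /qpi/eqP; rewrite KP.
  have dQ := limg_ker_dim f fullv; rewrite capfv kf lf in dQ.
  have dK := limg_ker_dim f K; rewrite kf (capv_idPr QK) in dK.
  (* Multiplication by [v1] identifies [S / K] with [K / Q lam], so the quotient has two residue
     layers. *)
  have dim_fK : \dim (f @: K) = delta.
    pose h : 'Hom(S, N) := (f \o amull v1)%VF.
    have hE s : h s = f (v1 * s) by rewrite comp_lfunE lfunE.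
    have kh : lker h = K.
      apply/vspaceP => s; rewrite memv_ker hE -memv_ker kf KP.
      by apply/idP/eqP => [/q4|/q5].
    have lh : limg h = (f @: K)%VS.
      apply/vspaceP => w; apply/memv_imgP/memv_imgP => [[s _ ->]|[s sK ->]].
        by exists (v1 * s); rewrite ?hE // KP piM pv1 mul0r.
      have [t sQt] := q3 s (eqP (etrans (esym (KP s)) sK)).
      exists t; rewrite ?memvf // hE; apply/eqP; rewrite -subr_eq0 -linearB.
      by rewrite -memv_ker kf.
    have := limg_ker_dim h fullv; rewrite capfv kh lh -dim_ker_pi.
    by move/addnI.
  have := dim_ker_pi; rewrite -/K -dQ -dK dim_fK mul2n -addnn => /eqP.
  by rewrite -addnA eqn_add2l => /eqP.
pose rest := iter (x - 2) (rsum rres) (rzero S).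
have drest : \dim {:rest} = ((x - 2) * delta)%N.
  rewrite /rest; elim: (x - 2)%N => [|k IH]; first by rewrite dim_rzero.
  by rewrite iterS dim_rsum IH mulSn.
have act0 (M : rmod S) s : (forall v : M, v *> s = 0) <-> \dim (limg (actl M s)) = 0%N.
  split=> [h|/eqP]; first apply/eqP; rewrite dimv_eq0.
    rewrite -subv0; apply/subvP => _ /memv_imgP[v _ ->]; by rewrite actlE h mem0v.
  by move=> /eqP h v; apply/eqP; rewrite -memv0 -h -actlE memv_img ?memvf.
have rest0 s : pi s = 0 -> \dim (limg (actl rest s)) = 0%N.
  move=> ps; rewrite /rest; elim: (x - 2)%N => [|k IH]; first exact/act0.
  rewrite iterS rsum_act_dim IH addn0; apply/act0 => v.
  by rewrite /= ps mulr0.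
exists (fun lam => rsum (W0 lam) rest); split=> [lam|lam mu iso].
  have [d0 _] := W0P lam.
  by rewrite dim_rsum d0 drest -mulnDl subnKC.
pose z := v0 - lam *: v1.
have cz : central z.
  by move=> y; rewrite /z mulrBl mulrBr c0 -scalerAl -scalerAr c1.
have [[q1 q2 _ _ _] qpi] := QP lam.
have z0 : \dim (limg (actl (rsum (W0 lam) rest) z)) = 0%N.
  rewrite rsum_act_dim rest0 ?addn0; last exact: qpi.
  apply/act0 => w; have [_ [f [kf lf ef]]] := W0P lam.
  have /memv_imgP[s _ ->] : w \in limg f by rewrite lf memvf.
  by rewrite -ef; apply/eqP; rewrite -memv_ker kf /= -cz q1.
have zmu : forall w : W0 mu, w *> z = 0.
  apply/act0/eqP; rewrite -leqn0 -z0 (riso_act_dim z iso) rsum_act_dim.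
  exact: leq_addr.
have [_ [f [kf lf ef]]] := W0P mu.
have zQ : z \in Q mu.
  have := zmu (f 1); rewrite -ef => /eqP.
  by rewrite -memv_ker kf /= mul1r.
have [[r1 r2 _ r4 _] _] := QP mu.
apply/eqP/negPn/negP => nlm; have := oner_eq0 D; rewrite -pi1 => /eqP; apply.
apply: r4; rewrite mulr1.
have : (mu - lam) *: v1 \in Q mu.
  have -> : (mu - lam) *: v1 = z - (v0 - mu *: v1).
    by rewrite /z opprB [RHS]addrC addrA subrK scalerBl.
  by rewrite memvB.
move=> h; have := memvZ (mu - lam)^-1 h; rewrite scalerA mulVf ?scale1r //.
by rewrite subr_eq0 eq_sym.
Qed.

End CountModules.

(** * Morita equivalence *)

Lemma dim_orthogonal (F : fieldType) (V : vectType F) (J : finType) (p : J -> 'End(V)) :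
  (forall v, \sum_j p j v = v) -> (forall j k v, j != k -> p j (p k v) = 0) ->
  \dim {:V} = (\sum_j \dim (limg (p j)))%N.
Proof.
move=> p1 p0; have pid j v : p j (p j v) = p j v.
  rewrite -{2}(p1 (p j v)) (bigD1 j) //= big1 ?addr0 // => k kj.
  exact: p0.
have fullE : {:V}%VS = (\sum_j limg (p j))%VS.
  apply/vspaceP => v; rewrite memvf -[v in RHS]p1; apply/esym/memv_sumr => j _.
  by rewrite memv_img ?memvf.
rewrite [in LHS]fullE; suff /directvP : directv (\sum_j limg (p j))%VS by [].
apply/directv_sum_independent => us usU us0 j _.
have usE k : p k (us k) = us k.
  by have /memv_imgP[w _ ->] := usU k isT; rewrite pid.
have usE' k : k != j -> p j (us k) = 0.
  by move=> kj; have /memv_imgP[w _ ->] := usU k isT; rewrite p0 // eq_sym.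
have := congr1 (p j) us0; rewrite linear0 linear_sum (bigD1 j) //=.
by rewrite big1 ?addr0 // ?usE // => k; exact: usE'.
Qed.

Section Morita.
Variables (F : fieldType) (T : falgType F) (t : nat) (m : 'I_t -> nat).
Variables (D : 'I_t -> falgType F) (Phi : forall i, T -> 'M[D i]_(m i)).
Hypothesis isoPhi : is_mx_prod_iso Phi.
Hypothesis m_gt0 : forall i, (0 < m i)%N.

Let o i : 'I_(m i) := Ordinal (m_gt0 i).

Let mx i (k l : 'I_(m i)) (d : D i) : 'M[D i]_(m i) :=
  \matrix_(a, b) (d *+ ((a == k) && (b == l))).

Definition unit_at i (k l : 'I_(m i)) (d : D i) : T := mx_inj Phi (mx k l d).

Local Notation u := unit_at.
Local Notation "''e_' i" := (@unit_at i (o i) (o i) 1) (at level 8, i at level 2).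

Lemma Phi_unit_at i k l d : Phi i (@u i k l d) = mx k l d.
Proof. exact: mx_injE. Qed.

Lemma Phi_unit_at_out i j k l d : i != j -> Phi j (@u i k l d) = 0.
Proof. exact: mx_inj_out. Qed.

Lemma Phi_inj_at i x y : (forall j, i != j -> Phi j x = 0) ->
  (forall j, i != j -> Phi j y = 0) -> Phi i x = Phi i y -> x = y.
Proof.
move=> x0 y0 E; apply: (Phi_inj isoPhi) => j.
by have [<- //|ij] := eqVneq i j; rewrite x0 ?y0.
Qed.

Lemma unit_at_linear i k l : linear (@u i k l).
Proof.
move=> c d d'; apply: (@Phi_inj_at i) => [j ij|j ij|].
- exact: Phi_unit_at_out.
- rewrite (PhiD isoPhi) (PhiZ isoPhi) !Phi_unit_at_out // addr0.
  by apply/matrixP => a b; rewrite !mxE scaler0.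
- rewrite (PhiD isoPhi) (PhiZ isoPhi) !Phi_unit_at.
  by apply/matrixP => a b; rewrite !mxE mulrnDl scalerMnr.
Qed.

Lemma mul_unit_at i k l l' (d d' : D i) : u k l d * u l l' d' = u k l' (d * d').
Proof.
apply: (@Phi_inj_at i) => [j ij|j ij|].
- by rewrite (PhiM isoPhi) Phi_unit_at_out // mul0mx.
- exact: Phi_unit_at_out.
- rewrite (PhiM isoPhi) !Phi_unit_at; apply/matrixP => a b; rewrite !mxE.
  rewrite (bigD1 l) //= big1 => [|c cl].
    by rewrite !mxE !eqxx andbT addr0 /=; case: (a == k); case: (b == l');
      rewrite ?mulr0n ?mulr1n ?mul0r ?mulr0.
  by rewrite !mxE (negPf cl) andbF mulr0n mul0r.
Qed.

Lemma mul_unit_at0 i k l k' l' (d d' : D i) : l != k' -> u k l d * u k' l' d' = 0.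
Proof.
move=> lk; apply: (Phi_inj isoPhi) => j; rewrite (PhiM isoPhi) (Phi0 isoPhi).
have [<-|ij] := eqVneq i j; last by rewrite Phi_unit_at_out // mul0mx.
rewrite !Phi_unit_at; apply/matrixP => a b; rewrite !mxE big1 // => c _; rewrite !mxE.
have [->|ck] := eqVneq c k'; last by rewrite mulr0n mulr0.
by rewrite [k' == l]eq_sym (negPf lk) andbF mulr0n mul0r.
Qed.

Lemma mul_unit_at_out i j k l k' l' (d : D i) (d' : D j) : i != j ->
  @u i k l d * @u j k' l' d' = 0.
Proof.
move=> ij; apply: (Phi_inj isoPhi) => j'; rewrite (PhiM isoPhi) (Phi0 isoPhi).
have [<-|ij'] := eqVneq i j'; last by rewrite Phi_unit_at_out // mul0mx.
by rewrite [Phi i (u k' l' d')]Phi_unit_at_out ?mulmx0 // eq_sym.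
Qed.

Lemma unit_at_mull i x k : x * u k (o i) 1 = \sum_l u l (o i) (Phi i x l k).
Proof.
apply: (@Phi_inj_at i) => [j ij|j ij|].
- by rewrite (PhiM isoPhi) Phi_unit_at_out // mulmx0.
- by rewrite (Phi_sum isoPhi) big1 // => l _; rewrite Phi_unit_at_out.
- rewrite (PhiM isoPhi) (Phi_sum isoPhi) Phi_unit_at; apply/matrixP => a b.
  rewrite summxE !mxE (bigD1 k) //= big1 => [|c ck].
    rewrite (bigD1 a) //= big1 => [|c ca].
      rewrite Phi_unit_at !mxE !eqxx /= !addr0.
      by case: (b == o i); rewrite ?mulr1n ?mulr0n ?mulr1 ?mulr0.
    by rewrite Phi_unit_at !mxE eq_sym (negPf ca).
  by rewrite !mxE (negPf ck) mulr0n mulr0.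
Qed.

Lemma unit_at_mulr i x k : u (o i) k 1 * x = \sum_l u (o i) l (Phi i x k l).
Proof.
apply: (@Phi_inj_at i) => [j ij|j ij|].
- by rewrite (PhiM isoPhi) Phi_unit_at_out // mul0mx.
- by rewrite (Phi_sum isoPhi) big1 // => l _; rewrite Phi_unit_at_out.
- rewrite (PhiM isoPhi) (Phi_sum isoPhi) Phi_unit_at; apply/matrixP => a b.
  rewrite summxE !mxE (bigD1 k) //= big1 => [|c ck].
    rewrite (bigD1 b) //= big1 => [|c cb].
      rewrite Phi_unit_at !mxE !eqxx !andbT /= !addr0; case: (a == o i);
        by rewrite ?mulr1n ?mulr0n ?mul1r ?mul0r.
    by rewrite Phi_unit_at !mxE [b == c]eq_sym (negPf cb) andbF.
  by rewrite !mxE (negPf ck) andbF mulr0n mul0r.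
Qed.

Lemma unit_at_sum1 : \sum_i \sum_k @u i k k 1 = 1.
Proof.
apply: (Phi_inj isoPhi) => j; rewrite (Phi_sum isoPhi) (Phi1 isoPhi).
rewrite (bigD1 j) //= [X in _ + X]big1 => [|i ij]; last first.
  by rewrite (Phi_sum isoPhi) big1 // => k _; rewrite Phi_unit_at_out.
rewrite addr0 (Phi_sum isoPhi); apply/matrixP => a b; rewrite summxE !mxE.
rewrite (bigD1 a) //= big1 => [|k ka]; rewrite Phi_unit_at !mxE.
  by rewrite eqxx addr0 eq_sym.
by rewrite eq_sym (negPf ka).
Qed.

Lemma ract_unit_at_decomp (M : rmod T) (v : M) :
  v = \sum_i \sum_k v *> @u i k (o i) 1 *> u (o i) k 1.
Proof.
rewrite -{1}[v]ract1 -unit_at_sum1 ract_sumr; apply: eq_bigr => i _.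
by rewrite ract_sumr; apply: eq_bigr => k _; rewrite -ractM mul_unit_at mulr1.
Qed.

(** The Morita functor [M |-> M e_i] as a relation, so that any isomorphic copy of [M e_i] may serve
    as [W]. *)
Definition corner i (M : rmod T) (W : rmod (D i)) := exists phi : 'Hom(W, M),
  [/\ lker phi == 0%VS, limg phi = limg (actl M 'e_i) &
      forall w d, phi (w *> d) = phi w *> u (o i) (o i) d].

Lemma limg_corner i (M : rmod T) (v : M) :
  (v \in limg (actl M 'e_i)) = (v *> 'e_i == v).
Proof.
apply/memv_imgP/eqP => [[w _ ->]|E]; last by exists v; rewrite ?memvf // actlE E.
by rewrite actlE -ractM mul_unit_at mulr1.
Qed.

Lemma corner_exists i (M : rmod T) : exists W, @corner i M W.
Proof.
apply: (@rsub_along F T (D i) (u (o i) (o i)) M (limg (actl M 'e_i))).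
- exact: unit_at_linear.
- by move=> x y; rewrite mul_unit_at.
- by move=> v d _; rewrite limg_corner -ractM mul_unit_at mulr1.
- by move=> v; rewrite limg_corner => /eqP.
Qed.

Lemma corner_dim i M W : @corner i M W -> \dim {:W} = \dim (limg (actl M 'e_i)).
Proof.
by move=> [phi [kphi lphi _]]; rewrite -lphi limg_dim_eq // (eqP kphi) capv0.
Qed.

(** Off-diagonal matrix units carry the images of the diagonal idempotents of one block
    isomorphically onto each other. *)
Lemma dim_unit_at i (M : rmod T) k :
  \dim (limg (actl M (@u i k k 1))) = \dim (limg (actl M 'e_i)).
Proof.
pose f := actl M (u k (o i) 1).
have fV : limg (actl M 'e_i) = (f @: limg (actl M (u k k 1%R)))%VS.
  apply/vspaceP => v; rewrite limg_corner; apply/eqP/memv_imgP => [E|[w]].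
    exists (v *> u (o i) k 1).
      apply/memv_imgP; exists (v *> u (o i) k 1); rewrite ?memvf //.
      by rewrite actlE -ractM mul_unit_at mulr1.
    by rewrite actlE -ractM mul_unit_at mulr1 E.
  by move=> _ ->; rewrite actlE -ractM mul_unit_at mulr1.
rewrite fV [RHS]limg_dim_eq //; apply/eqP; rewrite -subv0; apply/subvP => v.
move=> /memv_capP[/memv_imgP[w _ ->]]; rewrite memv_ker !actlE -ractM => /eqP E.
rewrite memv0; have -> : w *> u k k 1 = w *> (u k k 1 * u k (o i) 1) *> u (o i) k 1.
  by rewrite -ractM !mul_unit_at !mulr1.
by rewrite E ract0l.
Qed.

Lemma corner_total_dim (M : rmod T) (W : forall i, rmod (D i)) :
  (forall i, corner M (W i)) -> \dim {:M} = (\sum_i m i * \dim {:W i})%N.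
Proof.
move=> cW.
rewrite (@dim_orthogonal F M {i : 'I_t & 'I_(m i)}
  (fun p => actl M (u (tagged p) (tagged p) 1))).
- rewrite -(@sig_big_dep _ _ _ _ _ xpredT (fun _ => xpredT)
    (fun i k => \dim (limg (actl M (@u i k k 1))))) /=.
  apply: eq_bigr => i _; rewrite (corner_dim (cW i)).
  rewrite (eq_bigr (fun _ => \dim (limg (actl M 'e_i)))) => [|k _].
    by rewrite sum_nat_const card_ord.
  exact: dim_unit_at.
- move=> v; rewrite -(@sig_big_dep _ _ _ _ _ xpredT (fun _ => xpredT)
    (fun i k => actl M (@u i k k 1) v)) /=.
  rewrite -[RHS]ract1 -unit_at_sum1 ract_sumr; apply: eq_bigr => i _.
  by rewrite ract_sumr; apply: eq_bigr => k _; rewrite actlE.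
- move=> [i k] [j l] v /= ne; rewrite !actlE -ractM.
  have [ji|ji] := eqVneq j i; last by rewrite mul_unit_at_out // ract0r.
  move: l ne; rewrite ji => l ne; rewrite mul_unit_at0 ?ract0r //.
  by apply: contra ne => /eqP ->.
Qed.

Lemma corner_riso (M N : rmod T) (W W' : forall i, rmod (D i)) :
  (forall i, corner M (W i)) -> (forall i, corner N (W' i)) ->
  riso M N <-> forall i, riso (W i) (W' i).
Proof.
move=> cW cW'; split=> [iso i|iso].
  have dW : \dim {:W i} = \dim {:W' i}.
    by rewrite (corner_dim (cW i)) (corner_dim (cW' i)) (riso_act_dim _ iso).
  have [f [g [fK gK ef]]] := iso.
  have [phi [kphi lphi ephi]] := cW i; have [psi [kpsi lpsi epsi]] := cW' i.
  pose h := (psi^-1 \o f \o phi)%VF.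
  have hE w : psi (h w) = f (phi w).
    rewrite !comp_lfunE limg_lfunVK // lpsi limg_corner -ef.
    have : phi w \in limg phi by rewrite memv_img ?memvf.
    by rewrite lphi limg_corner => /eqP ->.
  have /lker0P psi_inj := kpsi; have /lker0P phi_inj := kphi.
  apply: (riso_dim_lfun (f := h)) => //.
    by apply/lker0P => x y /(congr1 psi); rewrite !hE => /(can_inj fK)/phi_inj.
  by move=> w d; apply: psi_inj; rewrite hE ephi ef -hE -epsi.
(* [h i] extends the isomorphism of corners to a linear map on all of [M]; only its values on
   [M e_i] are controlled. *)
have /boolp.choice[h hP] i : exists h : 'Hom(M, N),
    [/\ forall x d, x *> 'e_i = x ->
          h (x *> u (o i) (o i) d) = h x *> u (o i) (o i) d,
        forall x, h x *> 'e_i = h x &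
        forall x, x *> 'e_i = x -> h x = 0 -> x = 0].
  have [f [g [fK gK ef]]] := iso i.
  have [phi [kphi lphi ephi]] := cW i; have [psi [kpsi lpsi epsi]] := cW' i.
  have /lker0P psi_inj := kpsi.
  have phiV x : x *> 'e_i = x -> phi (phi^-1%VF x) = x.
    by move=> E; rewrite limg_lfunVK // lphi limg_corner E.
  exists (psi \o f \o phi^-1)%VF; split=> [x d E|x|x E].
  - rewrite !comp_lfunE -epsi -ef; congr (psi (f _)).
    have /lker0P phi_inj := kphi; apply: phi_inj.
    by rewrite ephi !phiV // -ractM mul_unit_at mulr1.
  - apply/eqP; rewrite -limg_corner -lpsi !comp_lfunE memv_img ?memvf //.
  - rewrite !comp_lfunE => E0; rewrite -(phiV x E).
    have -> : phi^-1%VF x = 0 by apply: (can_inj fK); apply: psi_inj; rewrite E0 !linear0.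
    by rewrite linear0.
(* Each diagonal component of [v] is moved into the corner by [u k (o i) 1], mapped by [h i], and
   moved back by [u (o i) k 1]. *)
pose Psi : 'Hom(M, N) := \sum_i \sum_k
  (actl N (u (o i) k 1) \o h i \o actl M (u k (o i) 1))%VF.
have PsiE v : Psi v = \sum_i \sum_k h i (v *> u k (o i) 1) *> u (o i) k 1.
  rewrite sum_lfunE; apply: eq_bigr => i _; rewrite sum_lfunE; apply: eq_bigr => k _.
  by rewrite !comp_lfunE !actlE.
have corner_v i k (v : M) : v *> @u i k (o i) 1 *> 'e_i = v *> u k (o i) 1.
  by rewrite -ractM mul_unit_at mulr1.
have Psi_u v i k : Psi v *> @u i k (o i) 1 = h i (v *> u k (o i) 1).
  have [_ he _] := hP i.
  rewrite PsiE ract_suml (bigD1 i) //= [X in _ + X]big1 ?addr0 => [|j ji].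
    rewrite ract_suml (bigD1 k) //= [X in _ + X]big1 ?addr0 => [|l lk].
      by rewrite -ractM mul_unit_at mulr1 he.
    by rewrite -ractM mul_unit_at0 ?ract0r.
  rewrite ract_suml big1 // => l _.
  by rewrite -ractM mul_unit_at_out ?ract0r.
apply: (riso_dim_lfun (f := Psi)).
- rewrite -subv0; apply/subvP => v; rewrite memv_ker memv0 => /eqP P0.
  rewrite (ract_unit_at_decomp v) big1 // => i _; rewrite big1 // => k _.
  have [_ _ h0] := hP i; rewrite (h0 (v *> u k (o i) 1)) ?ract0l //.
  by rewrite -Psi_u P0 ract0l.
- rewrite (corner_total_dim cW) (corner_total_dim cW').
  by apply: eq_bigr => i _; rewrite (riso_dim (iso i)).
- move=> v x; rewrite !PsiE ract_suml; apply: eq_bigr => i _.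
  have [hd he _] := hP i.
  pose y l k := h i (v *> u l (o i) 1) *> u (o i) k (Phi i x l k).
  transitivity (\sum_k \sum_l y l k).
    apply: eq_bigr => k _; rewrite -ractM unit_at_mull ract_sumr linear_sum ract_suml.
    apply: eq_bigr => l _; rewrite /y.
    have -> : u l (o i) (Phi i x l k) = u l (o i) 1 * u (o i) (o i) (Phi i x l k).
      by rewrite mul_unit_at mul1r.
    by rewrite ractM /= hd ?corner_v // -ractM mul_unit_at mulr1.
  rewrite exchange_big ract_suml; apply: eq_bigr => l _.
  by rewrite -ractM unit_at_mulr ract_sumr.
Qed.

(** Row vectors over [W], with [T] acting through its block [i] alone. *)
Lemma corner_realize1 i (W : rmod (D i)) : exists M : rmod T,
  corner M W /\ forall j (x : M), i != j -> x *> 'e_j = 0.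
Proof.
pose V : vectType F := {ffun 'I_(m i) -> W}.
pose act (v : V) (x : T) : V := [ffun l => \sum_k v k *> Phi i x k l].
have ll x : linear (act^~ x).
  move=> c v w; apply/ffunP => l; rewrite !ffunE scaler_sumr -big_split /=.
  by apply: eq_bigr => k _; rewrite !ffunE ractDl ractZl.
have lr v : linear (act v).
  move=> c x y; apply/ffunP => l; rewrite !ffunE scaler_sumr -big_split /=.
  apply: eq_bigr => k _.
  by rewrite (PhiD isoPhi) (PhiZ isoPhi) !mxE ractDr ractZr.
have a1 v : act v 1 = v.
  apply/ffunP => l; rewrite ffunE (Phi1 isoPhi) (bigD1 l) //= big1 => [|k kl].
    by rewrite mxE eqxx addr0 ract1.
  by rewrite mxE (negPf kl) ract0r.
have aM v x y : act v (x * y) = act (act v x) y.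
  apply/ffunP => l; rewrite !ffunE (PhiM isoPhi).
  under eq_bigr => k _ do rewrite mxE ract_sumr.
  rewrite exchange_big; apply: eq_bigr => k _; rewrite ffunE ract_suml.
  by apply: eq_bigr => k' _; rewrite ractM.
exists (RMod ll lr a1 aM); split; last first.
  move=> j x ij; apply/ffunP => l; rewrite !ffunE big1 // => k _.
  by rewrite Phi_unit_at_out 1?eq_sym // mxE ract0r.
pose f (w : W) : V := [ffun k => if k == o i then w else 0].
have lf : linear f.
  by move=> c v w; apply/ffunP => k; rewrite !ffunE; case: eqP; rewrite ?scaler0 ?addr0.
have actE v d : act v (u (o i) (o i) d) = f (v (o i) *> d).
  apply/ffunP => l; rewrite !ffunE (bigD1 (o i)) //= big1 => [|k ko].
    rewrite Phi_unit_at mxE eqxx addr0 /=; case: (l == o i) => //=.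
    by rewrite mulr0n ract0r.
  by rewrite Phi_unit_at mxE (negPf ko) mulr0n ract0r.
exists (hom_of lf : 'Hom(W, RMod ll lr a1 aM)); split.
- apply/lker0P => v w; rewrite !hom_ofE => /ffunP/(_ (o i)).
  by rewrite !ffunE eqxx.
- apply/vspaceP => v; apply/memv_imgP/memv_imgP => [[w _ ->]|[w _ ->]].
    exists (f w); rewrite ?memvf // (hom_ofE lf) actlE; rewrite [RHS]actE.
    by rewrite ffunE eqxx ract1.
  exists ((w : V) (o i)); rewrite ?memvf // (hom_ofE lf) actlE; rewrite [LHS]actE.
  by rewrite ract1.
- by move=> w d; rewrite !hom_ofE; rewrite [RHS]actE ffunE eqxx.
Qed.

Lemma corner_realize (W : forall i, rmod (D i)) :
  exists M : rmod T, forall i, corner M (W i).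
Proof.
(* Corners at indices not yet treated must vanish, so that adding a summand for [j] leaves the other
   corners unchanged. *)
suff [M MP] : exists M : rmod T, forall i,
    (i \in enum 'I_t -> corner M (W i)) /\
    (i \notin enum 'I_t -> forall x : M, x *> 'e_i = 0).
  by exists M => i; apply: (MP i).1; rewrite mem_enum.
elim: (enum 'I_t) (enum_uniq 'I_t) => [_|j s IH /= /andP[js us]].
  by exists (rzero T).
have [M MP] := IH us; have [N [cN N0]] := corner_realize1 (W j).
exists (rsum N M) => i; rewrite in_cons; split.
  have [->|ij] := eqVneq i j.
    move=> _; have [phi [kphi lphi ephi]] := cN.
    have lf : linear (fun w => (phi w, 0) : rsum N M).
      by move=> c x y; congr pair; rewrite ?linearP //= scaler0 addr0.
    have M0 := (MP j).2 js.
    exists (hom_of lf); split.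
    + by apply/lker0P => x y; rewrite !hom_ofE => -[]; have /lker0P := kphi; apply.
    + apply/vspaceP => -[x y]; apply/memv_imgP/idP => [[w _]|].
        rewrite hom_ofE => -[-> ->]; rewrite limg_corner rsum_actE ract0l.
        by rewrite xpair_eqE eqxx andbT -limg_corner -lphi memv_img ?memvf.
      rewrite limg_corner rsum_actE M0 xpair_eqE -limg_corner -lphi.
      by move=> /andP[/memv_imgP[w _ ->] /eqP <-]; exists w; rewrite ?memvf ?hom_ofE.
    + by move=> w d; rewrite !hom_ofE rsum_actE ephi ract0l.
  move=> /= si; have [phi [kphi lphi ephi]] := (MP i).1 si.
  have lf : linear (fun w => (0, phi w) : rsum N M).
    by move=> c x y; congr pair; rewrite ?linearP //= scaler0 addr0.
  have N0' (x : N) : x *> 'e_i = 0 by apply: N0; rewrite eq_sym.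
  exists (hom_of lf); split.
  + by apply/lker0P => x y; rewrite !hom_ofE => -[]; have /lker0P := kphi; apply.
  + apply/vspaceP => -[x y]; apply/memv_imgP/idP => [[w _]|].
      rewrite hom_ofE => -[-> ->]; rewrite limg_corner rsum_actE ract0l.
      by rewrite xpair_eqE eqxx -limg_corner -lphi memv_img ?memvf.
    rewrite limg_corner rsum_actE N0' xpair_eqE -limg_corner -lphi.
    by move=> /andP[/eqP <- /memv_imgP[w _ ->]]; exists w; rewrite ?memvf ?hom_ofE.
  + by move=> w d; rewrite !hom_ofE rsum_actE ephi ract0l.
rewrite negb_or => /andP[ij si] [x y]; rewrite rsum_actE (MP i).2 //.
by rewrite N0 1?eq_sym.
Qed.

End Morita.

(** * Homomorphisms and modules *)

Section DivisionAlgebra.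
Variables (F : fieldType) (S : falgType F).
Hypothesis divS : division_algebra S.

(** The uniserial case with [a = 0] and [e = 1]: every part of the partition is 1. *)
Lemma division_rmod (M : rmod S) : exists k, riso M (csum (0 : S) (nseq k 1)) /\
  \dim {:M} = (k * \dim {:S})%N.
Proof.
have c0 : central (0 : S) by move=> y; rewrite mul0r mulr0.
have e0 : (0 : S) ^+ 1 = 0 by rewrite expr1.
have e1 : (0 : S) ^+ 1.-1 != 0 by rewrite expr0 oner_neq0.
have Sloc (s : S) : s \is a GRing.unit \/ exists t, s = 0 * t.
  have [->|/divS us] := eqVneq s 0; [right | by left].
  by exists 0; rewrite mul0r.
have [|s [_ hs iM]] := uniserial_decomposition c0 e0 e1 Sloc (leqnn 1) (M := M).
  by move=> v; rewrite e0 ract0r.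
have sE : s = nseq (size s) 1%N.
  apply/all_pred1P; apply: sub_all hs => x; rewrite -eqn_leq eq_sym; exact.
exists (size s); rewrite -sE; split=> //.
rewrite (riso_dim iM) (dim_csum c0 e0 e1 Sloc); last first.
  by apply: sub_all hs => x /andP[].
have -> : limg (amull (0 : S)) = 0%VS.
  apply/eqP; rewrite -subv0; apply/subvP => x /memv_imgP[y _ ->].
  by rewrite lfunE /= mul0r mem0v.
by rewrite dimv0 subn0 sE sumn_nseq size_nseq mul1n.
Qed.

Lemma division_riso (M N : rmod S) : \dim {:M} = \dim {:N} -> riso M N.
Proof.
have [k [ik dk]] := division_rmod M; have [l [il dl]] := division_rmod N.
rewrite dk dl => /eqP; rewrite eqn_pmul2r ?falg_dim_gt0 // => /eqP kl.
by apply: riso_trans ik _; rewrite kl; apply: riso_sym.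
Qed.

Lemma division_dim_dvd (M : rmod S) : (\dim {:S} %| \dim {:M})%N.
Proof. by have [k [_ ->]] := division_rmod M; rewrite dvdn_mull. Qed.

End DivisionAlgebra.

(** * Matrices over [Delta] acting on columns *)

Section MatrixAction.
Variables (F : fieldType) (Delta : falgType F) (n : nat).

Definition colv : vectType F := {ffun 'I_n -> Delta}.
Implicit Types (X Y : 'M[Delta]_n) (v : colv).

Definition mv X v : colv := [ffun k => \sum_l X k l * v l].
Definition rv v (b : Delta) : colv := [ffun k => v k * b].
Definition basisv l : colv := [ffun k => (k == l)%:R].

Lemma mvM X Y v : mv (X *m Y) v = mv X (mv Y v).
Proof.
apply/ffunP => k; rewrite !ffunE; under eq_bigr => l _ do rewrite mxE mulr_suml.
rewrite exchange_big; apply: eq_bigr => l _; rewrite ffunE mulr_sumr.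
by apply: eq_bigr => j _; rewrite mulrA.
Qed.

Lemma mv1 v : mv 1%:M v = v.
Proof.
apply/ffunP => k; rewrite ffunE (bigD1 k) //= big1 => [|l lk].
  by rewrite mxE eqxx mul1r addr0.
by rewrite mxE eq_sym (negPf lk) mul0r.
Qed.

Lemma mvB X Y v : mv (X - Y) v = mv X v - mv Y v.
Proof.
apply/ffunP => k; rewrite !ffunE -sumrB; apply: eq_bigr => l _.
by rewrite !mxE mulrBl.
Qed.

Lemma mvZ c X v : mv (map_mx ( *:%R c) X) v = c *: mv X v.
Proof.
apply/ffunP => k; rewrite !ffunE scaler_sumr; apply: eq_bigr => l _.
by rewrite !mxE scalerAl.
Qed.

Lemma mv_linear X : linear (mv X).
Proof.
move=> c v w; apply/ffunP => k; rewrite !ffunE scaler_sumr -big_split /=.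
by apply: eq_bigr => l _; rewrite !ffunE mulrDr scalerAr.
Qed.

Lemma rv_linear b : linear (rv^~ b).
Proof. by move=> c v w; apply/ffunP => k; rewrite !ffunE mulrDl scalerAl. Qed.

Lemma mv_rv X v b : mv X (rv v b) = rv (mv X v) b.
Proof.
apply/ffunP => k; rewrite !ffunE mulr_suml; apply: eq_bigr => l _.
by rewrite ffunE mulrA.
Qed.

Lemma mv_basisv X k l : mv X (basisv l) k = X k l.
Proof.
rewrite ffunE (bigD1 l) //= big1 => [|j jl]; first by rewrite ffunE eqxx mulr1 addr0.
by rewrite ffunE (negPf jl) mulr0.
Qed.

Lemma mv_inj X Y : (forall v, mv X v = mv Y v) -> X = Y.
Proof. by move=> E; apply/matrixP => k l; rewrite -!mv_basisv E. Qed.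

Lemma basisv_decomp v : v = \sum_l rv (basisv l) (v l).
Proof.
apply/ffunP => k; rewrite sum_ffunE (bigD1 k) //= big1 => [|l lk].
  by rewrite !ffunE eqxx mul1r addr0.
by rewrite !ffunE eq_sym (negPf lk) mul0r.
Qed.

Lemma mv_of_linear (g : 'End(colv)) : (forall v b, g (rv v b) = rv (g v) b) ->
  forall v, g v = mv (\matrix_(k, l) g (basisv l) k) v.
Proof.
move=> gr v; rewrite {1}[v]basisv_decomp linear_sum; apply/ffunP => k.
rewrite sum_ffunE ffunE; apply: eq_bigr => l _.
by rewrite /= gr ffunE mxE.
Qed.

Definition rstd : rmod Delta.
Proof.
exists colv rv.
- exact: rv_linear.
- by move=> v c s t; apply/ffunP => k; rewrite !ffunE mulrDr scalerAr.
- by move=> v; apply/ffunP => k; rewrite !ffunE mulr1.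
- by move=> v s t; apply/ffunP => k; rewrite !ffunE mulrA.
Defined.

Lemma dim_colv : \dim {:colv} = (n * \dim {:Delta})%N.
Proof. by rewrite !dimvf -[in RHS](card_ord n). Qed.

End MatrixAction.

(** * Homomorphisms into matrix algebras as modules over the tensor product *)

Section Models.
Variables (F : fieldType) (A Delta T : falgType F) (n : nat).
Variables (i : {lrmorphism Delta -> T}) (j : {lrmorphism A^c -> T}).
Hypothesis tensT : is_tensor_product i j.
Local Notation V := (colv Delta n).
Implicit Types (f g : A -> 'M[Delta]_n) (M N : rmod T).

(** [M] is a copy of [Delta^n] on which [Delta] acts from the right and [a] acts as the matrix
    [f a], a left action of [A] being a right action of its opposite. *)
Definition models f M := exists beta : 'Hom(V, M),
  [/\ lker beta == 0%VS, limg beta = fullv,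
      forall v b, beta (rv v b) = beta v *> i b &
      forall v (a : A), beta (mv (f a) v) = beta v *> j a].

Lemma tensor_equivariant M N (h : 'Hom(M, N)) :
  (forall v b, h (v *> i b) = h v *> i b) ->
  (forall v c, h (v *> j c) = h v *> j c) -> equivariant h.
Proof.
move=> hi hj v x; move: x v.
apply: (tensor_lin_ind tensT) => [v|c x y Ex Ey v|b c v].
- by rewrite !ract0r linear0.
- by rewrite !ractDr !ractZr linearP /= Ex Ey.
- by rewrite !ractM hj hi.
Qed.

Lemma models_dim f M : models f M -> \dim {:M} = (n * \dim {:Delta})%N.
Proof.
by move=> [beta [kb lb _ _]]; rewrite -dim_colv -lb limg_dim_eq // (eqP kb) capv0.
Qed.

Lemma models_exists f : is_mx_alg_hom f -> exists M, models f M.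
Proof.
move=> [fB [f1 fM] fZ].
have f0 : f 0 = 0 by rewrite -(subrr 0) fB subrr.
have fD x y : f (x + y) = f x + f y.
  by rewrite -[y in LHS]opprK fB -(sub0r y) fB f0 sub0r opprK.
have lop b c : linear (fun v : V => mv (f c) (rv v b)).
  by move=> k v w; rewrite rv_linear mv_linear.
pose op b (c : A^c) : 'End(V) := hom_of (lop b c).
have opE b c v : op b c v = mv (f c) (rv v b) by rewrite hom_ofE.
have [||h hE] := @tensor_universal _ _ _ _ _ _ tensT 'End(V) op.
- move=> c k b b'; apply/lfunP => v; rewrite add_lfunE scale_lfunE !opE.
  rewrite -mv_linear; congr mv; apply/ffunP => l.
  by rewrite !ffunE mulrDr scalerAr.
- move=> b k c c'; apply/lfunP => v; rewrite add_lfunE scale_lfunE !opE.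
  rewrite fD fZ -mvZ; apply/ffunP => l; rewrite !ffunE -big_split /=.
  by apply: eq_bigr => p _; rewrite !mxE mulrDl.
have ll x : linear (fun v => h x v) by move=> c u v; rewrite linearP.
have lr v : linear (fun x => h x v).
  by move=> c x y; rewrite linearP add_lfunE scale_lfunE.
have a1 v : h 1 v = v.
  have -> : (1 : T) = i 1 * j 1 by rewrite !rmorph1 mulr1.
  rewrite hE opE; have -> : f (1 : A^c) = 1%:M by exact: f1.
  by rewrite mv1; apply/ffunP => l; rewrite ffunE mulr1.
have aM v x y : h (x * y) v = h y (h x v).
  move: x v; apply: (tensor_lin_ind tensT) => [v|k x x' Ex Ex' v|b c v].
  - by rewrite mul0r !(linear0 h) zero_lfunE linear0.
  - by rewrite mulrDl -scalerAl !linearP !add_lfunE !scale_lfunE Ex Ex' linearP.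
  move: y; apply: (tensor_lin_ind tensT) => [|k y y' Ey Ey'|b' c'].
  - by rewrite mulr0 !(linear0 h) !zero_lfunE.
  - by rewrite mulrDr -scalerAr !linearP !add_lfunE !scale_lfunE Ey Ey'.
  rewrite (tensor_mul tensT) !hE !opE.
  have -> : f (c * c' : A^c) = f c' *m f c by exact: fM.
  rewrite mvM -mv_rv; congr (mv _ (mv _ _)).
  by apply/ffunP => l; rewrite !ffunE mulrA.
exists (RMod ll lr a1 aM), \1%VF; split.
- by apply/lker0P => u v; rewrite !id_lfunE.
- by rewrite lim1g.
- move=> v b; rewrite !id_lfunE; apply/ffunP => l.
  have -> : i b = i b * j 1 by rewrite rmorph1 mulr1.
  rewrite /= hE opE; have -> : f (1 : A^c) = 1%:M by exact: f1.
  by rewrite mv1.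
- move=> v c; rewrite !id_lfunE.
  have -> : j c = i 1 * j c by rewrite rmorph1 mul1r.
  rewrite /= hE opE; congr mv; apply/ffunP => l.
  by rewrite !ffunE mulr1.
Qed.

Hypothesis divDelta : division_algebra Delta.

Lemma restrict_exists M : exists (N : rmod Delta) (g : 'Hom(N, M)),
  [/\ lker g == 0%VS, limg g = fullv & forall v b, g (v *> b) = g v *> i b].
Proof.
apply: (@rsub_along F T Delta i M fullv).
- by move=> c x y; exact: linearP.
- by move=> x y; exact: rmorphM.
- by move=> u s _; exact: memvf.
- by move=> u _; rewrite rmorph1 ract1.
Qed.

Lemma dim_Delta_dvd M : (\dim {:Delta} %| \dim {:M})%N.
Proof.
have [N [g [kg lg _]]] := restrict_exists M.
by rewrite -lg limg_dim_eq ?(eqP kg) ?capv0 //; exact: division_dim_dvd.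
Qed.

(** By dimension [M] is isomorphic to [Delta^n] over [Delta]; the action of [A] commutes with that
    of [Delta], so it is given by matrices. *)
Lemma models_of_dim M : \dim {:M} = (n * \dim {:Delta})%N ->
  exists f, is_mx_alg_hom f /\ models f M.
Proof.
move=> dM; have [N [g [kg lg eg]]] := restrict_exists M.
have dN : \dim {:N} = (n * \dim {:Delta})%N.
  by rewrite -dM -lg limg_dim_eq // (eqP kg) capv0.
have [|p [p' [pK pK' ep]]] := @division_riso _ _ divDelta (rstd Delta n) N.
  by rewrite dN -dim_colv.
have [beta betaE] : exists beta : 'Hom(V, M), forall v, beta v = g (p v).
  by exists (g \o p)%VF => v; rewrite comp_lfunE.
have /lker0P g_inj := kg.
have kb : lker beta == 0%VS.
  by apply/lker0P => x y; rewrite !betaE => /g_inj/(can_inj pK).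
have lb : limg beta = fullv by apply: limg_ker0_full => //; rewrite dM dim_colv.
have betaK x : beta (beta^-1%VF x) = x by rewrite limg_lfunVK // lb memvf.
have /lker0P beta_inj := kb.
have betar v b : beta (rv v b) = beta v *> i b.
  by rewrite !betaE -eg -(ep v b).
pose gam (a : A^c) : 'End(V) := (beta^-1 \o actl M (j a) \o beta)%VF.
have gamE a v : beta (gam a v) = beta v *> j a by rewrite !comp_lfunE betaK actlE.
have gam_rv a v b : gam a (rv v b) = rv (gam a v) b.
  by apply: beta_inj; rewrite gamE !betar gamE -!ractM (tensT.1 b a).
pose f (a : A) : 'M[Delta]_n := \matrix_(k, l) gam a (basisv Delta l) k.
have fE a v : mv (f a) v = gam a v by rewrite -(mv_of_linear (gam_rv a)).
exists f; split; last first.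
  by exists beta; split=> // v a; rewrite fE gamE.
split.
- move=> a b; apply: mv_inj => v; rewrite mvB !fE; apply: beta_inj.
  rewrite linearB /= !gamE -ractBr; congr (_ *> _); exact: (rmorphB j a b).
- split=> [|a b]; apply: mv_inj => v.
    rewrite mv1 fE; apply: beta_inj; rewrite gamE.
    have -> : j (1 : A) = 1 by exact: (rmorph1 j).
    by rewrite ract1.
  rewrite [f a * f b](_ : _ = f a *m f b) // mvM !fE; apply: beta_inj; rewrite !gamE -ractM.
  congr (_ *> _); exact: (rmorphM j b a).
- move=> c a; apply: mv_inj => v; rewrite mvZ !fE; apply: beta_inj.
  rewrite linearZ /= !gamE -ractZr; congr (_ *> _); exact: (linearZ_LR j c a).
Qed.

Lemma conj_orbit_refl f : conj_orbit f f.
Proof.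
exists 1%:M, 1%:M; split; rewrite ?mulmx1 // => a.
by rewrite mul1mx mulmx1.
Qed.

Lemma conj_orbit_eq f g : conj_orbit f g -> conj_orbit f = conj_orbit g.
Proof.
move=> [b [b' [bb' b'b gE]]]; apply/seteqP; split=> h [c [c' [cc' c'c hE]]].
  exists (c *m b'), (b *m c'); split.
  - by rewrite mulmxA -[c *m b' *m b]mulmxA b'b mulmx1.
  - by rewrite mulmxA -[b *m c' *m c]mulmxA c'c mulmx1.
  - move=> a; rewrite hE gE !mulmxA -[c *m b' *m b]mulmxA b'b mulmx1.
    by rewrite -[_ *m b' *m b]mulmxA b'b mulmx1.
exists (c *m b), (b' *m c'); split.
- by rewrite mulmxA -[c *m b *m b']mulmxA bb' mulmx1.
- by rewrite mulmxA -[b' *m c' *m c]mulmxA c'c mulmx1.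
- by move=> a; rewrite hE gE !mulmxA.
Qed.

(** A [Delta]-linear isomorphism is multiplication by an invertible matrix, and compatibility with
    [A] says that this matrix conjugates [f] into [g]. *)
Lemma models_riso f g M N : models f M -> models g N ->
  riso M N <-> conj_orbit f = conj_orbit g.
Proof.
move=> mM mN; have dM := models_dim mM; have dN := models_dim mN.
move: mM mN => [beta [kb lb bi bj]] [gamma [kg lg gi gj]].
have /lker0P beta_inj := kb; have /lker0P gamma_inj := kg.
have betaK x : beta (beta^-1%VF x) = x by rewrite limg_lfunVK // lb memvf.
have gammaK x : gamma (gamma^-1%VF x) = x by rewrite limg_lfunVK // lg memvf.
have betaVK x : beta^-1%VF (beta x) = x by apply: lker0_lfunK.
have gammaVK x : gamma^-1%VF (gamma x) = x by apply: lker0_lfunK.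
split=> [[h [h' [hK h'K eh]]]|E].
  have eh' : equivariant h' by move=> v s; apply: (can_inj hK); rewrite eh !h'K.
  pose q : 'End(V) := (gamma^-1 \o h \o beta)%VF.
  pose q' : 'End(V) := (beta^-1 \o h' \o gamma)%VF.
  have qE v : gamma (q v) = h (beta v) by rewrite !comp_lfunE gammaK.
  have q'E v : beta (q' v) = h' (gamma v) by rewrite !comp_lfunE betaK.
  have qr v b : q (rv v b) = rv (q v) b.
    by apply: gamma_inj; rewrite qE bi eh gi qE.
  have qr' v b : q' (rv v b) = rv (q' v) b.
    by apply: beta_inj; rewrite q'E gi eh' bi q'E.
  have mq := mv_of_linear qr; have mq' := mv_of_linear qr'.
  set b := (\matrix_(k, l) _) in mq; set b' := (\matrix_(k, l) _) in mq'.
  apply: conj_orbit_eq; exists b, b'; split.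
  - apply: mv_inj => v; rewrite mvM -mq' -mq mv1; apply: gamma_inj.
    by rewrite qE q'E h'K.
  - apply: mv_inj => v; rewrite mvM -mq -mq' mv1; apply: beta_inj.
    by rewrite q'E qE hK.
  - move=> a; apply: mv_inj => v; rewrite !mvM -mq' -mq; apply: gamma_inj.
    by rewrite qE bj q'E eh h'K gj.
have [b [b' [bb' b'b gE]]] : conj_orbit f g by rewrite E; exact: conj_orbit_refl.
pose h : 'Hom(M, N) := (gamma \o hom_of (mv_linear b) \o beta^-1)%VF.
have hE v : h (beta v) = gamma (mv b v) by rewrite !comp_lfunE betaVK hom_ofE.
have surj x : exists v, x = beta v by exists (beta^-1%VF x); rewrite betaK.
apply: (riso_dim_lfun (f := h)); last 1 first.
- apply: tensor_equivariant => x c; have [v ->] := surj x.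
    by rewrite -bi !hE mv_rv gi.
  rewrite -bj !hE -(gj _ (c : A)); congr (gamma _).
  by rewrite -!mvM gE -!mulmxA b'b mulmx1.
- apply/lker0P => x y; have [v ->] := surj x; have [w ->] := surj y.
  rewrite !hE => /gamma_inj /(congr1 (mv b')).
  by rewrite -!mvM b'b !mv1 => ->.
- by rewrite dM dN.
Qed.

End Models.

(** Elements of [m] are central and nilpotent, hence zero; a nonempty cotangent basis of zeros would
    force 1 into [m]. *)
Lemma reduced_cotangent_dim (F : fieldType) (S D : falgType F) (pi : {lrmorphism S -> D})
    (R m : {vspace S}) e d : division_algebra D ->
  R = 'Z({:S})%VS -> maximal_ideal_of R m -> is_nilpotency_index m e ->
  reduced_center S -> has_cotangent_dim R m d -> d = 0%N.
Proof.
move=> divD RE maxm nilm redS; case: d => // d [v [vm _ vfree]].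
have v0 k : v k = 0.
  apply: (redS _ e); first exact: (maximal_ideal_central RE maxm (vm k)).
  by apply/eqP; rewrite -memv0; case: nilm => _ <- _; exact: memv_expv.
have /negP[] := maximal_ideal_neq1 pi divD nilm; apply: (vfree (fun=> 1)) ord0 => [k|].
  exact: center1.
by rewrite big1 ?mem0v // => k _; rewrite v0 mulr0.
Qed.

(** * Counting orbits by tuples of modules *)

Section Assembly.
Variables (F : fieldType) (A Delta : falgType F) (n : nat).
Variables (T : falgType F) (iDelta : {lrmorphism Delta -> T}) (iA : {lrmorphism A^c -> T}).
Variables (t : nat) (m : 'I_t -> nat) (D' D : 'I_t -> falgType F).
Variables (Phi : forall i, T -> 'M[D' i]_(m i)) (pi : forall i, {lrmorphism D' i -> D i}).
Hypothesis divDelta : division_algebra Delta.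
Hypothesis tensT : is_tensor_product iDelta iA.
Hypothesis m_gt0 : forall i, (0 < m i)%N.
Hypothesis isoPhi : is_mx_prod_iso Phi.
Hypotheses (divD : forall i, division_algebra (D i)) (ssq : forall i, is_ss_quotient (pi i)).

Let P := multiplicity_vectors Delta n m D.
Let Orb := orbit_set A Delta n.
Let ell i := (m i * \dim {:D i} %/ \dim {:Delta})%N.

Definition rmod_power i x : rmod (D' i) := iter x (rsum (rres (pi i))) (rzero (D' i)).

Lemma dim_rmod_power i x : \dim {:rmod_power i x} = (x * \dim {:D i})%N.
Proof.
by elim: x => [|x IH]; [rewrite dim_rzero | rewrite /rmod_power iterS dim_rsum IH mulSn].
Qed.

(** The [T]-module whose only nonzero corner is the residue module at [i] has dimension
    [m i * \dim (D i)], and it is also a [Delta]-module, so the division is exact. *)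
Lemma ellE i : (ell i * \dim {:Delta})%N = (m i * \dim {:D i})%N.
Proof.
rewrite divnK //.
have [M cM] := corner_realize isoPhi m_gt0 (fun j => rmod_power j (j == i)).
have := dim_Delta_dvd iDelta divDelta M; rewrite (corner_total_dim isoPhi cM).
rewrite (bigD1 i) //= big1 => [|j ji]; last by rewrite (negPf ji) dim_rzero muln0.
by rewrite addn0 dim_rmod_power eqxx mul1n.
Qed.

Lemma ell_gt0 i : (0 < ell i)%N.
Proof.
have : (0 < ell i * \dim {:Delta})%N by rewrite ellE muln_gt0 m_gt0 falg_dim_gt0.
by rewrite muln_gt0 => /andP[].
Qed.

Lemma multiplicity_dim (x : {ffun 'I_t -> nat}) :
  P x <-> (\sum_i m i * (x i * \dim {:D i}) = n * \dim {:Delta})%N.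
Proof.
have -> : (\sum_i m i * (x i * \dim {:D i}) = (\sum_i ell i * x i) * \dim {:Delta})%N.
  rewrite big_distrl /=; apply: eq_bigr => i _.
  by rewrite mulnAC ellE -mulnA [(x i * _)%N]mulnC.
rewrite /P /multiplicity_vectors /=; split=> [->//|/eqP].
by rewrite eqn_pmul2r ?falg_dim_gt0 // => /eqP ->.
Qed.

Lemma finite_multiplicity_vectors : finite_set P.
Proof.
pose f (y : {ffun 'I_t -> 'I_n.+1}) : {ffun 'I_t -> nat} := [ffun i => val (y i)].
apply: (@sub_finite_set _ _ (range f)); last by apply: finite_image; exact: finite_finset.
move=> x Px; exists [ffun i => inord (x i)] => //; apply/ffunP => i.
rewrite !ffunE /= inordK // ltnS Px (bigD1 i) //=.
by apply: leq_trans (leq_addr _ _); rewrite -{1}[x i]mul1n leq_mul2r ell_gt0 orbT.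
Qed.

(* [f] corresponds to the family [W] under orbits <-> right [T]-modules <->
   families of right [D' i]-modules. *)
Definition realizes (f : A -> 'M[Delta]_n) (W : forall i, rmod (D' i)) :=
  is_mx_alg_hom f /\
  exists2 M, models iDelta iA f M & forall i, corner Phi m_gt0 M (W i).

Lemma realizes_orbit f g W W' : realizes f W -> realizes g W' ->
  conj_orbit f = conj_orbit g <-> forall i, riso (W i) (W' i).
Proof.
move=> [_ [M mM cM]] [_ [N mN cN]].
by rewrite -(corner_riso isoPhi cM cN) -(models_riso tensT mM mN).
Qed.

Lemma realizes_exists (x : {ffun 'I_t -> nat}) (W : forall i, rmod (D' i)) :
  P x -> (forall i, \dim {:W i} = (x i * \dim {:D i})%N) -> exists f, realizes f W.
Proof.
move=> /multiplicity_dim Px dW; have [M cM] := corner_realize isoPhi m_gt0 W.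
have [|f [hf mf]] := @models_of_dim _ _ _ _ n _ _ tensT divDelta M.
  rewrite (corner_total_dim isoPhi cM) -Px.
  by apply: eq_bigr => i _; rewrite dW.
by exists f; split=> //; exists M.
Qed.

Lemma hom_realizes f : is_mx_alg_hom f -> exists (x : {ffun 'I_t -> nat}) W,
  [/\ realizes f W, P x & forall i, \dim {:W i} = (x i * \dim {:D i})%N].
Proof.
move=> hf; have [M mM] := models_exists tensT hf.
pose W i := projT1 (cid (corner_exists isoPhi m_gt0 i M)).
have cM i : corner Phi m_gt0 M (W i) := projT2 (cid (corner_exists isoPhi m_gt0 i M)).
have /boolp.choice[x xP] i : exists x, \dim {:W i} = (x * \dim {:D i})%N.
  by have [x _ ?] := rmod_has_length (divD (i := i)) (ssq i) (W i); exists x.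
exists [ffun i => x i], W; split.
- by split=> //; exists M.
- apply/multiplicity_dim; rewrite -(models_dim mM) (corner_total_dim isoPhi cM).
  by apply: eq_bigr => i _; rewrite xP ffunE.
- by move=> i; rewrite xP ffunE.
Qed.

Lemma orbit_count : (forall x, P x -> forall i, Mod_finite (D' i) (x i)) ->
  finite_set Orb /\
  ncard Orb = (\big[addn/0]_(x \in P) \prod_(i < t) Mod_card (D' i) (x i))%N.
Proof.
move=> finM; pose k (x : {ffun 'I_t -> nat}) i := Mod_card (D' i) (x i).
have repsE (x : {ffun 'I_t -> nat}) i : exists W : 'I_(k x i) -> rmod (D' i),
    P x -> rmod_reps (D i) (x i) W.
  case: (pselect (P x)) => [Px|nPx]; last by exists (fun _ => rzero _).
  have [k' hk] := finM x Px i; have := hk; rewrite -(Mod_cardE hk).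
  by move=> /(Mod_has_cardP (divD (i := i)) (ssq i))[W hW]; exists W.
pose W x i := projT1 (cid (repsE x i)).
have WP x i : P x -> rmod_reps (D i) (x i) (W x i) := projT2 (cid (repsE x i)).
pose X := fset_set P.
have XP (x : X) : P (val x).
  by have := valP x; rewrite in_fset_set ?inE //; exact: finite_multiplicity_vectors.
(* A multiplicity vector with a representative chosen at each index: [orb] maps [I] bijectively onto
   the orbits, and the cardinality of [I] is the sum of products. *)
pose I := {x : X & {dffun forall i : 'I_t, 'I_(k (val x) i)}}.
have /boolp.choice[f fP] (p : I) : exists f,
    realizes f (fun i => W (val (tag p)) i (tagged p i)).
  apply: (realizes_exists (XP (tag p))) => i.
  by have [dW _ _] := WP _ i (XP (tag p)).
pose orb p := conj_orbit (f p).
have orb_inj : injective orb.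
  move=> p q /(realizes_orbit (fP p) (fP q)) iso.
  have tagE : tag p = tag q.
    apply/val_inj/ffunP => i.
    have [dp _ _] := WP _ i (XP (tag p)); have [dq _ _] := WP _ i (XP (tag q)).
    have := riso_dim (iso i); rewrite dp dq => /eqP.
    by rewrite eqn_pmul2r ?falg_dim_gt0 // => /eqP.
  move: q tagE iso => [x b] /=; case: p => [y a] /= E; move: b; case: _ / E => b iso.
  congr existT; apply/ffunP => i.
  by have [_ inj _] := WP _ i (XP y); apply: inj; exact: iso.
have OrbE : Orb = range orb.
  apply/seteqP; split=> [_ [g hg <-]|_ [p _ <-]]; last first.
    by exists (f p) => //; case: (fP p).
  have [x [V [rV Px dV]]] := hom_realizes hg.
  have xX : x \in X.
    by rewrite in_fset_set ?inE //; exact: finite_multiplicity_vectors.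
  have aP i : exists a : 'I_(k x i), riso (V i) (W x i a).
    by have [_ _ sur] := WP x i Px; apply: sur; rewrite dV.
  pose a : {dffun forall i, 'I_(k x i)} := [ffun i => projT1 (cid (aP i))].
  exists (existT _ [` xX]%fset a : I) => //.
  apply/esym/(realizes_orbit rV (fP _)) => i /=.
  by rewrite ffunE; exact: (projT2 (cid (aP i))).
have finOrb : finite_set Orb by rewrite OrbE; apply: finite_image; exact: finite_finset.
split=> //.
have -> : ncard Orb = #|{: I}|.
  rewrite /ncard; have -> : fset_set Orb = [fset orb p | p in {: I}]%fset.
    apply/fsetP => O; rewrite in_fset_set //; apply/idP/imfsetP => /=.
      by rewrite inE OrbE => -[p _ <-]; exists p.
    by move=> [p _ ->]; rewrite inE OrbE; exists p.
  by rewrite card_imfset //= -cardE.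
rewrite fsbig_finite; last exact: finite_multiplicity_vectors.
rewrite card_tagged sumnE big_map big_enum /= big_seq_fsetE /=.
apply: eq_bigr => x _.
rewrite card_dep_ffun foldrE big_map big_enum /=.
by apply: eq_bigr => i _; rewrite card_ord.
Qed.

Variables (R mR : forall i, {vspace D' i}) (d e : 'I_t -> nat).
Hypothesis RE : forall i, R i = 'Z({:D' i})%VS.
Hypothesis maxm : forall i, maximal_ideal_of (R i) (mR i).
Hypothesis cot : forall i, has_cotangent_dim (R i) (mR i) (d i).
Hypothesis nilm : forall i, is_nilpotency_index (mR i) (e i).
Hypothesis frameD : forall i, central_frame (@central (D' i)).
Hypothesis redD : finite_set [set: F] -> forall i, reduced_center (D' i).

Lemma infinite_orbits x i : P x -> (2 <= d i)%N -> (2 <= x i)%N -> infinite_set Orb.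
Proof.
move=> Px d2 x2.
(* Over a finite field the centre of [D' i] is reduced, which forces [d i = 0]. *)
have infF : infinite_set [set: F].
  move=> finF.
  have := reduced_cotangent_dim (pi i) (divD (i := i)) (RE i) (maxm i) (nilm i)
    (redD finF (i := i)) (cot i).
  by move=> d0; rewrite d0 in d2.
have [W [dW Winj]] := infinite_rmod_family (divD (i := i)) (ssq i) (RE i) (maxm i)
  (nilm i) (frameD i) (cot i) d2 x2.
(* Only component [i] varies; the others are sums of residue modules of the prescribed length. *)
pose V lam := dfwith (fun j => rmod_power j (x j)) (W lam).
have /boolp.choice[f fP] lam : exists f, realizes f (V lam).
  apply: (realizes_exists Px) => j; rewrite /V.
  by case: dfwithP => [|j' _]; [exact: dW | exact: dim_rmod_power].
have inj : injective (fun lam => conj_orbit (f lam)).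
  move=> lam mu /(realizes_orbit (fP lam) (fP mu))/(_ i).
  by rewrite /V !dfwith_in; exact: Winj.
move=> finO; apply: infF.
have ui : {in [set: F] &, injective (fun lam => conj_orbit (f lam))}.
  by move=> a b _ _; exact: inj.
rewrite -(eq_finite_set (inj_card_eq ui)); apply: sub_finite_set finO.
by move=> _ [lam _ <-]; exists (f lam) => //; case: (fP lam).
Qed.

Lemma Mod_has_card_small i x : (d i < 2)%N \/ (x < 2)%N ->
  exists k, [/\ Mod_has_card (D' i) x k, (x <= 1)%N -> k = 1%N &
    (1 < x)%N -> d i = 1%N -> k = npartitions x (e i)].
Proof.
move=> dx; have [x1|x1] := leqP x 1.
  by exists 1%N; split=> //; exact: (Mod_has_card_le1 (divD (i := i)) (ssq i)).
have d1 : (d i <= 1)%N by case: dx => //; rewrite ltnNge x1.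
exists (npartitions x (e i)); split=> //.
exact: (Mod_has_card_uniserial (divD (i := i)) (ssq i) (RE i) (maxm i) (nilm i)
  (frameD i) x (cot i) d1).
Qed.

End Assembly.

Theorem theorem1p4 (F : fieldType) (A : falgType F) (Delta : falgType F)
    (n : nat)
    (* T = Delta (x)_F A^o *)
    (T : falgType F)
    (iDelta : {lrmorphism Delta -> T}) (iA : {lrmorphism A^c -> T})
    (* T ~ \prod_i 'M[D' i]_(m i), with (D' i)^ss = D i *)
    (t : nat) (m : 'I_t -> nat) (D' D : 'I_t -> falgType F)
    (Phi : forall i, T -> 'M[D' i]_(m i))
    (pi : forall i, {lrmorphism D' i -> D i})
    (* R i, its maximal ideal mR i, d i = dim_(Z_i) mR i / (mR i)^2 *)
    (R mR : forall i, {vspace D' i}) (d e : 'I_t -> nat) :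
  semisimple_algebra A ->
  division_algebra Delta -> (0 < n)%N ->
  is_tensor_product iDelta iA ->
  (forall i, 0 < m i)%N ->
  is_mx_prod_iso Phi ->
  (forall i, division_algebra (D i)) ->
  (forall i, is_ss_quotient (pi i)) ->
  (forall i, R i = 'Z({:D' i})%VS) ->
  (forall i, maximal_ideal_of (R i) (mR i)) ->
  (forall i, has_cotangent_dim (R i) (mR i) (d i)) ->
  (forall i, is_nilpotency_index (mR i) (e i)) ->
  let P := multiplicity_vectors Delta n m D in
  let Orb := orbit_set A Delta n in
  (infinite_set Orb <->
     exists2 x, P x & exists i, (2 <= d i)%N /\ (2 <= x i)%N)
  /\
  (finite_set Orb ->
     [/\ ncard Orb =
           (\big[addn/0]_(x \in P) \prod_(i < t) Mod_card (D' i) (x i))%N,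
         forall x, P x -> forall i, Mod_finite (D' i) (x i) &
         forall x, P x -> forall i,
           ((x i <= 1)%N -> Mod_card (D' i) (x i) = 1%N) /\
           ((1 < x i)%N -> d i = 1%N ->
              Mod_card (D' i) (x i) = npartitions (x i) (e i))]).
Proof.
move=> ssA divDelta n0 tensT m0 isoPhi divD ssq RE maxm cot nilm P Orb.
have ssDelta := division_semisimple divDelta.
have frameDelta := semisimple_frame ssDelta.
have frameA := central_frame_opp (semisimple_frame ssA).
have redDelta := semisimple_reduced_center ssDelta.
have redA := reduced_center_opp (semisimple_reduced_center ssA).
have frameD i : central_frame (@central (D' i)).
  exact: (mx_prod_frame isoPhi m0 i (tensor_central_frame tensT frameDelta frameA)).
have redD : finite_set [set: F] -> forall i, reduced_center (D' i).
  move=> finF i; apply: (mx_prod_reduced_center isoPhi m0).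
  exact: (tensor_reduced_center tensT frameDelta frameA redDelta redA).
have inf_orb := infinite_orbits (n := n) divDelta tensT m0 isoPhi divD ssq
  RE maxm cot nilm frameD redD.
have small i x : (d i < 2)%N \/ (x < 2)%N -> exists k,
    [/\ Mod_has_card (D' i) x k, (x <= 1)%N -> k = 1%N &
      (1 < x)%N -> d i = 1%N -> k = npartitions x (e i)].
  exact: (Mod_has_card_small divD ssq RE maxm cot nilm frameD).
have count := orbit_count (n := n) divDelta tensT m0 isoPhi divD ssq.
have smallP : ~ (exists2 x, P x & exists i, (2 <= d i)%N /\ (2 <= x i)%N) ->
    forall x, P x -> forall i, (d i < 2)%N \/ (x i < 2)%N.
  move=> h x Px i; case: (ltnP (d i) 2) => di; [by left | right].
  by rewrite ltnNge; apply/negP => xi; apply: h; exists x => //; exists i.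
have finM : (forall x, P x -> forall i, (d i < 2)%N \/ (x i < 2)%N) ->
    forall x, P x -> forall i, Mod_finite (D' i) (x i).
  by move=> h x Px i; have [k [hk _ _]] := small i (x i) (h x Px i); exists k.
split.
  (* By contraposition: without a bad pair [(x, i)] every [Mod] involved is finite, and the count
     then gives finitely many orbits. *)
  split=> [infO|[x Px [i [di xi]]]]; last exact: inf_orb Px di xi.
  by apply: contrapT => h; apply: infO; exact: (count (finM (smallP h))).1.
move=> finO.
have h : forall x, P x -> forall i, (d i < 2)%N \/ (x i < 2)%N.
  apply: smallP => -[x Px [i [di xi]]]; exact: inf_orb Px di xi finO.
split; first exact: (count (finM h)).2.
- exact: finM.
- move=> x Px i; have [k [hk k1 k2]] := small i (x i) (h x Px i).
  by rewrite (Mod_cardE hk).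
Qed.
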